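(* Let $\mathcal C$ be a $\mathbb K$-linear good enough symmetric monoidal category ($c$-good enough for the statements on $\mathfrak F_-$, $k$-good enough for those on $\mathfrak F_+$), let $C$ be a coPoisson Hopf monoid in $\mathcal C$ and $P$ a Poisson Hopf monoid in $\mathcal C$. Then the assignments $$\mathfrak F_-:\underline{\mathfrak{DY}}(C,\mathcal C)\to\mathcal C,\quad (V,\mu_V,\delta_V)\mapsto\mathrm{coker}(\mu_V-\varepsilon\otimes\mathrm{id}),\quad f\mapsto f|_{\mathrm{coker}},$$ $$\mathfrak F_+:\overline{\mathfrak{DY}}(P,\mathcal C)\to\mathcal C,\quad (V,\pi_V,\Delta_V)\mapsto\ker(\Delta_V-\mathrm{id}\otimes\eta),\quad f\mapsto f|_{\ker}$$ are functorial. Furthermore, the canonical morphisms (induced by the universal properties of (co)kernels) $$\mathfrak F_-^2(V,W):\mathrm{coker}(\mu_{V\otimes W}-\varepsilon\otimes\mathrm{id})\to\mathrm{coker}(\mu_V-\varepsilon\otimes\mathrm{id})\otimes\mathrm{coker}(\mu_W-\varepsilon\otimes\mathrm{id}),\qquad \mathfrak F_-^0:\mathrm{coker}(\mu_I-\varepsilon\otimes\mathrm{id})\to I,$$ $$\mathfrak F_{+,2}(V,W):\ker(\Delta_V-\mathrm{id}\otimes\eta)\otimes\ker(\Delta_W-\mathrm{id}\otimes\eta)\to\ker(\Delta_{V\otimes W}-\mathrm{id}\otimes\eta),\qquad \mathfrak F_{+,0}:I\to\ker(\Delta_I-\mathrm{id}\otimes\eta)$$ make $\mathfrak F_-$ (resp.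 $\mathfrak F_+$) an infinitesimally braided comonoidal (resp. monoidal) functor, where $\mathcal C$ carries the trivial infinitesimal braiding. Moreover, the functor $\mathfrak F_-(C_-\otimes-)$ (resp. $\mathfrak F_+(-\otimes P_+)$) is naturally isomorphic to the forgetful functor, hence $\mathfrak F_-$ is $C_-$-adapted (resp. $\mathfrak F_+$ is $P_+$-coadapted), and $\mathfrak F_-(C_-\otimes C_-)\cong C$ as coPoisson Hopf monoids (resp. $\mathfrak F_+(P_+\otimes P_+)\cong P$ as Poisson Hopf monoids).
   Context: $\mathbb K$ is a field of characteristic $0$. Hopf monoids have structure maps $\mu,\eta,\Delta,\varepsilon,S$ with invertible antipode; $1$ denotes $\eta$. Sweedler notation with generalized elements is used ($\Delta(c)=c_1\otimes c_2$, coaction $v\mapsto v_0\otimes v_1$, $\delta(c)=c'\otimes c''$, $\delta_V(v)=v_{[0]}\otimes v_{[1]}$); formulas abbreviate composites of structure maps and symmetries. Associativity and unit constraints are suppressed. $\mathcal C$ is $k$-good enough (resp. $c$-good enough) if it has all kernels (resp. cokernels) and every $Z\otimes-$ preserves them. **Cartier categories.** A symmetric Cartier category is a preadditive symmetric monoidal category with a natural transformation $t_{X,Y}:X\otimes Y\to X\otimes Y$ such that $\sigma_{X,Y}t_{X,Y}=t_{Y,X}\sigma_{X,Y}$ and $t_{X,Y\otimes Z}=t_{X,Y}\otimes\mathrm{id}_Z+(\sigma_{X,Y}^{-1}\otimes\mathrm{id})(\mathrm{id}_Y\otimes t_{X,Z})(\sigma_{X,Y}\otimes\mathrm{id})$.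 A braided comonoidal (resp. monoidal) functor is infinitesimally braided if $tF^2=F^2F(t)$ (resp. $F_2t=F(t)F_2$). **(co)Poisson Hopf monoids.** A coPoisson Hopf monoid is a cocommutative Hopf monoid $C$ with $\delta:C\to C\otimes C$ such that $\delta+\sigma\delta=0$, the cyclic sum of $(\mathrm{id}\otimes\delta)\delta$ is $0$, $c'_1\otimes c'_2\otimes c''=c_1\otimes c_2'\otimes c_2''+c_1'\otimes c_2\otimes c_1''$, $\delta(cd)=\delta(c)\Delta(d)+\Delta(c)\delta(d)$, $\delta\eta=0$, $(\varepsilon\otimes\mathrm{id})\delta=0$. A Poisson Hopf monoid is a commutative Hopf monoid $P$ with an antisymmetric $\{\cdot,\cdot\}:P\otimes P\to P$ satisfying the Jacobi identity, $\{pq,r\}=p\{q,r\}+\{p,r\}q$, $\Delta\{p,q\}=\{p_1,q_1\}\otimes p_2q_2+p_1q_1\otimes\{p_2,q_2\}$, $\varepsilon\{\cdot,\cdot\}=0$, $\{1,\cdot\}=0$. **Drinfeld–Yetter modules.** $\underline{\mathfrak{DY}}(C,\mathcal C)$: triples $(V,\mu_V,\delta_V)$, $V$ a left $C$-module and $\delta_V:V\to V\otimes C$ with $(\mathrm{id}\otimes\delta)\delta_V=(\delta_V\otimes\mathrm{id})\delta_V-\sigma_{(23)}(\delta_V\otimes\mathrm{id})\delta_V$; $(\mathrm{id}\otimes\Delta)\delta_V(v)=v_{[0]}\otimes1\otimes v_{[1]}+v_{[0]}\otimes v_{[1]}\otimes1$; $\delta_V(cv)=c_2'v\otimes c_2''S^{-1}(c_1)+c_2v_{[0]}\otimes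 c_3v_{[1]}S^{-1}(c_1)$; tensor product $c(v\otimes w)=c_1v\otimes c_2w$, $\delta_{V\otimes W}(v\otimes w)=v_{[0]}\otimes w\otimes v_{[1]}+v\otimes w_{[0]}\otimes w_{[1]}$; symmetry that of $\mathcal C$; $t(v\otimes w)=-v_{[0]}\otimes v_{[1]}w-w_{[1]}v\otimes w_{[0]}$. $\overline{\mathfrak{DY}}(P,\mathcal C)$: triples $(V,\pi_V,\Delta_V)$, $V$ a right $P$-comodule and $\pi_V:P\otimes V\to V$, written $p\cdot v$, with $\{p,q\}\cdot v=p\cdot(q\cdot v)-q\cdot(p\cdot v)$; $(pq)\cdot v=\varepsilon(p)q\cdot v+\varepsilon(q)p\cdot v$; $\Delta_V(p\cdot v)=v_0\otimes\{p_2,v_1\}S^{-1}(p_1)+p_2\cdot v_0\otimes p_3v_1S^{-1}(p_1)$; tensor product $p\cdot(v\otimes w)=p\cdot v\otimes w+v\otimes p\cdot w$, coaction $v_0\otimes w_0\otimes v_1w_1$; symmetry that of $\mathcal C$; $t(v\otimes w)=-v_0\otimes v_1\cdot w-w_1\cdot v\otimes w_0$. Morphisms commute with both structure maps. Both are symmetric Cartier categories. $C_-=(C,\mu,\delta_-)$, $\delta_-(c)=c_2'\otimes c_2''S^{-1}(c_1)$, with comonoid structure $\Delta,\varepsilon$; $P_+=(P,\pi_+,\Delta)$, $\pi_+(p\otimes q)=\{p_2,q\}S^{-1}(p_1)$, with monoid structure $\mu,\eta$. **Adapted functors.** A braided comonoidal functor $(F,F^2,F^0):\mathcal B\to\mathcal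 C$ is $M$-adapted, $M$ a comonoid in $\mathcal B$, if $\chi_M=F^0F(\varepsilon_M)$ and $\gamma^M_{X,Y}=F^2(X\otimes M,M\otimes Y)F(\mathrm{id}_X\otimes\Delta_M\otimes\mathrm{id}_Y)$ are invertible for all $X,Y$. If $\mathcal B$ is symmetric Cartier, $\sigma\Delta_M=\Delta_M$, $t\Delta_M=0$ and $F$ is infinitesimally braided, $F(M\otimes M)$ is a coPoisson Hopf monoid with $\mu=F(\mathrm{id}\otimes\varepsilon_M\otimes\mathrm{id})(\gamma^M_{M,M})^{-1}$, $\eta=F(\Delta_M)\chi_M^{-1}$, $\Delta=F^2F(\beta)F(\Delta_M\otimes\Delta_M)$, $\varepsilon=F^0F(\varepsilon_M\otimes\varepsilon_M)$, $S=F(\sigma_{M,M})$, $\delta=\frac12(\mathrm{id}-\sigma)F^2F(\beta^t)F(\Delta_M\otimes\Delta_M)$, where $\beta$ (resp. $\beta^t$) applies $\sigma_{M,M}$ (resp. $\sigma_{M,M}t_{M,M}$) to the two middle factors. A braided monoidal functor $(F,F_2,F_0)$ is $A$-coadapted, $A$ a monoid, if $\vartheta_A=F(\eta_A)F_0$ and $\psi^A_{X,Y}=F(\mathrm{id}\otimes\mu_A\otimes\mathrm{id})F_2(X\otimes A,A\otimes Y)$ are invertible; if $\mathcal B$ is symmetric Cartier, $\mu_A\sigma=\mu_A$, $\mu_At=0$ and $F$ is infinitesimally braided, $F(A\otimes A)$ is a Poisson Hopf monoid with $\mu=F(\mu_A\otimes\mu_A)F(\beta)F_2$, $\eta=F(\eta_A\otimes\eta_A)F_0$,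 $\Delta=(\psi^A_{A,A})^{-1}F(\mathrm{id}\otimes\eta_A\otimes\mathrm{id})$, $\varepsilon=\vartheta_A^{-1}F(\mu_A)$, $S=F(\sigma_{A,A})$, $\{\cdot,\cdot\}=\frac12F(\mu_A\otimes\mu_A)F(\beta^t)F_2(\mathrm{id}-\sigma)$. *)

(* Defs.v *)
From HB Require Import structures.
From mathcomp Require Import all_boot all_algebra.

Set Implicit Arguments.
Unset Strict Implicit.
Unset Printing Implicit Defensive.

Import GRing.Theory.

Declare Scope cat_scope.
Delimit Scope cat_scope with cat.
Local Open Scope ring_scope.
Local Open Scope cat_scope.

(* Linear categories: hom-modules over R, bilinear composition.  The case     *)
(* R = int is that of preadditive categories.                                 *)

Record linCat (R : comPzRingType) := LinCat {
  Ob :> Type;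
  Mor : Ob -> Ob -> lmodType R;
  idm : forall X, Mor X X;
  comp : forall X Y Z, Mor Y Z -> Mor X Y -> Mor X Z;
  compA : forall X Y Z T (h : Mor Z T) (g : Mor Y Z) (f : Mor X Y),
    comp h (comp g f) = comp (comp h g) f;
  comp1m : forall X Y (f : Mor X Y), comp (idm Y) f = f;
  compm1 : forall X Y (f : Mor X Y), comp f (idm X) = f;
  comp_linl : forall X Y Z (f : Mor X Y) a (g g' : Mor Y Z),
    comp (a *: g + g') f = a *: comp g f + comp g' f;
  comp_linr : forall X Y Z (g : Mor Y Z) a (f f' : Mor X Y),
    comp g (a *: f + f') = a *: comp g f + comp g f'
}.

Arguments Mor {R l}.
Arguments idm {R l}.
Arguments comp {R l X Y Z}.

Notation "g ∘ f" := (comp g f) (at level 37, right associativity) : cat_scope.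

(* Symmetric monoidal linear categories, with explicit associativity and unit *)
(* isomorphisms.                                                              *)

Record symMonCat (R : comPzRingType) := SymMonCat {
  smCat :> linCat R;
  tens : smCat -> smCat -> smCat;
  tunit : smCat;
  tensm : forall X Y X' Y' : smCat,
    Mor X Y -> Mor X' Y' -> Mor (tens X X') (tens Y Y');
  assoc : forall X Y Z : smCat, Mor (tens (tens X Y) Z) (tens X (tens Y Z));
  associ : forall X Y Z : smCat, Mor (tens X (tens Y Z)) (tens (tens X Y) Z);
  lunit : forall X : smCat, Mor (tens tunit X) X;
  luniti : forall X : smCat, Mor X (tens tunit X);
  runit : forall X : smCat, Mor (tens X tunit) X;
  runiti : forall X : smCat, Mor X (tens X tunit);
  sym : forall X Y : smCat, Mor (tens X Y) (tens Y X);
  tensm1 : forall X Y : smCat, tensm (idm X) (idm Y) = idm (tens X Y);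
  tensm_comp : forall (X Y Z X' Y' Z' : smCat) (g : Mor Y Z) (f : Mor X Y)
      (g' : Mor Y' Z') (f' : Mor X' Y'),
    tensm (g ∘ f) (g' ∘ f') = tensm g g' ∘ tensm f f';
  tensm_linl : forall (X Y X' Y' : smCat) (h : Mor X' Y') a (f g : Mor X Y),
    tensm (a *: f + g) h = a *: tensm f h + tensm g h;
  tensm_linr : forall (X Y X' Y' : smCat) (h : Mor X Y) a (f g : Mor X' Y'),
    tensm h (a *: f + g) = a *: tensm h f + tensm h g;
  assocK : forall X Y Z, associ X Y Z ∘ assoc X Y Z = idm _;
  associK : forall X Y Z, assoc X Y Z ∘ associ X Y Z = idm _;
  lunitK : forall X, luniti X ∘ lunit X = idm _;
  lunitiK : forall X, lunit X ∘ luniti X = idm _;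
  runitK : forall X, runiti X ∘ runit X = idm _;
  runitiK : forall X, runit X ∘ runiti X = idm _;
  symK : forall X Y, sym Y X ∘ sym X Y = idm _;
  assoc_nat : forall (X Y Z X' Y' Z' : smCat) (f : Mor X X') (g : Mor Y Y')
      (h : Mor Z Z'),
    assoc X' Y' Z' ∘ tensm (tensm f g) h = tensm f (tensm g h) ∘ assoc X Y Z;
  lunit_nat : forall (X Y : smCat) (f : Mor X Y),
    lunit Y ∘ tensm (idm tunit) f = f ∘ lunit X;
  runit_nat : forall (X Y : smCat) (f : Mor X Y),
    runit Y ∘ tensm f (idm tunit) = f ∘ runit X;
  sym_nat : forall (X Y X' Y' : smCat) (f : Mor X X') (g : Mor Y Y'),
    sym X' Y' ∘ tensm f g = tensm g f ∘ sym X Y;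
  pentagon : forall W X Y Z : smCat,
    assoc W X (tens Y Z) ∘ assoc (tens W X) Y Z =
    tensm (idm W) (assoc X Y Z) ∘ assoc W (tens X Y) Z
      ∘ tensm (assoc W X Y) (idm Z);
  triangle : forall X Y : smCat,
    tensm (idm X) (lunit Y) ∘ assoc X tunit Y = tensm (runit X) (idm Y);
  hexagon : forall X Y Z : smCat,
    assoc Y Z X ∘ sym X (tens Y Z) ∘ assoc X Y Z =
    tensm (idm Y) (sym X Z) ∘ assoc Y X Z ∘ tensm (sym X Y) (idm Z)
}.

Arguments tens {R s}.
Arguments tunit {R s}.
Arguments tensm {R s X Y X' Y'}.
Arguments assoc {R s}.
Arguments associ {R s}.
Arguments lunit {R s}.
Arguments luniti {R s}.
Arguments runit {R s}.
Arguments runiti {R s}.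
Arguments sym {R s}.

Notation "X ⊗ Y" := (tens X Y) (at level 32, left associativity) : cat_scope.
Notation "f ⊠ g" := (tensm f g) (at level 32, left associativity) : cat_scope.

Section Rearrangements.
Variables (R : comPzRingType) (C : symMonCat R).
Implicit Types X Y Z W : C.

(* x ⊗ (y ⊗ z) |-> y ⊗ (z ⊗ x) *)
Definition cyc X Y Z : Mor (X ⊗ (Y ⊗ Z)) (Y ⊗ (Z ⊗ X)) :=
  assoc Y Z X ∘ sym X (Y ⊗ Z).

(* x ⊗ (y ⊗ z) |-> y ⊗ (x ⊗ z) *)
Definition swap12 X Y Z : Mor (X ⊗ (Y ⊗ Z)) (Y ⊗ (X ⊗ Z)) :=
  assoc Y X Z ∘ (sym X Y ⊠ idm Z) ∘ associ X Y Z.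

(* (x ⊗ y) ⊗ z |-> (x ⊗ z) ⊗ y *)
Definition swap23 X Y Z : Mor (X ⊗ Y ⊗ Z) (X ⊗ Z ⊗ Y) :=
  associ X Z Y ∘ (idm X ⊠ sym Y Z) ∘ assoc X Y Z.

(* apply h to the two middle factors *)
Definition mid X Y Y' Z W W' (h : Mor (Y ⊗ Y') (W ⊗ W')) :
    Mor ((X ⊗ Y) ⊗ (Y' ⊗ Z)) ((X ⊗ W) ⊗ (W' ⊗ Z)) :=
  associ X W (W' ⊗ Z)
    ∘ (idm X ⊠ (assoc W W' Z ∘ (h ⊠ idm Z) ∘ associ Y Y' Z))
    ∘ assoc X Y (Y' ⊗ Z).

Definition swapmid X Y Z W : Mor ((X ⊗ Y) ⊗ (Z ⊗ W)) ((X ⊗ Z) ⊗ (Y ⊗ W)) :=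
  mid X W (sym Y Z).

(* id_X ⊗ d ⊗ id_Y for d : M -> M ⊗ M *)
Definition splitm X Y M (d : Mor M (M ⊗ M)) :
    Mor ((X ⊗ M) ⊗ Y) ((X ⊗ M) ⊗ (M ⊗ Y)) :=
  assoc (X ⊗ M) M Y ∘ ((associ X M M ∘ (idm X ⊠ d)) ⊠ idm Y).

(* id_X ⊗ m ⊗ id_Y for m : A ⊗ A -> A *)
Definition mergem X Y A (m : Mor (A ⊗ A) A) :
    Mor ((X ⊗ A) ⊗ (A ⊗ Y)) ((X ⊗ A) ⊗ Y) :=
  (((idm X ⊠ m) ∘ assoc X A A) ⊠ idm Y) ∘ associ (X ⊗ A) A Y.

(* id_X ⊗ e ⊗ id_Y for e : M -> I *)
Definition dropm X Y M (e : Mor M tunit) : Mor ((X ⊗ M) ⊗ Y) (X ⊗ Y) :=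
  (runit X ∘ (idm X ⊠ e)) ⊠ idm Y.

(* id_X ⊗ u ⊗ id_Y for u : I -> A *)
Definition insertm X Y A (u : Mor tunit A) : Mor (X ⊗ Y) ((X ⊗ A) ⊗ Y) :=
  ((idm X ⊠ u) ∘ runiti X) ⊠ idm Y.

End Rearrangements.

Record isInverse (R : comPzRingType) (C : linCat R) (X Y : C)
    (f : Mor X Y) (g : Mor Y X) : Prop := IsInverse {
  invl : g ∘ f = idm X;
  invr : f ∘ g = idm Y
}.

Record cartierCat (R : comPzRingType) := CartierCat {
  caCat :> symMonCat R;
  tinf : forall X Y : caCat, Mor (X ⊗ Y) (X ⊗ Y);
  tinf_nat : forall (X X' Y Y' : caCat) (f : Mor X X') (g : Mor Y Y'),
    tinf X' Y' ∘ (f ⊠ g) = (f ⊠ g) ∘ tinf X Y;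
  tinf_sym : forall X Y, sym X Y ∘ tinf X Y = tinf Y X ∘ sym X Y;
  tinf_tens : forall X Y Z,
    tinf X (Y ⊗ Z) =
    assoc X Y Z ∘ (tinf X Y ⊠ idm Z) ∘ associ X Y Z
    + assoc X Y Z ∘ (sym Y X ⊠ idm Z) ∘ associ Y X Z
        ∘ (idm Y ⊠ tinf X Z)
        ∘ assoc Y X Z ∘ (sym X Y ⊠ idm Z) ∘ associ X Y Z
}.

Arguments tinf {R c}.

Section LinearityFacts.
Variable (R : comPzRingType).

Lemma comp0m (C : linCat R) (X Y Z : C) (f : Mor X Y) :
  (0 : Mor Y Z) ∘ f = 0.
Proof.
have := comp_linl f 1 0 (0 : Mor Y Z).
rewrite !scale1r addr0 => /(congr1 (fun h => h - (0 : Mor Y Z) ∘ f)).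
by rewrite addrK subrr.
Qed.

Lemma compm0 (C : linCat R) (X Y Z : C) (g : Mor Y Z) :
  g ∘ (0 : Mor X Y) = 0.
Proof.
have := comp_linr g 1 0 (0 : Mor X Y).
rewrite !scale1r addr0 => /(congr1 (fun h => h - g ∘ (0 : Mor X Y))).
by rewrite addrK subrr.
Qed.

Lemma tens0m (C : symMonCat R) (X Y X' Y' : C) (h : Mor X' Y') :
  (0 : Mor X Y) ⊠ h = 0.
Proof.
have := tensm_linl h 1 0 (0 : Mor X Y).
rewrite !scale1r addr0 => /(congr1 (fun k => k - (0 : Mor X Y) ⊠ h)).
by rewrite addrK subrr.
Qed.

Lemma tensm0 (C : symMonCat R) (X Y X' Y' : C) (h : Mor X Y) :
  h ⊠ (0 : Mor X' Y') = 0.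
Proof.
have := tensm_linr h 1 0 (0 : Mor X' Y').
rewrite !scale1r addr0 => /(congr1 (fun k => k - h ⊠ (0 : Mor X' Y'))).
by rewrite addrK subrr.
Qed.

End LinearityFacts.

Definition trivialCartier (R : comPzRingType) (C : symMonCat R) : cartierCat R.
Proof.
refine (@CartierCat R C (fun X Y => 0) _ _ _).
- by move=> X X' Y Y' f g; rewrite comp0m compm0.
- by move=> X Y; rewrite comp0m compm0.
- by move=> X Y Z; rewrite tens0m tensm0 !comp0m !compm0 addr0.
Defined.

Section Cokernels.
Variables (R : comPzRingType) (C : symMonCat R).

Definition isCoker (X Y Q : C) (f : Mor X Y) (p : Mor Y Q) : Prop :=
  p ∘ f = 0 /\
  forall (Z : C) (g : Mor Y Z), g ∘ f = 0 -> exists! h : Mor Q Z, h ∘ p = g.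

Definition isKer (X Y N : C) (f : Mor X Y) (i : Mor N X) : Prop :=
  f ∘ i = 0 /\
  forall (Z : C) (g : Mor Z X), f ∘ g = 0 -> exists! h : Mor Z N, i ∘ h = g.

(* A choice of all cokernels, preserved by every Z ⊗ -. *)
Record cGoodEnough := CGoodEnough {
  coker : forall X Y : C, Mor X Y -> C;
  cokerp : forall (X Y : C) (f : Mor X Y), Mor Y (coker f);
  cokerP : forall (X Y : C) (f : Mor X Y), isCoker f (cokerp f);
  coker_tens : forall (Z X Y Q : C) (f : Mor X Y) (p : Mor Y Q),
    isCoker f p -> isCoker (idm Z ⊠ f) (idm Z ⊠ p)
}.

(* A choice of all kernels, preserved by every Z ⊗ -. *)
Record kGoodEnough := KGoodEnough {
  ker : forall X Y : C, Mor X Y -> C;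
  keri : forall (X Y : C) (f : Mor X Y), Mor (ker f) X;
  kerP : forall (X Y : C) (f : Mor X Y), isKer f (keri f);
  ker_tens : forall (Z X Y N : C) (f : Mor X Y) (i : Mor N X),
    isKer f i -> isKer (idm Z ⊠ f) (idm Z ⊠ i)
}.

End Cokernels.

(* A functor structure on a given map F on objects.                           *)

Record functor (R : comPzRingType) (B C : linCat R) (F : B -> C) := Functor {
  fmor : forall X Y : B, Mor X Y -> Mor (F X) (F Y);
  fmor1 : forall X, fmor (idm X) = idm (F X);
  fmor_comp : forall (X Y Z : B) (g : Mor Y Z) (f : Mor X Y),
    fmor (g ∘ f) = fmor g ∘ fmor f
}.

Arguments fmor {R B C F} _ {X Y} _.

Section FunctorOps.
Variable (R : comPzRingType).

Definition functor_comp (A B C : linCat R) (G : B -> C) (F : A -> B)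
    (gG : functor G) (fF : functor F) : functor (fun X : A => G (F X)).
Proof.
refine (@Functor R A C (fun X => G (F X)) (fun X Y f => fmor gG (fmor fF f)) _ _).
- by move=> X; rewrite !fmor1.
- by move=> X Y Z g f; rewrite !fmor_comp.
Defined.

Definition tens_left (B : symMonCat R) (M : B) : functor (fun X : B => M ⊗ X).
Proof.
refine (@Functor R B B (fun X => M ⊗ X) (fun X Y f => idm M ⊠ f) _ _).
- by move=> X; rewrite tensm1.
- by move=> X Y Z g f; rewrite -tensm_comp comp1m.
Defined.

Definition tens_right (B : symMonCat R) (M : B) : functor (fun X : B => X ⊗ M).
Proof.
refine (@Functor R B B (fun X => X ⊗ M) (fun X Y f => f ⊠ idm M) _ _).
- by move=> X; rewrite tensm1.
- by move=> X Y Z g f; rewrite -tensm_comp comp1m.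
Defined.

Definition naturally_isomorphic (B C : linCat R) (F G : B -> C)
    (fF : functor F) (fG : functor G) : Prop :=
  exists (u : forall X, Mor (F X) (G X)) (v : forall X, Mor (G X) (F X)),
    (forall X, isInverse (u X) (v X)) /\
    (forall (X Y : B) (f : Mor X Y), u Y ∘ fmor fF f = fmor fG f ∘ u X).

End FunctorOps.

Section MonoidalFunctors.
Variables (R : comPzRingType) (B C : symMonCat R) (F : B -> C).
Variable fF : functor F.

Record comonoidal := Comonoidal {
  cF2 : forall X Y : B, Mor (F (X ⊗ Y)) (F X ⊗ F Y);
  cF0 : Mor (F tunit) tunit;
  cF2_nat : forall (X Y X' Y' : B) (f : Mor X X') (g : Mor Y Y'),
    cF2 X' Y' ∘ fmor fF (f ⊠ g) = (fmor fF f ⊠ fmor fF g) ∘ cF2 X Y;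
  cF2_assoc : forall X Y Z : B,
    assoc (F X) (F Y) (F Z) ∘ (cF2 X Y ⊠ idm (F Z)) ∘ cF2 (X ⊗ Y) Z =
    (idm (F X) ⊠ cF2 Y Z) ∘ cF2 X (Y ⊗ Z) ∘ fmor fF (assoc X Y Z);
  cF2_lunit : forall X : B,
    lunit (F X) ∘ (cF0 ⊠ idm (F X)) ∘ cF2 tunit X = fmor fF (lunit X);
  cF2_runit : forall X : B,
    runit (F X) ∘ (idm (F X) ⊠ cF0) ∘ cF2 X tunit = fmor fF (runit X)
}.

Definition comonoidal_braided (c : comonoidal) : Prop := forall X Y : B,
  cF2 c Y X ∘ fmor fF (sym X Y) = sym (F X) (F Y) ∘ cF2 c X Y.

Record monoidal := Monoidal {
  mF2 : forall X Y : B, Mor (F X ⊗ F Y) (F (X ⊗ Y));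
  mF0 : Mor tunit (F tunit);
  mF2_nat : forall (X Y X' Y' : B) (f : Mor X X') (g : Mor Y Y'),
    fmor fF (f ⊠ g) ∘ mF2 X Y = mF2 X' Y' ∘ (fmor fF f ⊠ fmor fF g);
  mF2_assoc : forall X Y Z : B,
    fmor fF (assoc X Y Z) ∘ mF2 (X ⊗ Y) Z ∘ (mF2 X Y ⊠ idm (F Z)) =
    mF2 X (Y ⊗ Z) ∘ (idm (F X) ⊠ mF2 Y Z) ∘ assoc (F X) (F Y) (F Z);
  mF2_lunit : forall X : B,
    fmor fF (lunit X) ∘ mF2 tunit X ∘ (mF0 ⊠ idm (F X)) = lunit (F X);
  mF2_runit : forall X : B,
    fmor fF (runit X) ∘ mF2 X tunit ∘ (idm (F X) ⊠ mF0) = runit (F X)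
}.

Definition monoidal_braided (c : monoidal) : Prop := forall X Y : B,
  fmor fF (sym X Y) ∘ mF2 c X Y = mF2 c Y X ∘ sym (F X) (F Y).

End MonoidalFunctors.

Definition comonoidal_inf_braided (R : comPzRingType) (B C : cartierCat R)
    (F : B -> C) (fF : functor F) (c : comonoidal fF) : Prop :=
  comonoidal_braided c /\
  forall X Y : B, tinf (F X) (F Y) ∘ cF2 c X Y = cF2 c X Y ∘ fmor fF (tinf X Y).

Definition monoidal_inf_braided (R : comPzRingType) (B C : cartierCat R)
    (F : B -> C) (fF : functor F) (c : monoidal fF) : Prop :=
  monoidal_braided c /\
  forall X Y : B, mF2 c X Y ∘ tinf (F X) (F Y) = fmor fF (tinf X Y) ∘ mF2 c X Y.

Section Monoids.
Variables (R : comPzRingType) (C : symMonCat R).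

Record comonoid := Comonoid {
  cm_ob :> C;
  cm_comul : Mor cm_ob (cm_ob ⊗ cm_ob);
  cm_counit : Mor cm_ob tunit;
  cm_coassoc : assoc _ _ _ ∘ (cm_comul ⊠ idm _) ∘ cm_comul =
    (idm _ ⊠ cm_comul) ∘ cm_comul;
  cm_counitl : lunit _ ∘ (cm_counit ⊠ idm _) ∘ cm_comul = idm _;
  cm_counitr : runit _ ∘ (idm _ ⊠ cm_counit) ∘ cm_comul = idm _
}.

Record monoid := Monoid {
  mo_ob :> C;
  mo_mul : Mor (mo_ob ⊗ mo_ob) mo_ob;
  mo_one : Mor tunit mo_ob;
  mo_assoc : mo_mul ∘ (mo_mul ⊠ idm _) =
    mo_mul ∘ (idm _ ⊠ mo_mul) ∘ assoc _ _ _;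
  mo_onel : mo_mul ∘ (mo_one ⊠ idm _) = lunit _;
  mo_oner : mo_mul ∘ (idm _ ⊠ mo_one) = runit _
}.

(* The inverse Si of the antipode is part of the data; it is determined by S. *)
Record hopfData := HopfData {
  ho_ob :> C;
  mul : Mor (ho_ob ⊗ ho_ob) ho_ob;
  one : Mor tunit ho_ob;
  comul : Mor ho_ob (ho_ob ⊗ ho_ob);
  counit : Mor ho_ob tunit;
  antip : Mor ho_ob ho_ob;
  antipi : Mor ho_ob ho_ob
}.

Definition mul2 (H : hopfData) : Mor ((H ⊗ H) ⊗ (H ⊗ H)) (H ⊗ H) :=
  (mul H ⊠ mul H) ∘ swapmid H H H H.

Definition comul2 (H : hopfData) : Mor (H ⊗ H) ((H ⊗ H) ⊗ (H ⊗ H)) :=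
  swapmid H H H H ∘ (comul H ⊠ comul H).

Record isHopf (H : hopfData) : Prop := IsHopf {
  mulA : mul H ∘ (mul H ⊠ idm H) = mul H ∘ (idm H ⊠ mul H) ∘ assoc H H H;
  mul1l : mul H ∘ (one H ⊠ idm H) = lunit H;
  mul1r : mul H ∘ (idm H ⊠ one H) = runit H;
  comulA : assoc H H H ∘ (comul H ⊠ idm H) ∘ comul H =
    (idm H ⊠ comul H) ∘ comul H;
  counitl : lunit H ∘ (counit H ⊠ idm H) ∘ comul H = idm H;
  counitr : runit H ∘ (idm H ⊠ counit H) ∘ comul H = idm H;
  comul_mul : comul H ∘ mul H = mul2 H ∘ (comul H ⊠ comul H);
  comul_one : comul H ∘ one H = (one H ⊠ one H) ∘ luniti tunit;
  counit_mul : counit H ∘ mul H = lunit tunit ∘ (counit H ⊠ counit H);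
  counit_one : counit H ∘ one H = idm tunit;
  antipl : mul H ∘ (antip H ⊠ idm H) ∘ comul H = one H ∘ counit H;
  antipr : mul H ∘ (idm H ⊠ antip H) ∘ comul H = one H ∘ counit H;
  antip_inv : isInverse (antip H) (antipi H)
}.

Record coPoissonData := CoPoissonData {
  cp_hopf :> hopfData;
  cobr : Mor cp_hopf (cp_hopf ⊗ cp_hopf)
}.

Record isCoPoissonHopf (H : coPoissonData) : Prop := IsCoPoissonHopf {
  cp_isHopf : isHopf H;
  cp_cocomm : sym H H ∘ comul H = comul H;
  cobr_anti : cobr H + sym H H ∘ cobr H = 0;
  cobr_jacobi :
    (idm H ⊠ cobr H) ∘ cobr H
    + cyc H H H ∘ (idm H ⊠ cobr H) ∘ cobr H
    + cyc H H H ∘ cyc H H H ∘ (idm H ⊠ cobr H) ∘ cobr H = 0;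
  cobr_comul : (comul H ⊠ idm H) ∘ cobr H =
    associ H H H ∘ (idm H ⊠ cobr H) ∘ comul H
    + swap23 H H H ∘ (cobr H ⊠ idm H) ∘ comul H;
  cobr_mul : cobr H ∘ mul H =
    mul2 H ∘ (cobr H ⊠ comul H) + mul2 H ∘ (comul H ⊠ cobr H);
  cobr_one : cobr H ∘ one H = 0;
  cobr_counit : (counit H ⊠ idm H) ∘ cobr H = 0
}.

Record coPoissonHopf := CoPoissonHopf {
  cp_data :> coPoissonData;
  cp_ax : isCoPoissonHopf cp_data
}.

Record poissonData := PoissonData {
  po_hopf :> hopfData;
  br : Mor (po_hopf ⊗ po_hopf) po_hopf
}.

Record isPoissonHopf (H : poissonData) : Prop := IsPoissonHopf {
  po_isHopf : isHopf H;
  po_comm : mul H ∘ sym H H = mul H;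
  br_anti : br H + br H ∘ sym H H = 0;
  br_jacobi :
    br H ∘ (idm H ⊠ br H)
    + br H ∘ (idm H ⊠ br H) ∘ cyc H H H
    + br H ∘ (idm H ⊠ br H) ∘ cyc H H H ∘ cyc H H H = 0;
  br_mul : br H ∘ (mul H ⊠ idm H) =
    mul H ∘ (idm H ⊠ br H) ∘ assoc H H H
    + mul H ∘ (br H ⊠ idm H) ∘ swap23 H H H;
  br_comul : comul H ∘ br H =
    (br H ⊠ mul H) ∘ comul2 H + (mul H ⊠ br H) ∘ comul2 H;
  br_counit : counit H ∘ br H = 0;
  br_one : br H ∘ (one H ⊠ idm H) = 0
}.

Record poissonHopf := PoissonHopf {
  po_data :> poissonData;
  po_ax : isPoissonHopf po_data
}.

Record hopfMor (H H' : hopfData) (f : Mor H H') : Prop := HopfMor {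
  hm_mul : f ∘ mul H = mul H' ∘ (f ⊠ f);
  hm_one : f ∘ one H = one H';
  hm_comul : (f ⊠ f) ∘ comul H = comul H' ∘ f;
  hm_counit : counit H' ∘ f = counit H;
  hm_antip : f ∘ antip H = antip H' ∘ f
}.

Definition coPoissonHopf_iso (H H' : coPoissonData) : Prop :=
  exists (f : Mor H H') (g : Mor H' H),
    [/\ isInverse f g, hopfMor f & (f ⊠ f) ∘ cobr H = cobr H' ∘ f].

Definition poissonHopf_iso (H H' : poissonData) : Prop :=
  exists (f : Mor H H') (g : Mor H' H),
    [/\ isInverse f g, hopfMor f & f ∘ br H = br H' ∘ (f ⊠ f)].

End Monoids.

Section Adapted.
Variables (R : comPzRingType) (B C : symMonCat R) (F : B -> C).
Variables (fF : functor F).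

Section Comonoidal.
Variables (c : comonoidal fF) (M : comonoid B).

Definition ad_chi : Mor (F M) tunit := cF0 c ∘ fmor fF (cm_counit M).

Definition ad_gamma (X Y : B) : Mor (F (X ⊗ M ⊗ Y)) (F (X ⊗ M) ⊗ F (M ⊗ Y)) :=
  cF2 c (X ⊗ M) (M ⊗ Y) ∘ fmor fF (splitm X Y (cm_comul M)).

(* M-adaptedness, with the (unique) inverses as data. *)
Record adapted := Adapted {
  ad_chii : Mor tunit (F M);
  ad_gammai : forall X Y : B, Mor (F (X ⊗ M) ⊗ F (M ⊗ Y)) (F (X ⊗ M ⊗ Y));
  ad_chiK : isInverse ad_chi ad_chii;
  ad_gammaK : forall X Y : B, isInverse (ad_gamma X Y) (ad_gammai X Y)
}.

End Comonoidal.

Section Monoidal.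
Variables (c : monoidal fF) (A : monoid B).

Definition coad_theta : Mor tunit (F A) := fmor fF (mo_one A) ∘ mF0 c.

Definition coad_psi (X Y : B) : Mor (F (X ⊗ A) ⊗ F (A ⊗ Y)) (F (X ⊗ A ⊗ Y)) :=
  fmor fF (mergem X Y (mo_mul A)) ∘ mF2 c (X ⊗ A) (A ⊗ Y).

(* A-coadaptedness, with the (unique) inverses as data. *)
Record coadapted := Coadapted {
  coad_thetai : Mor (F A) tunit;
  coad_psii : forall X Y : B, Mor (F (X ⊗ A ⊗ Y)) (F (X ⊗ A) ⊗ F (A ⊗ Y));
  coad_thetaK : isInverse coad_theta coad_thetai;
  coad_psiK : forall X Y : B, isInverse (coad_psi X Y) (coad_psii X Y)
}.

End Monoidal.

End Adapted.

Section AdaptedHopf.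
Variables (K : fieldType) (B : cartierCat K) (C : symMonCat K) (F : B -> C).
Variable (fF : functor F).

Definition adaptedCoPoisson (c : comonoidal fF) (M : comonoid B)
    (ad : adapted c M) : coPoissonData C :=
  let D := fmor fF (cm_comul M ⊠ cm_comul M) in
  CoPoissonData (cp_hopf := {|
    ho_ob := F (M ⊗ M);
    mul := fmor fF (dropm M M (cm_counit M)) ∘ ad_gammai ad M M;
    one := fmor fF (cm_comul M) ∘ ad_chii ad;
    comul := cF2 c (M ⊗ M) (M ⊗ M) ∘ fmor fF (mid M M (sym M M)) ∘ D;
    counit := cF0 c
      ∘ fmor fF (lunit tunit ∘ (cm_counit M ⊠ cm_counit M));
    antip := fmor fF (sym M M);
    antipi := fmor fF (sym M M) |})
  (2%:R^-1 *:
     ((idm _ - sym _ _) ∘ cF2 c (M ⊗ M) (M ⊗ M)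
        ∘ fmor fF (mid M M (sym M M ∘ tinf M M)) ∘ D)).

Definition coadaptedPoisson (c : monoidal fF) (A : monoid B)
    (ad : coadapted c A) : poissonData C :=
  let m := fmor fF (mo_mul A ⊠ mo_mul A) in
  PoissonData (po_hopf := {|
    ho_ob := F (A ⊗ A);
    mul := m ∘ fmor fF (mid A A (sym A A)) ∘ mF2 c (A ⊗ A) (A ⊗ A);
    one := fmor fF ((mo_one A ⊠ mo_one A) ∘ luniti tunit) ∘ mF0 c;
    comul := coad_psii ad A A ∘ fmor fF (insertm A A (mo_one A));
    counit := coad_thetai ad ∘ fmor fF (mo_mul A);
    antip := fmor fF (sym A A);
    antipi := fmor fF (sym A A) |})
  (2%:R^-1 *:
     (m ∘ fmor fF (mid A A (sym A A ∘ tinf A A))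
        ∘ mF2 c (A ⊗ A) (A ⊗ A) ∘ (idm _ - sym _ _))).

End AdaptedHopf.

(* Triples (V, H ⊗ V -> V, V -> V ⊗ H) over a Hopf monoid H, the common       *)
(* carrier of both kinds of Drinfeld-Yetter modules.                          *)

Section Triples.
Variables (R : comPzRingType) (C : symMonCat R) (H : hopfData C).

Record triple := Triple {
  tr_ob :> C;
  act : Mor (H ⊗ tr_ob) tr_ob;
  coact : Mor tr_ob (tr_ob ⊗ H)
}.

Definition isTripleMor (V W : triple) (f : Mor V W) : bool :=
  (f ∘ act V == act W ∘ (idm H ⊠ f)) && (coact W ∘ f == (f ⊠ idm H) ∘ coact V).

Lemma isTripleMor_submod V W : submod_closed (@isTripleMor V W).
Proof.
split.
  by rewrite unfold_in /isTripleMor tens0m tensm0 !comp0m !compm0 !eqxx.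
move=> a f g /andP[/eqP fa /eqP fc] /andP[/eqP ga /eqP gc].
apply/andP; split; apply/eqP.
  by rewrite tensm_linr comp_linl comp_linr fa ga.
by rewrite tensm_linl comp_linl comp_linr fc gc.
Qed.

HB.instance Definition _ V W :=
  GRing.isSubmodClosed.Build R (Mor (tr_ob V) (tr_ob W)) (@isTripleMor V W)
    (@isTripleMor_submod V W).

Record tripleHom (V W : triple) := TripleHom {
  tmor :> Mor V W;
  tmorP : isTripleMor tmor
}.

HB.instance Definition _ V W := [isSub for @tmor V W].
HB.instance Definition _ V W := [Choice of tripleHom V W by <:].
HB.instance Definition _ V W := [SubChoice_isSubLmodule of tripleHom V W by <:].

Lemma isTripleMor_id (V : triple) : isTripleMor (idm V).
Proof.
by rewrite /isTripleMor !tensm1 !comp1m !compm1 !eqxx.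
Qed.

Lemma isTripleMor_comp (V W U : triple) (g : Mor W U) (f : Mor V W) :
  isTripleMor g -> isTripleMor f -> isTripleMor (g ∘ f).
Proof.
move=> /andP[/eqP ga /eqP gc] /andP[/eqP fa /eqP fc].
apply/andP; split; apply/eqP.
  by rewrite -[idm H]comp1m tensm_comp compA -ga -!compA fa.
by rewrite -[idm H]comp1m tensm_comp compA gc -!compA fc.
Qed.

(* v ⊗ w |-> - v_[0] ⊗ v_[1] w - w_[1] v ⊗ w_[0] *)
Definition triple_t (V W : triple) : Mor (V ⊗ W) (V ⊗ W) :=
  - ((idm V ⊠ act W) ∘ assoc V H W ∘ (coact V ⊠ idm W))
  - ((act V ⊠ idm W) ∘ associ H V W ∘ sym (V ⊗ W) H ∘ associ V W H
       ∘ (idm V ⊠ coact W)).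

(* x ⊗ (v ⊗ y) |-> v ⊗ (y S^-1(x)) *)
Definition mul_antipi (V : C) : Mor (H ⊗ (V ⊗ H)) (V ⊗ H) :=
  (idm V ⊠ mul H) ∘ cyc H V H ∘ (antipi H ⊠ idm (V ⊗ H)).

(* x ⊗ v |-> x_2 v_0 ⊗ x_3 v_1 S^-1(x_1) *)
Definition twisted_coact (V : triple) : Mor (H ⊗ V) (V ⊗ H) :=
  mul_antipi V
    ∘ (idm H ⊠ ((act V ⊠ mul H) ∘ swapmid H H V H))
    ∘ assoc H (H ⊗ H) (V ⊗ H)
    ∘ (((idm H ⊠ comul H) ∘ comul H) ⊠ coact V).

End Triples.

(* A tensor structure on triples, lying over that of C: sp_act and sp_coact   *)
(* are the structure maps of V ⊗ W, sp_unit_act and sp_unit_coact of the unit.*)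

Section TripleCategory.
Variables (R : comPzRingType) (C : symMonCat R).

Record tripleSpec := TripleSpec {
  sp_hopf : hopfData C;
  sp_ax : triple sp_hopf -> Prop;
  sp_unit_act : Mor (sp_hopf ⊗ tunit) tunit;
  sp_unit_coact : Mor tunit (tunit ⊗ sp_hopf);
  sp_act : forall V W : triple sp_hopf, Mor (sp_hopf ⊗ (V ⊗ W)) (V ⊗ W);
  sp_coact : forall V W : triple sp_hopf, Mor (V ⊗ W) (V ⊗ W ⊗ sp_hopf)
}.

Variable S : tripleSpec.
Local Notation H := (sp_hopf S).
Local Notation triple := (triple H).

Definition sp_unit : triple := Triple (sp_unit_act S) (sp_unit_coact S).
Definition sp_tens (V W : triple) : triple :=
  Triple (sp_act V W) (sp_coact V W).

Record spOb := SpOb { sp_triple :> triple; sp_tripleP : sp_ax sp_triple }.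

(* What has to be checked for the triples satisfying sp_ax, with the tensor   *)
(* structure above and triple_t, to form a symmetric Cartier category whose   *)
(* associativity, unit and symmetry isomorphisms are those of C.              *)
Record isCartierSpec : Prop := IsCartierSpec {
  sp_unitP : sp_ax sp_unit;
  sp_tensP : forall V W : spOb, sp_ax (sp_tens V W);
  sp_tensmP : forall (V V' W W' : spOb) (f : tripleHom V V')
      (g : tripleHom W W'),
    isTripleMor (V := sp_tens V W) (W := sp_tens V' W') (tmor f ⊠ tmor g);
  sp_assocP : forall U V W : spOb,
    isTripleMor (V := sp_tens (sp_tens U V) W) (W := sp_tens U (sp_tens V W))
      (assoc U V W);
  sp_associP : forall U V W : spOb,
    isTripleMor (V := sp_tens U (sp_tens V W)) (W := sp_tens (sp_tens U V) W)
      (associ U V W);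
  sp_lunitP : forall V : spOb,
    isTripleMor (V := sp_tens sp_unit V) (W := V) (lunit V);
  sp_lunitiP : forall V : spOb,
    isTripleMor (V := V) (W := sp_tens sp_unit V) (luniti V);
  sp_runitP : forall V : spOb,
    isTripleMor (V := sp_tens V sp_unit) (W := V) (runit V);
  sp_runitiP : forall V : spOb,
    isTripleMor (V := V) (W := sp_tens V sp_unit) (runiti V);
  sp_symP : forall V W : spOb,
    isTripleMor (V := sp_tens V W) (W := sp_tens W V) (sym V W);
  sp_tP : forall V W : spOb,
    isTripleMor (V := sp_tens V W) (W := sp_tens V W) (triple_t V W);
  sp_t_nat : forall (V V' W W' : spOb) (f : tripleHom V V')
      (g : tripleHom W W'),
    triple_t V' W' ∘ (tmor f ⊠ tmor g) = (tmor f ⊠ tmor g) ∘ triple_t V W;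
  sp_t_sym : forall V W : spOb,
    sym V W ∘ triple_t V W = triple_t W V ∘ sym V W;
  sp_t_tens : forall U V W : spOb,
    triple_t U (sp_tens V W) =
    assoc U V W ∘ (triple_t U V ⊠ idm W) ∘ associ U V W
    + assoc U V W ∘ (sym V U ⊠ idm W) ∘ associ V U W
        ∘ (idm V ⊠ triple_t U W)
        ∘ assoc V U W ∘ (sym U V ⊠ idm W) ∘ associ U V W
}.

Definition spLinCat : linCat R.
Proof.
refine (@LinCat R spOb (fun V W => tripleHom V W : lmodType R)
  (fun V => TripleHom (isTripleMor_id V))
  (fun U V W g f => TripleHom (isTripleMor_comp (tmorP g) (tmorP f)))
  _ _ _ _ _).
- by move=> X Y Z T h g f; apply/val_inj; rewrite /= compA.
- by move=> X Y f; apply/val_inj; rewrite /= comp1m.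
- by move=> X Y f; apply/val_inj; rewrite /= compm1.
- by move=> X Y Z f a g g'; apply/val_inj; rewrite /= comp_linl.
- by move=> X Y Z g a f f'; apply/val_inj; rewrite /= comp_linr.
Defined.

Variable cs : isCartierSpec.

Definition spSymMonCat : symMonCat R.
Proof.
refine (@SymMonCat R spLinCat
  (fun V W => SpOb (sp_tensP cs V W))
  (SpOb (sp_unitP cs))
  (fun V V' W W' f g => TripleHom (sp_tensmP cs f g))
  (fun U V W => TripleHom (sp_assocP cs U V W))
  (fun U V W => TripleHom (sp_associP cs U V W))
  (fun V => TripleHom (sp_lunitP cs V))
  (fun V => TripleHom (sp_lunitiP cs V))
  (fun V => TripleHom (sp_runitP cs V))
  (fun V => TripleHom (sp_runitiP cs V))
  (fun V W => TripleHom (sp_symP cs V W))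
  _ _ _ _ _ _ _ _ _ _ _ _ _ _ _ _ _ _).
- by move=> *; apply/val_inj; apply: tensm1.
- by move=> *; apply/val_inj; apply: tensm_comp.
- by move=> *; apply/val_inj; apply: tensm_linl.
- by move=> *; apply/val_inj; apply: tensm_linr.
- by move=> *; apply/val_inj; apply: assocK.
- by move=> *; apply/val_inj; apply: associK.
- by move=> *; apply/val_inj; apply: lunitK.
- by move=> *; apply/val_inj; apply: lunitiK.
- by move=> *; apply/val_inj; apply: runitK.
- by move=> *; apply/val_inj; apply: runitiK.
- by move=> *; apply/val_inj; apply: symK.
- by move=> *; apply/val_inj; apply: assoc_nat.
- by move=> *; apply/val_inj; apply: lunit_nat.
- by move=> *; apply/val_inj; apply: runit_nat.
- by move=> *; apply/val_inj; apply: sym_nat.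
- by move=> *; apply/val_inj; apply: pentagon.
- by move=> *; apply/val_inj; apply: triangle.
- by move=> *; apply/val_inj; apply: hexagon.
Defined.

Definition spCartierCat : cartierCat R.
Proof.
refine (@CartierCat R spSymMonCat (fun V W => TripleHom (sp_tP cs V W)) _ _ _).
- by move=> *; apply/val_inj; apply: sp_t_nat.
- by move=> *; apply/val_inj; apply: sp_t_sym.
- by move=> *; apply/val_inj; apply: sp_t_tens.
Defined.

Definition forget : functor (fun V : spCartierCat => tr_ob (sp_triple V)).
Proof.
by refine (@Functor R spCartierCat C (fun V => tr_ob (sp_triple V))
  (fun V W f => tmor f) _ _).
Defined.

End TripleCategory.

(* The Drinfeld-Yetter modules of a coPoisson Hopf monoid H: H-modules with   *)
(* an infinitesimal coaction.                                                 *)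

Section LowerDY.
Variables (R : comPzRingType) (C : symMonCat R) (H : coPoissonHopf C).

(* c |-> c_2' ⊗ c_2'' S^-1(c_1) *)
Definition cobr_minus : Mor H (H ⊗ H) :=
  mul_antipi H H ∘ (idm H ⊠ cobr H) ∘ comul H.

Record isLowerDY (V : triple H) : Prop := IsLowerDY {
  ldy_act_mul : act V ∘ (mul H ⊠ idm V) =
    act V ∘ (idm H ⊠ act V) ∘ assoc H H V;
  ldy_act_one : act V ∘ (one H ⊠ idm V) = lunit V;
  ldy_coact_cobr : (idm V ⊠ cobr H) ∘ coact V =
    assoc V H H ∘ (coact V ⊠ idm H) ∘ coact V
    - assoc V H H ∘ swap23 V H H ∘ (coact V ⊠ idm H) ∘ coact V;
  ldy_coact_comul : (idm V ⊠ comul H) ∘ coact V =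
    (idm V ⊠ ((one H ⊠ idm H) ∘ luniti H)) ∘ coact V
    + (idm V ⊠ ((idm H ⊠ one H) ∘ runiti H)) ∘ coact V;
  ldy_coact_act : coact V ∘ act V =
    (act V ⊠ idm H) ∘ swap23 H H V ∘ (cobr_minus ⊠ idm V) + twisted_coact V
}.

Definition lowerDYspec : tripleSpec C := {|
  sp_hopf := H;
  sp_ax := isLowerDY;
  sp_unit_act := lunit tunit ∘ (counit H ⊠ idm tunit);
  sp_unit_coact := 0;
  sp_act := fun V W =>
    (act V ⊠ act W) ∘ swapmid H H V W ∘ (comul H ⊠ idm (V ⊗ W));
  sp_coact := fun V W =>
    swap23 V H W ∘ (coact V ⊠ idm W) + associ V W H ∘ (idm V ⊠ coact W) |}.

Definition lowerDY (cs : isCartierSpec lowerDYspec) : cartierCat R :=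
  spCartierCat cs.

Definition Cminus_triple : triple (sp_hopf lowerDYspec) :=
  @Triple R C H H (mul H) cobr_minus.

Record isLowerComonoid : Prop := IsLowerComonoid {
  cminusP : sp_ax (t := lowerDYspec) Cminus_triple;
  cminus_comulP : isTripleMor (V := Cminus_triple)
    (W := sp_tens Cminus_triple Cminus_triple) (comul H);
  cminus_counitP : isTripleMor (V := Cminus_triple)
    (W := sp_unit lowerDYspec) (counit H)
}.

Definition Cminus (cs : isCartierSpec lowerDYspec) (cm : isLowerComonoid) :
  comonoid (lowerDY cs).
Proof.
refine (@Comonoid R (lowerDY cs) (SpOb (cminusP cm))
  (TripleHom (cminus_comulP cm)) (TripleHom (cminus_counitP cm)) _ _ _).
- apply/val_inj; exact: comulA (cp_isHopf (cp_ax H)).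
- apply/val_inj; exact: counitl (cp_isHopf (cp_ax H)).
- apply/val_inj; exact: counitr (cp_isHopf (cp_ax H)).
Defined.

(* coker (act_V - counit ⊗ id) and its projection *)
Variable good : cGoodEnough C.

Definition Fminus_rel (V : triple H) : Mor (H ⊗ V) V :=
  act V - lunit V ∘ (counit H ⊠ idm V).

Definition Fminus_ob (V : triple H) : C := coker good (Fminus_rel V).

Definition Fminus_proj (V : triple H) : Mor V (Fminus_ob V) := cokerp good (Fminus_rel V).

End LowerDY.

(* The Drinfeld-Yetter modules of a Poisson Hopf monoid H: H-comodules with   *)
(* an infinitesimal action.                                                   *)

Section UpperDY.
Variables (R : comPzRingType) (C : symMonCat R) (H : poissonHopf C).

Record isUpperDY (V : triple H) : Prop := IsUpperDY {
  udy_coact_comul : assoc V H H ∘ (coact V ⊠ idm H) ∘ coact V =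
    (idm V ⊠ comul H) ∘ coact V;
  udy_coact_counit : runit V ∘ (idm V ⊠ counit H) ∘ coact V = idm V;
  udy_act_br : act V ∘ (br H ⊠ idm V) =
    act V ∘ (idm H ⊠ act V) ∘ assoc H H V
    - act V ∘ (idm H ⊠ act V) ∘ assoc H H V ∘ (sym H H ⊠ idm V);
  udy_act_mul : act V ∘ (mul H ⊠ idm V) =
    act V ∘ ((lunit H ∘ (counit H ⊠ idm H)) ⊠ idm V)
    + act V ∘ ((runit H ∘ (idm H ⊠ counit H)) ⊠ idm V);
  udy_coact_act : coact V ∘ act V =
    mul_antipi H V
      ∘ (idm H ⊠ ((idm V ⊠ br H) ∘ swap12 H V H))
      ∘ assoc H H (V ⊗ H) ∘ (comul H ⊠ coact V)
    + twisted_coact V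
}.

Definition upperDYspec : tripleSpec C := {|
  sp_hopf := H;
  sp_ax := isUpperDY;
  sp_unit_act := 0;
  sp_unit_coact := (idm tunit ⊠ one H) ∘ runiti tunit;
  sp_act := fun V W =>
    (act V ⊠ idm W) ∘ associ H V W + (idm V ⊠ act W) ∘ swap12 H V W;
  sp_coact := fun V W =>
    (idm (V ⊗ W) ⊠ mul H) ∘ swapmid V H W H ∘ (coact V ⊠ coact W) |}.

Definition upperDY (cs : isCartierSpec upperDYspec) : cartierCat R :=
  spCartierCat cs.

(* p ⊗ q |-> {p_2, q} S^-1(p_1) *)
Definition br_plus : Mor (H ⊗ H) H :=
  mul H ∘ sym H H ∘ (antipi H ⊠ br H) ∘ assoc H H H ∘ (comul H ⊠ idm H).

Definition Pplus_triple : triple (sp_hopf upperDYspec) :=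
  @Triple R C H H br_plus (comul H).

Record isUpperMonoid : Prop := IsUpperMonoid {
  pplusP : sp_ax (t := upperDYspec) Pplus_triple;
  pplus_mulP : isTripleMor (V := sp_tens Pplus_triple Pplus_triple)
    (W := Pplus_triple) (mul H);
  pplus_oneP : isTripleMor (V := sp_unit upperDYspec)
    (W := Pplus_triple) (one H)
}.

Definition Pplus (cs : isCartierSpec upperDYspec) (cm : isUpperMonoid) :
  monoid (upperDY cs).
Proof.
refine (@Monoid R (upperDY cs) (SpOb (pplusP cm))
  (TripleHom (pplus_mulP cm)) (TripleHom (pplus_oneP cm)) _ _ _).
- apply/val_inj; exact: mulA (po_isHopf (po_ax H)).
- apply/val_inj; exact: mul1l (po_isHopf (po_ax H)).
- apply/val_inj; exact: mul1r (po_isHopf (po_ax H)).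
Defined.

(* ker (coact_V - id ⊗ one) and its inclusion *)
Variable good : kGoodEnough C.

Definition Fplus_rel (V : triple H) : Mor V (V ⊗ H) :=
  coact V - (idm V ⊠ one H) ∘ runiti V.

Definition Fplus_ob (V : triple H) : C := ker good (Fplus_rel V).

Definition Fplus_incl (V : triple H) : Mor (Fplus_ob V) V :=
  keri good (Fplus_rel V).

End UpperDY.

(* Main.v *)
From HB Require Import structures.
Require Import Defs.
From mathcomp Require Import all_boot all_algebra.

(* The H-module C_- ⊗ V is free, so its coinvariants are V through c ⊗ v |-> S(c) v;
   likewise those of V ⊗ C_-.  Evaluating the projection on c_1 . (1 ⊗ S(c_2) v) in two
   ways inverts this map, and the same computation in the middle factor of X ⊗ C_- ⊗ Y
   shows that C_- is adapted.  On C_- ⊗ C_- it is c ⊗ d |-> S(c) d, which carries the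
   structure maps of F(C_- ⊗ C_-) to those of C; as sigma delta = - delta, the factor 1/2
   disappears.  The Poisson half is dual, with V -> V ⊗ P_+, v |-> v_0 ⊗ S(v_1).

   All identities between structure maps are equalities of string diagrams.  They are
   decided by reflection: a morphism becomes a signed sum of programs, lists of boxes
   with named input and output wires, whose meaning depends neither on the names nor on
   the order of independent boxes, and the axioms act as rewriting rules on programs.
   (Co)commutativity is used as a rule only to sort the leaves of iterated (co)products,
   which brings factors such as x_1 and S(x_2) next to each other. *)

Set Implicit Arguments.
Unset Strict Implicit.
Unset Printing Implicit Defensive.

Import GRing.Theory.
Local Open Scope ring_scope.
Local Open Scope cat_scope.

(** Associativity and unit isomorphisms are explicit here, so the independence of names and order
    has to be derived from the pentagon, the triangle and the hexagon: factors of tensor products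
    nested to the right are permuted by name, and these permutations are shown to compose as they
    should.

    Of the rewriting only soundness is proved. Matching, ordering and termination belong to an
    unverified search: every application of a rule tests by computation the conditions under which
    it is sound, and a search that goes wrong makes the final check fail.

    Rewriting alone is not asked to find the identities of the antipode. They rest on the uniqueness
    of convolution inverses: an expression that cancels in two ways is supplied by hand, and the
    rules evaluate it.

    The axioms of F(C_- ⊗ C_-) are not verified on cokernels. Once c ⊗ d |-> S(c) d is invertible
    and respects the structure maps, they are transported from C. *)

Local Notation catA := Defs.compA.

(** * Coherence and permutations of tensor factors *)

Section MonoidalCoherence.
Variables (R : comPzRingType) (C : symMonCat R).
Implicit Types X Y Z W : C.

Lemma tens_compl X Y Z W (g : Mor Y Z) (f : Mor X Y) :
  (g ∘ f) ⊠ idm W = (g ⊠ idm W) ∘ (f ⊠ idm W).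
Proof. by rewrite -tensm_comp comp1m. Qed.

Lemma tens_compr X Y Z W (g : Mor Y Z) (f : Mor X Y) :
  idm W ⊠ (g ∘ f) = (idm W ⊠ g) ∘ (idm W ⊠ f).
Proof. by rewrite -tensm_comp comp1m. Qed.

Lemma tens_lr X Y Z W (f : Mor X Y) (g : Mor Z W) :
  (f ⊠ idm W) ∘ (idm X ⊠ g) = f ⊠ g.
Proof. by rewrite -tensm_comp comp1m compm1. Qed.

Lemma iso_epi X Y Z (f : Mor X Y) (f' : Mor Y X) (g h : Mor Y Z) :
  f ∘ f' = idm _ -> g ∘ f = h ∘ f -> g = h.
Proof. by move=> fK /(congr1 (fun k => k ∘ f')); rewrite -!catA fK !compm1. Qed.

Lemma iso_mono X Y Z (f : Mor X Y) (f' : Mor Y X) (g h : Mor Z X) :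
  f' ∘ f = idm _ -> f ∘ g = f ∘ h -> g = h.
Proof. by move=> fK /(congr1 (fun k => f' ∘ k)); rewrite !catA fK !comp1m. Qed.

Lemma associ_nat X Y Z X' Y' Z' (f : Mor X X') (g : Mor Y Y') (h : Mor Z Z') :
  associ X' Y' Z' ∘ (f ⊠ (g ⊠ h)) = ((f ⊠ g) ⊠ h) ∘ associ X Y Z.
Proof.
apply: (iso_epi (associK X Y Z)); rewrite -!catA assocK compm1 -assoc_nat.
by rewrite catA assocK comp1m.
Qed.

Lemma luniti_nat X Y (f : Mor X Y) : luniti Y ∘ f = (idm tunit ⊠ f) ∘ luniti X.
Proof.
apply: (iso_epi (lunitiK X)); rewrite -!catA lunitK compm1 -lunit_nat.
by rewrite catA lunitK comp1m.
Qed.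

Lemma runiti_nat X Y (f : Mor X Y) : runiti Y ∘ f = (f ⊠ idm tunit) ∘ runiti X.
Proof.
apply: (iso_epi (runitiK X)); rewrite -!catA runitK compm1 -runit_nat.
by rewrite catA runitK comp1m.
Qed.

Lemma tunit_tens_inj X Y (f g : Mor X Y) :
  idm tunit ⊠ f = idm tunit ⊠ g -> f = g.
Proof.
move=> e; apply: (iso_epi (lunitiK X)); by rewrite -!lunit_nat e.
Qed.

Lemma tens_tunit_inj X Y (f g : Mor X Y) :
  f ⊠ idm tunit = g ⊠ idm tunit -> f = g.
Proof.
move=> e; apply: (iso_epi (runitiK X)); by rewrite -!runit_nat e.
Qed.

(** Composites are kept nested to the right, so the left side of an equation between composites is
    in general no subterm when another map is applied before it. These lemmas carry that tail [k]
    along. *)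
Lemma eqA X Y Y' Z W (f : Mor Y Z) (g : Mor X Y) (f' : Mor Y' Z) (g' : Mor X Y')
  (k : Mor W X) : f ∘ g = f' ∘ g' -> f ∘ g ∘ k = f' ∘ g' ∘ k.
Proof. by move=> e; rewrite catA e -catA. Qed.

Lemma eqA1 X Y Z W (f : Mor Y Z) (g : Mor X Y) (h : Mor X Z)
  (k : Mor W X) : f ∘ g = h -> f ∘ g ∘ k = h ∘ k.
Proof. by move=> e; rewrite catA e. Qed.

Lemma eqA3 X Y Y' Z Z' T W (f : Mor Z T) (g : Mor Y Z) (h : Mor X Y)
    (f' : Mor Z' T) (g' : Mor Y' Z') (h' : Mor X Y') (k : Mor W X) :
  f ∘ g ∘ h = f' ∘ g' ∘ h' -> f ∘ g ∘ h ∘ k = f' ∘ g' ∘ h' ∘ k.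
Proof. by move=> e; rewrite !catA -(catA f) e -!catA. Qed.

Lemma cancA X Y W (f : Mor Y X) (g : Mor X Y) (k : Mor W X) :
  f ∘ g = idm X -> f ∘ g ∘ k = k.
Proof. by move=> e; rewrite catA e comp1m. Qed.

(** Kelly's argument: tensoring with the unit is faithful because [lunit] is a natural isomorphism,
    and the tensored claim follows from the pentagon at two unit objects and the triangle, up to the
    isomorphism cancelled through [e1]. *)
Lemma lunit_tens X Y : lunit (X ⊗ Y) ∘ assoc tunit X Y = lunit X ⊠ idm Y.
Proof.
apply: tunit_tens_inj.
have e1 : (assoc tunit (tunit ⊗ X) Y ∘ (assoc tunit tunit X ⊠ idm Y)) ∘
    (associ tunit tunit X ⊠ idm Y) ∘ associ tunit (tunit ⊗ X) Y = idm _.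
  by rewrite -!catA cancA ?associK // -tens_compl associK tensm1.
apply: (iso_epi e1); rewrite tens_compr -catA -pentagon.
rewrite (eqA1 _ (triangle _ _)) -tensm1 -assoc_nat (eqA _ (esym (assoc_nat _ _ _))).
by rewrite -tensm_comp triangle comp1m.
Qed.

Lemma runit_tens X Y : (idm X ⊠ runit Y) ∘ assoc X Y tunit = runit (X ⊗ Y).
Proof.
apply: tens_tunit_inj; apply: (iso_mono (assocK X Y tunit)).
rewrite tens_compl catA assoc_nat -catA -triangle tens_compr -!catA -pentagon.
by rewrite -(triangle (X ⊗ Y)) -tensm1 (eqA _ (assoc_nat _ _ _)).
Qed.

Lemma lunit_runit_tunit : lunit (tunit : C) = runit tunit.
Proof.
apply: tens_tunit_inj; rewrite -triangle -lunit_tens; congr (_ ∘ _).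
by apply: (iso_mono (lunitK tunit)); rewrite lunit_nat.
Qed.

(** The hexagon at [X], [tunit], [tunit], stripped of its unit constraints, is this identity
    tensored with the unit. *)
Lemma lunit_sym X : lunit X ∘ sym X tunit = runit X.
Proof.
apply: tens_tunit_inj; apply: (iso_mono (symK X tunit)).
have := congr1 (fun k => lunit _ ∘ k) (hexagon X tunit tunit).
rewrite /= (eqA1 _ (lunit_tens _ _)) (eqA _ (esym (sym_nat _ _))) triangle.
by rewrite (eqA _ (lunit_nat _)) (eqA1 _ (lunit_tens _ _)) -tens_compl => ->.
Qed.

Lemma runit_sym X : runit X ∘ sym tunit X = lunit X.
Proof. by rewrite -lunit_sym -catA symK compm1. Qed.

(** The second hexagon, obtained by inverting the first, since [sym] is its own inverse. *)
Lemma sym_tensl X Y Z :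
  sym (X ⊗ Y) Z ∘ associ X Y Z = swap12 X Z Y ∘ (idm X ⊠ sym Y Z).
Proof.
apply: (iso_epi (f := (idm X ⊠ sym Z Y) ∘ assoc X Z Y ∘ (sym Z X ⊠ idm Y))
  (f' := (sym X Z ⊠ idm Y) ∘ associ X Z Y ∘ (idm X ⊠ sym Y Z))).
  rewrite -!catA (cancA (f := sym Z X ⊠ _)) -?tens_compl ?symK ?tensm1 //.
  by rewrite cancA ?associK // -tens_compr symK tensm1.
transitivity (assoc Z X Y).
  by rewrite -hexagon -!catA (cancA _ (assocK _ _ _)) (cancA _ (symK _ _)).
rewrite /swap12 -!catA.
rewrite (cancA (f := idm X ⊠ _)) -?tens_compr ?symK ?tensm1 //.
by rewrite (cancA _ (assocK _ _ _)) -tens_compl symK tensm1 compm1.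
Qed.

Lemma swap12_tens X Y Z W :
  assoc Y Z (X ⊗ W) ∘ swap12 X (Y ⊗ Z) W ∘ (idm X ⊠ associ Y Z W) =
  (idm Y ⊠ swap12 X Z W) ∘ swap12 X Y (Z ⊗ W).
Proof.
have e : sym X (Y ⊗ Z) = associ Y Z X ∘ (idm Y ⊠ sym X Z) ∘ assoc Y X Z
    ∘ (sym X Y ⊠ idm Z) ∘ associ X Y Z.
  apply: (iso_epi (associK X Y Z)); rewrite -!catA assocK compm1 -hexagon.
  by rewrite cancA ?assocK.
rewrite /swap12 e !tens_compl -!catA (eqA _ (pentagon _ _ _ _)) -!catA.
rewrite (cancA (f := assoc Y Z X ⊠ _)) -?tens_compl ?associK ?tensm1 //.
rewrite (eqA _ (assoc_nat _ _ _)) !tens_compr -!catA; congr (_ ∘ _ ∘ _).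
have p : assoc X Y (Z ⊗ W) ∘ assoc (X ⊗ Y) Z W ∘ (associ X Y Z ⊠ idm W) ∘
    associ X (Y ⊗ Z) W = idm X ⊠ assoc Y Z W.
  rewrite (eqA _ (pentagon _ _ _ _)) -!catA.
  rewrite (cancA (f := assoc X Y Z ⊠ _)) -?tens_compl ?associK ?tensm1 //.
  by rewrite compm1.
have p' : (associ X Y Z ⊠ idm W) ∘ associ X (Y ⊗ Z) W =
    associ (X ⊗ Y) Z W ∘ associ X Y (Z ⊗ W) ∘ (idm X ⊠ assoc Y Z W).
  by rewrite -p (cancA _ (assocK _ _ _)) (cancA _ (assocK _ _ _)).
rewrite (eqA _ p') -!catA -tens_compr associK tensm1 compm1.
rewrite (eqA _ (esym (associ_nat _ _ _))) tensm1.
have q : assoc Y (X ⊗ Z) W ∘ (assoc Y X Z ⊠ idm W) ∘ associ (Y ⊗ X) Z W =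
  (idm Y ⊠ associ X Z W) ∘ assoc Y X (Z ⊗ W).
  apply: (iso_epi (associK _ _ _)); rewrite -!catA assocK compm1 pentagon.
  by rewrite (cancA (f := _ ⊠ associ _ _ _)) // -tens_compr assocK tensm1.
by move/(congr1 (fun h => h ∘ (sym X Y ⊠ idm _) ∘ associ X Y _)): q; rewrite -!catA.
Qed.

Lemma swap12_nat X Y Z X' Y' Z' (f : Mor X X') (g : Mor Y Y') (h : Mor Z Z') :
  swap12 X' Y' Z' ∘ (f ⊠ (g ⊠ h)) = (g ⊠ (f ⊠ h)) ∘ swap12 X Y Z.
Proof.
rewrite /swap12 -!catA associ_nat [RHS](eqA _ (esym (assoc_nat _ _ _))).
by congr (_ ∘ _); rewrite !catA -!tensm_comp sym_nat comp1m compm1.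
Qed.

Lemma swap12K X Y Z : swap12 Y X Z ∘ swap12 X Y Z = idm _.
Proof.
rewrite /swap12 -!catA (cancA _ (assocK _ _ _)).
by rewrite (cancA (f := sym _ _ ⊠ _)) ?associK // -tens_compl symK tensm1.
Qed.

(** The Yang-Baxter relation. Passing [Y ⊗ Z] is natural in that object, hence compatible with
    [sym Y Z]; [swap12_tens] splits the passage on both sides into single swaps. *)
Lemma swap12_braid X Y Z W :
  swap12 Y Z (X ⊗ W) ∘ (idm Y ⊠ swap12 X Z W) ∘ swap12 X Y (Z ⊗ W) =
  (idm Z ⊠ swap12 X Y W) ∘ swap12 X Z (Y ⊗ W) ∘ (idm X ⊠ swap12 Y Z W).
Proof.
have := swap12_nat (idm X) (sym Y Z) (idm W); rewrite tensm1 => n.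
have d V : swap12 Y Z V = assoc Z Y V ∘ (sym Y Z ⊠ idm V) ∘ associ Y Z V by [].
rewrite -swap12_tens (eqA _ (esym (swap12_tens _ _ _ _))) !d -!catA.
rewrite (cancA _ (assocK _ _ _)); congr (_ ∘ _).
move/(congr1 (fun k => k ∘ (idm X ⊠ associ Y Z W))): n.
rewrite /swap12 -!catA => <-; rewrite -!tens_compr.
by rewrite (cancA _ (assocK _ _ _)).
Qed.

End MonoidalCoherence.

(* [swap12], locked so that rewriting with associativity does not unfold it. *)
HB.lock Definition sw (R : comPzRingType) (C : symMonCat R) (X Y Z : C) :
  Mor (X ⊗ (Y ⊗ Z)) (Y ⊗ (X ⊗ Z)) := swap12 X Y Z.

Section LockedSwap.
Variables (R : comPzRingType) (C : symMonCat R).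
Implicit Types X Y Z W : C.

Lemma sw_braid X Y Z W :
  sw Y Z (X ⊗ W) ∘ (idm Y ⊠ sw X Z W) ∘ sw X Y (Z ⊗ W) =
  (idm Z ⊠ sw X Y W) ∘ sw X Z (Y ⊗ W) ∘ (idm X ⊠ sw Y Z W).
Proof. by rewrite !sw.unlock swap12_braid. Qed.

Lemma sw_nat X Y Z X' Y' Z' (f : Mor X X') (g : Mor Y Y') (h : Mor Z Z') :
  sw X' Y' Z' ∘ (f ⊠ (g ⊠ h)) = (g ⊠ (f ⊠ h)) ∘ sw X Y Z.
Proof. by rewrite !sw.unlock swap12_nat. Qed.

Lemma swK X Y Z : sw Y X Z ∘ sw X Y Z = idm _.
Proof. by rewrite !sw.unlock swap12K. Qed.

Lemma sw_tens X Y Z W :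
  assoc Y Z (X ⊗ W) ∘ sw X (Y ⊗ Z) W ∘ (idm X ⊠ associ Y Z W) =
  (idm Y ⊠ sw X Z W) ∘ sw X Y (Z ⊗ W).
Proof. by rewrite !sw.unlock swap12_tens. Qed.

Lemma sw_assoc X Y Z W :
  sw X Y (Z ⊗ W) ∘ (idm X ⊠ assoc Y Z W) ∘ assoc X (Y ⊗ Z) W =
  (idm Y ⊠ assoc X Z W) ∘ assoc Y (X ⊗ Z) W ∘ (sw X Y Z ⊠ idm W).
Proof.
have p : (idm X ⊠ assoc Y Z W) ∘ assoc X (Y ⊗ Z) W =
    assoc X Y (Z ⊗ W) ∘ assoc (X ⊗ Y) Z W ∘ (associ X Y Z ⊠ idm W).
  rewrite (eqA _ (pentagon _ _ _ _)) -!catA -tens_compl associK tensm1.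
  by rewrite compm1.
rewrite p !sw.unlock /swap12 -!catA (cancA _ (assocK _ _ _)) -tensm1.
rewrite (eqA _ (esym (assoc_nat _ _ _))) (eqA _ (pentagon _ _ _ _)) -!catA.
by rewrite !tens_compl.
Qed.

Lemma sw_unit X Y : lunit (X ⊗ Y) ∘ sw X tunit Y = idm X ⊠ lunit Y.
Proof.
rewrite sw.unlock /swap12 (eqA1 _ (lunit_tens _ _)) catA -tens_compl lunit_sym.
by rewrite -triangle -catA associK compm1.
Qed.

Lemma sym_tens_sw X Y Z :
  sym (X ⊗ Y) Z ∘ associ X Y Z = sw X Z Y ∘ (idm X ⊠ sym Y Z).
Proof. by rewrite !sw.unlock sym_tensl. Qed.

End LockedSwap.

(* The object carried by a wire, as an index, and the name of the wire. *)
Notation wire := (nat * nat)%type.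

Section Wires.
Variables (R : comPzRingType) (C : symMonCat R) (ob : nat -> C).
Implicit Types (s a b c : seq wire) (w x y : wire).

Definition ty w : C := ob w.1.

Fixpoint big s : C := if s is w :: s' then ty w ⊗ big s' else tunit.

Fixpoint join a b : Mor (big a ⊗ big b) (big (a ++ b)) :=
  match a with
  | [::] => lunit _
  | x :: a' => (idm _ ⊠ join a' b) ∘ assoc _ _ _
  end.

Fixpoint split a b : Mor (big (a ++ b)) (big a ⊗ big b) :=
  match a with
  | [::] => luniti _
  | x :: a' => associ _ _ _ ∘ (idm _ ⊠ split a' b)
  end.

Lemma joinK a b : split a b ∘ join a b = idm _.
Proof.
elim: a => [|x a IH] /=; first exact: lunitK.
rewrite -catA (cancA (f := _ ⊠ split _ _)) ?assocK // -tens_compr IH.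
by rewrite tensm1.
Qed.

Lemma splitK a b : join a b ∘ split a b = idm _.
Proof.
elim: a => [|x a IH] /=; first exact: lunitiK.
by rewrite -catA cancA ?associK // -tens_compr IH tensm1.
Qed.

(** Total, with junk value 0, so that programs carry no typing proofs. Equality of indices is
    decidable, so the diagonal case needs no axiom. *)
Definition cast_ty (t t' : nat) : Mor (ob t) (ob t') :=
  match @eqP _ t t' with
  | ReflectT e => eq_rect t (fun z => Mor (ob t) (ob z)) (idm _) t' e
  | ReflectF _ => 0
  end.

Lemma cast_tyxx t : cast_ty t t = idm _.
Proof. by rewrite /cast_ty; case: eqP => // e; rewrite (eq_axiomK e). Qed.

Lemma cast_wirexx w : cast_ty w.1 w.1 = idm (ty w).
Proof. exact: cast_tyxx. Qed.

Fixpoint relab s s' : Mor (big s) (big s') :=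
  match s, s' with
  | [::], [::] => idm _
  | w :: r, w' :: r' => cast_ty w.1 w'.1 ⊠ relab r r'
  | _, _ => 0
  end.

Definition wtypes s := map (fun w : wire => w.1) s.

Lemma relab_id s : relab s s = idm _.
Proof. by elim: s => //= w s ->; rewrite cast_tyxx tensm1. Qed.

Lemma relab_comp s1 s2 s3 : wtypes s1 = wtypes s2 ->
  relab s2 s3 ∘ relab s1 s2 = relab s1 s3.
Proof.
elim: s1 s2 s3 => [|[t1 i1] s1 IH] [|[t2 i2] s2] // [|[t3 i3] s3] //= e.
- by rewrite comp1m.
- by rewrite comp0m.
- by rewrite comp0m.
by case: e => <- e; rewrite -tensm_comp cast_tyxx compm1 IH.
Qed.

Lemma relabK s1 s2 : wtypes s1 = wtypes s2 -> relab s2 s1 ∘ relab s1 s2 = idm _.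
Proof. by move=> e; rewrite relab_comp // relab_id. Qed.

Lemma relab_cat a b a' b' : size a = size a' ->
  relab (a ++ b) (a' ++ b') ∘ join a b = join a' b' ∘ (relab a a' ⊠ relab b b').
Proof.
elim: a a' => [|x a IH] [|x' a'] //= => [_|[e]].
  by rewrite -lunit_nat.
rewrite -!catA assoc_nat (catA (_ ⊠ relab _ _)) -tensm_comp compm1 IH //.
by rewrite catA -tensm_comp comp1m.
Qed.

Lemma relab_cat_split a b a' b' : size a = size a' ->
  split a' b' ∘ relab (a ++ b) (a' ++ b') = (relab a a' ⊠ relab b b') ∘ split a b.
Proof.
move=> e; apply: (iso_epi (splitK a b)); rewrite -!catA joinK compm1.
by rewrite relab_cat // cancA // joinK.
Qed.

(* [ext s w] moves the factor [w] to the front and [pm s s'] permutes the factors of [s]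
   into the order [s'].  The value is 0 if the wires do not fit, as for [relab], which
   keeps the order and changes the names only. *)
Fixpoint ext s w : Mor (big s) (ty w ⊗ big (rem w s)) :=
  match s return Mor (big s) (ty w ⊗ big (rem w s)) with
  | [::] => 0
  | x :: r =>
    if x == w as b
    return Mor (ty x ⊗ big r) (ty w ⊗ big (if b then r else x :: rem w r))
    then cast_ty x.1 w.1 ⊠ idm _
    else sw _ _ _ ∘ (idm _ ⊠ ext r w)
  end.

Fixpoint pm s s' : Mor (big s) (big s') :=
  match s' with
  | [::] => if s is [::] then idm _ else 0
  | w :: t => (idm _ ⊠ pm (rem w s) t) ∘ ext s w
  end.

Lemma pm_cons x s s' : pm (x :: s) (x :: s') = idm _ ⊠ pm s s'.
Proof. by rewrite /= eqxx cast_tyxx tensm1 compm1. Qed.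

Lemma pm_id s : pm s s = idm _.
Proof. by elim: s => // x s IH; rewrite pm_cons IH tensm1. Qed.

Lemma remC (T : eqType) (x y : T) (s : seq T) :
  rem x (rem y s) = rem y (rem x s).
Proof.
elim: s => //= z s IH.
by case: (eqVneq z y) => [<-|/negbTE zy]; case: (eqVneq z x) => [<-|/negbTE zx] //=;
  rewrite ?eqxx ?zx ?zy ?IH.
Qed.

(** When neither wire is at the head, the inductive step is the braid relation [sw_braid]. The [pm]
    on the left is only a cast along [remC]. *)
Lemma ext_swap s w x : w != x -> w \in s -> x \in s ->
  (idm _ ⊠ (idm _ ⊠ pm (rem w (rem x s)) (rem x (rem w s))))
    ∘ sw _ _ _ ∘ (idm _ ⊠ ext (rem x s) w) ∘ ext s x =
  (idm _ ⊠ ext (rem w s) x) ∘ ext s w.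
Proof.
move=> wx; have xw : x != w by rewrite eq_sym.
elim: s => // y r IH; rewrite !inE.
have [e|wy] := eqVneq w y.
  move=> _ _; subst y; rewrite /= eqxx (negbTE wx) /= eqxx /=.
  rewrite pm_id !tensm1 comp1m cast_wirexx !tensm1 compm1 comp1m.
  by rewrite (cancA _ (swK _ _ _)).
have [e|xy] := eqVneq x y.
  move=> _ _; subst y; rewrite /= eqxx (negbTE xw) /= eqxx /=.
  by rewrite pm_id !tensm1 comp1m cast_wirexx !tensm1 compm1 comp1m.
rewrite eq_sym in wy; rewrite eq_sym in xy => /= wr xr; move: (IH wr xr).
rewrite (negbTE wy) (negbTE xy) /= (negbTE wy) (negbTE xy) -pm_cons.
rewrite !pm_cons => {}IH.
rewrite !tens_compr -!catA. rewrite (eqA (f := _ ⊠ (_ ⊠ ext _ _)) _ (esym (sw_nat _ _ _))).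
rewrite (eqA3 _ (sw_braid _ _ _ _)).
rewrite [in RHS](eqA (f := _ ⊠ (_ ⊠ ext (rem w r) x)) _ (esym (sw_nat _ _ _))).
rewrite -[(_ ⊠ (_ ⊠ ext (rem w r) x)) ∘ _]tens_compr -IH !tens_compr.
rewrite (eqA (f := sw _ _ _) _ (sw_nat _ _ _)).
rewrite (eqA1 (g := _ ⊠ (_ ⊠ (_ ⊠ pm _ _))) _ (esym (tens_compr _ _ _))) sw_nat.
by rewrite !tens_compr -!catA.
Qed.

Lemma ext_pm s1 s2 w : perm_eq s1 s2 -> w \in s2 ->
  ext s2 w ∘ pm s1 s2 = (idm _ ⊠ pm (rem w s1) (rem w s2)) ∘ ext s1 w.
Proof.
elim: s2 s1 => // x t IH s1 p; rewrite inE.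
have [e|wx] := eqVneq w x => /=.
  by move=> _; subst w; rewrite eqxx cast_wirexx tensm1 comp1m.
move=> wt; have xw : x != w by rewrite eq_sym.
have xs : x \in s1 by rewrite (perm_mem p) mem_head.
have ws : w \in s1 by rewrite (perm_mem p) inE wt orbT.
have p' : perm_eq (rem x s1) t.
  by rewrite -(perm_cons x) -(permPl (perm_to_rem xs)).
rewrite (negbTE xw) /= -!catA (catA (_ ⊠ ext t w)) -tens_compr IH //.
rewrite [in RHS]tens_compr -[in RHS]catA -(ext_swap wx ws xs).
rewrite !tens_compr -!catA.
rewrite (eqA _ (sw_nat _ _ _)) -?catA !catA. do 3 congr (_ ∘ _).
by rewrite -!tens_compr (remC w x) pm_id compm1.
Qed.

(** The coherence theorem of the calculus: however permutations are composed, only the first and the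
    last list matter. *)
Lemma pm_comp s1 s2 s3 : perm_eq s1 s2 -> perm_eq s2 s3 ->
  pm s2 s3 ∘ pm s1 s2 = pm s1 s3.
Proof.
elim: s3 s1 s2 => [|w t IH] s1 s2 p12 p23.
  have := perm_size p23; have := perm_size p12.
  by case: s1 {p12} => //; case: s2 {p23} => //=; rewrite comp1m.
have ws2 : w \in s2 by rewrite (perm_mem p23) mem_head.
have ws1 : w \in s1 by rewrite (perm_mem p12).
rewrite /= -catA ext_pm // catA -tens_compr IH //.
  rewrite -(perm_cons w) -(permPl (perm_to_rem ws1)).
  by rewrite -(permPr (perm_to_rem ws2)).
by rewrite -(perm_cons w) -(permPl (perm_to_rem ws2)).
Qed.

Lemma pmK s1 s2 : perm_eq s1 s2 -> pm s2 s1 ∘ pm s1 s2 = idm _.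
Proof. by move=> p; rewrite pm_comp ?pm_id // perm_sym. Qed.

Lemma ext_cat a c w : w \in a ->
  ext (a ++ c) w ∘ join a c =
  (idm _ ⊠ (pm (rem w a ++ c) (rem w (a ++ c)) ∘ join (rem w a) c))
    ∘ assoc _ _ _ ∘ (ext a w ⊠ idm _).
Proof.
elim: a => // x a IH; rewrite inE.
have [e|wx] := eqVneq w x => /=.
  move=> _; subst w; rewrite eqxx cast_wirexx !tensm1 pm_id !comp1m.
  by rewrite compm1.
move=> wa; rewrite eq_sym (negbTE wx) pm_cons -!catA.
rewrite (eqA1 (f := _ ⊠ ext _ _) _ (esym (tens_compr _ _ _))) IH //.
rewrite ![in LHS]tens_compr -!catA -assoc_nat (eqA _ (sw_nat _ _ _)).
rewrite (eqA _ (sw_nat _ _ _)).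
rewrite /= !tens_compr tens_compl -!catA (eqA3 _ (sw_assoc _ _ _ _)).
by [].
Qed.

Lemma rem_cat_in (T : eqType) (x : T) (s1 s2 : seq T) :
  x \in s1 -> rem x (s1 ++ s2) = rem x s1 ++ s2.
Proof.
elim: s1 => //= y s IH; rewrite inE eq_sym.
by case: eqVneq => //= _ xs; rewrite IH.
Qed.

Lemma pm_cat a b c : perm_eq a b ->
  pm (a ++ c) (b ++ c) ∘ join a c = join b c ∘ (pm a b ⊠ idm _).
Proof.
elim: b a => [|w t IH] a p.
  have := perm_size p; case: a p => //= _ _.
  by rewrite pm_id comp1m tensm1 compm1.
have wa : w \in a by rewrite (perm_mem p) mem_head.
rewrite /= -!catA ext_cat // (eqA1 _ (esym (tens_compr _ _ _))).
have -> : rem w (a ++ c) = rem w a ++ c by rewrite rem_cat_in.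
rewrite pm_id comp1m IH.
  by rewrite tens_compr -!catA (eqA _ (esym (assoc_nat _ _ _))) tens_compl.
by rewrite -(perm_cons w) -(permPl (perm_to_rem wa)).
Qed.

Lemma pm_catl a b c : pm (a ++ b) (a ++ c) ∘ join a b = join a c ∘ (idm _ ⊠ pm b c).
Proof.
elim: a => [|x a IH]; first by rewrite /= lunit_nat.
rewrite -[(x :: a) ++ b]/(x :: (a ++ b)) -[(x :: a) ++ c]/(x :: (a ++ c)) pm_cons.
rewrite /= catA -tens_compr IH tens_compr -!catA -assoc_nat.
by rewrite tensm1.
Qed.

(** The hypothesis is needed because [ext] takes the first wire with the given name. *)
Lemma pm_move x b a : x \notin b ->
  pm (x :: (b ++ a)) (b ++ x :: a) ∘ (idm _ ⊠ join b a) =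
  join b (x :: a) ∘ sw _ _ _.
Proof.
elim: b => [_|y b IH]; first by rewrite pm_id comp1m sw_unit.
rewrite inE negb_or => /andP[xy xb].
have -> : pm (x :: ((y :: b) ++ a)) ((y :: b) ++ x :: a) =
    (idm _ ⊠ pm (x :: (b ++ a)) (b ++ x :: a)) ∘ sw _ _ _.
  by rewrite /= (negbTE xy) eqxx cast_wirexx !tensm1 compm1.
rewrite /= tens_compr -!catA (eqA _ (sw_nat _ _ _)).
rewrite (eqA1 _ (esym (tens_compr _ _ _))) IH // tens_compr -!catA.
rewrite -(eqA _ (sw_tens _ _ _ _)) -!catA -tens_compr assocK.
by rewrite tensm1 compm1.
Qed.

(** The lists [b] and [b ++ [::]] are equal but not convertible; [pm] serves as the cast. *)
Lemma join_nil b : pm b (b ++ [::]) = join b [::] ∘ runiti _.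
Proof.
elim: b => [|y b IH]; first by rewrite /= lunit_runit_tunit runitiK.
rewrite -[(y :: b) ++ _]/(y :: (b ++ [::])) pm_cons IH tens_compr /= -catA.
congr (_ ∘ _); apply: (iso_epi (runitiK _)); rewrite -!catA runitK.
by rewrite -runit_tens catA -tens_compr runitK tensm1 comp1m compm1.
Qed.

(** The bridge between named permutations and the symmetry of the category. The wires of [a] pass
    the block [b] one at a time, each by the second hexagon [sym_tens_sw]. *)
Lemma pm_sym a b : uniq (a ++ b) ->
  pm (a ++ b) (b ++ a) = join b a ∘ sym _ _ ∘ split a b.
Proof.
elim: a => [_|x a IH].
  rewrite join_nil /=; congr (_ ∘ _).
  by apply: (iso_epi (lunitiK _)); rewrite -!catA lunitK compm1 -runit_sym catA runitK comp1m.
rewrite /= mem_cat negb_or => /andP[/andP[_ xb] u].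
rewrite -(pm_comp (s2 := x :: (b ++ a))).
- rewrite pm_cons IH // tens_compr.
  rewrite (eqA _ (pm_move _ xb)) tens_compr -(eqA _ (sym_tens_sw _ _ _)).
  by [].
- by rewrite perm_cons perm_catC.
by rewrite -(cat1s x) perm_catCA perm_refl.
Qed.

End Wires.

(** * String diagrams *)

(* A box: the index of its morphism, its input wires and its output wires. *)
Notation instr := (nat * (seq wire * seq wire))%type.
Definition ins (i : instr) : seq wire := i.2.1.
Definition outs (i : instr) : seq wire := i.2.2.

Definition rest (d s : seq wire) := [seq w <- s | w \notin d].

(** Programs are linear: wires are neither copied nor discarded except by boxes such as [comul] and
    [counit]. *)
Fixpoint vld (p : seq instr) (s s' : seq wire) : bool :=
  match p with
  | [::] => perm_eq s s'
  | i :: p' => [&& uniq (ins i), all (mem s) (ins i), uniq (outs i ++ rest (ins i) s)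
                 & vld p' (outs i ++ rest (ins i) s) s']
  end.

Lemma perm_rest d s : uniq s -> uniq d -> all (mem s) d -> perm_eq s (d ++ rest d s).
Proof.
move=> us ud /allP ds; apply: uniq_perm => //.
  rewrite cat_uniq ud filter_uniq // andbT; apply/hasPn => x.
  by rewrite mem_filter => /andP[].
move=> x; rewrite mem_cat mem_filter.
by case: (boolP (x \in d)) => // /ds.
Qed.

Lemma perm_rest_eq d s s' : perm_eq s s' -> perm_eq (rest d s) (rest d s').
Proof. exact: perm_filter. Qed.

Lemma vld_perm p s1 s2 s' : perm_eq s1 s2 -> vld p s1 s' = vld p s2 s'.
Proof.
elim: p s1 s2 => [|i p IH] s1 s2 e /=; first by apply: (permPl e).
have e' : perm_eq (outs i ++ rest (ins i) s1) (outs i ++ rest (ins i) s2).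
  by rewrite perm_cat2l perm_rest_eq.
rewrite (IH _ _ e') (perm_uniq e'); congr [&& _, _ & _].
by apply: eq_all => x /=; apply: (perm_mem e).
Qed.

(* [f] with idle wires [c], locked for the same reason as [sw]. *)
HB.lock Definition wh (R : comPzRingType) (C : symMonCat R) (ob : nat -> C)
    (a b : seq wire) (f : Mor (big ob a) (big ob b)) (c : seq wire) :
    Mor (big ob (a ++ c)) (big ob (b ++ c)) :=
  join ob b c ∘ (f ⊠ idm _) ∘ split ob a c.

Section Denotation.
Variables (R : comPzRingType) (C : symMonCat R) (ob : nat -> C).
Implicit Types (s a b c : seq wire) (p q : seq instr).
Local Notation big := (big ob).
Local Notation pm := (pm ob).
Local Notation join := (join ob).
Local Notation split := (split ob).

Lemma wh_comp a b b' (g : Mor (big b) (big b')) (f : Mor (big a) (big b)) c :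
  wh (g ∘ f) c = wh g c ∘ wh f c.
Proof. by rewrite !wh.unlock tens_compl -!catA (cancA _ (joinK _ _ _)). Qed.

Lemma wh_pm a b c : perm_eq a b -> wh (pm a b) c = pm (a ++ c) (b ++ c).
Proof.
move=> p; rewrite !wh.unlock catA -pm_cat // -!catA.
by rewrite splitK compm1.
Qed.

Lemma join_assoc a b c :
  pm ((a ++ b) ++ c) (a ++ (b ++ c)) ∘ join (a ++ b) c ∘ (join a b ⊠ idm _) =
  join a (b ++ c) ∘ (idm _ ⊠ join b c) ∘ assoc _ _ _.
Proof.
elim: a => [|x a IH].
  by rewrite /= pm_id comp1m (eqA _ (lunit_nat _)) lunit_tens.
rewrite -[(x :: a) ++ (b ++ c)]/(x :: (a ++ (b ++ c))).
rewrite -[((x :: a) ++ b) ++ c]/(x :: ((a ++ b) ++ c)) pm_cons.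
rewrite /= tens_compl -!catA (eqA _ (assoc_nat _ _ _)).
rewrite [in LHS]catA [in LHS]catA -!tens_compr -catA IH !tens_compr -!catA.
rewrite -pentagon -[in RHS]tensm1 (eqA _ (assoc_nat _ _ _)).
by [].
Qed.

Lemma wh_wh a a' (f : Mor (big a) (big a')) b c :
  pm ((a' ++ b) ++ c) (a' ++ (b ++ c)) ∘ wh (wh f b) c =
  wh f (b ++ c) ∘ pm ((a ++ b) ++ c) (a ++ (b ++ c)).
Proof.
have e : (join (a ++ b) c ∘ (join a b ⊠ idm _)) ∘
    (split a b ⊠ idm _) ∘ split (a ++ b) c = idm _.
  by rewrite -!catA (cancA (f := _ ⊠ _)) ?splitK // -tens_compl splitK tensm1.
apply: (iso_epi e); rewrite !wh.unlock !tens_compl -!catA.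
rewrite (cancA _ (joinK _ _ _)) join_assoc.
rewrite -[(split a _ ⊠ _) ∘ _]tens_compl joinK tensm1 compm1.
rewrite (eqA3 _ (join_assoc _ _ _)) (cancA _ (joinK _ _ _)).
rewrite assoc_nat; congr (_ ∘ _).
by rewrite !catA; congr (_ ∘ _); rewrite -!tensm_comp !tensm1 !comp1m !compm1.
Qed.

Variable G : nat -> forall a b, Mor (big a) (big b).

Definition step (i : instr) s : Mor (big s) (big (outs i ++ rest (ins i) s)) :=
  wh (G i.1 (ins i) (outs i)) (rest (ins i) s) ∘ pm s (ins i ++ rest (ins i) s).

Fixpoint den p s s' : Mor (big s) (big s') :=
  match p with
  | [::] => pm s s'
  | i :: p' => den p' (outs i ++ rest (ins i) s) s' ∘ step i s
  end.

Lemma wh_frame a b (f : Mor (big a) (big b)) c c' :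
  wh f c' ∘ pm (a ++ c) (a ++ c') = pm (b ++ c) (b ++ c') ∘ wh f c.
Proof.
apply: (iso_epi (splitK _ a c)); rewrite !wh.unlock -!catA joinK compm1.
rewrite pm_catl (cancA _ (joinK _ _ _)) (eqA _ (pm_catl _ _ _ _)).
by rewrite -!tensm_comp !comp1m !compm1.
Qed.

Lemma step_alt i s s0 r : uniq s -> uniq (ins i) -> all (mem s) (ins i) ->
  perm_eq s0 s -> perm_eq s (ins i ++ r) ->
  wh (G i.1 (ins i) (outs i)) r ∘ pm s (ins i ++ r) ∘ pm s0 s =
  pm (outs i ++ rest (ins i) s0) (outs i ++ r) ∘ step i s0.
Proof.
move=> us ui si e er.
have us0 : uniq s0 by rewrite (perm_uniq e).
have si0 : all (mem s0) (ins i).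
  by rewrite (eq_all (a2 := mem s)) // => x; apply: (perm_mem e).
have e0 := perm_rest us0 ui si0.
rewrite pm_comp // /step catA -wh_frame -catA pm_comp //.
by rewrite -(permPl e0) (permPl e).
Qed.

Lemma den_pm p s0 s s' : uniq s -> perm_eq s0 s -> vld p s s' ->
  den p s s' ∘ pm s0 s = den p s0 s'.
Proof.
elim: p s0 s => [|i p IH] s0 s us e /=; first by move=> e'; rewrite pm_comp.
case/and4P=> ui si uo v.
rewrite /step -!catA step_alt //; last exact: perm_rest.
by rewrite catA IH // perm_cat2l perm_rest_eq.
Qed.

(** Frees the first step from the particular list [rest (ins i) s]: any list [r] of the idle wires
    will do. *)
Lemma den_cons i p s r s' : uniq s -> vld (i :: p) s s' ->
  perm_eq s (ins i ++ r) ->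
  den (i :: p) s s' =
  den p (outs i ++ r) s' ∘ wh (G i.1 (ins i) (outs i)) r ∘ pm s (ins i ++ r).
Proof.
move=> us /= /and4P[ui si uo v] e.
have := step_alt us ui si (perm_refl s) e; rewrite pm_id compm1 => ->.
have e' : perm_eq (outs i ++ rest (ins i) s) (outs i ++ r).
  by rewrite perm_cat2l -(perm_cat2l (ins i)) -(permPl (perm_rest us ui si)).
by rewrite catA den_pm // -?(perm_uniq e') // -(vld_perm _ _ e').
Qed.

Lemma vld_cons i p s r s' : uniq s -> vld (i :: p) s s' -> perm_eq s (ins i ++ r) ->
  uniq (outs i ++ r) && vld p (outs i ++ r) s'.
Proof.
move=> us /= /and4P[ui si uo v] e.
have e' : perm_eq (outs i ++ rest (ins i) s) (outs i ++ r).
  by rewrite perm_cat2l -(perm_cat2l (ins i)) -(permPl (perm_rest us ui si)).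
by rewrite -(perm_uniq e') uo -(vld_perm _ _ e').
Qed.

(** The interchange law. Each exchange of blocks is a symmetry by [pm_sym], and naturality moves the
    boxes through it. *)
Lemma wh_swap0 a a' b b' (f : Mor (big a) (big a')) (g : Mor (big b) (big b')) :
  uniq (a ++ b) -> uniq (a' ++ b) -> uniq (a ++ b') -> uniq (a' ++ b') ->
  wh g a' ∘ pm (a' ++ b) (b ++ a') ∘ wh f b =
  pm (a' ++ b') (b' ++ a') ∘ wh f b' ∘ pm (b' ++ a) (a ++ b') ∘ wh g a
    ∘ pm (a ++ b) (b ++ a).
Proof.
move=> u1 u2 u3 u4; rewrite !wh.unlock !pm_sym // 1?(uniq_catC b') //.
rewrite -!catA !(cancA _ (joinK _ _ _)); congr (_ ∘ _); rewrite !catA.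
congr (_ ∘ _); rewrite -!catA sym_nat [in RHS](eqA _ (sym_nat _ _)) (cancA _ (symK _ _)).
by rewrite !catA; congr (_ ∘ _); rewrite -!tensm_comp !comp1m !compm1.
Qed.

Lemma pm_assoc_comp a b c d r : perm_eq (a ++ b) (c ++ d) ->
  pm ((c ++ d) ++ r) (c ++ (d ++ r)) ∘ pm ((a ++ b) ++ r) ((c ++ d) ++ r) =
  pm (a ++ (b ++ r)) (c ++ (d ++ r)) ∘ pm ((a ++ b) ++ r) (a ++ (b ++ r)).
Proof.
move=> e; rewrite !pm_comp // ?perm_cat2r // -?[_ ++ (_ ++ r)]seq.catA ?seq.catA ?perm_cat2r //.
Qed.

Lemma wh_swap a a' b b' r (f : Mor (big a) (big a')) (g : Mor (big b) (big b')) :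
  uniq (a ++ b) -> uniq (a' ++ b) -> uniq (a ++ b') -> uniq (a' ++ b') ->
  wh g (a' ++ r) ∘ pm (a' ++ (b ++ r)) (b ++ (a' ++ r)) ∘ wh f (b ++ r) =
  pm (a' ++ (b' ++ r)) (b' ++ (a' ++ r)) ∘ wh f (b' ++ r)
    ∘ pm (b' ++ (a ++ r)) (a ++ (b' ++ r)) ∘ wh g (a ++ r)
    ∘ pm (a ++ (b ++ r)) (b ++ (a ++ r)).
Proof.
move=> u1 u2 u3 u4.
have e (x y : seq wire) :
    pm ((x ++ y) ++ r) (x ++ (y ++ r)) ∘ pm (x ++ (y ++ r)) ((x ++ y) ++ r) = idm _.
  by rewrite pmK // seq.catA.
apply: (iso_epi (e a b)); rewrite -!catA -wh_wh.
have pc (x y : seq wire) : perm_eq (x ++ y) (y ++ x) by rewrite perm_catC.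
have pcA x y W (k : Mor W _) := esym (eqA k (pm_assoc_comp r (pc x y))).
have wA x x' h y W (k : Mor W _) := esym (eqA k (@wh_wh x x' h y r)).
rewrite -(pm_assoc_comp _ (pc _ _)); do 4 rewrite ?wA ?pcA.
by rewrite -!wh_pm // -!wh_comp wh_swap0.
Qed.

Lemma den_swap i j p s s' : uniq s ->
  vld (i :: j :: p) s s' -> vld (j :: i :: p) s s' ->
  perm_eq s (ins i ++ (ins j ++ rest (ins i ++ ins j) s)) ->
  den (i :: j :: p) s s' = den (j :: i :: p) s s'.
Proof.
move=> us v1 v2; set r := rest _ s => e1.
have e2 : perm_eq s (ins j ++ (ins i ++ r)) by rewrite (permPl e1) perm_catCA.
have [u1 v1'] := andP (vld_cons us v1 e1).
have [u2 v2'] := andP (vld_cons us v2 e2).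
have e1' : perm_eq (outs i ++ (ins j ++ r)) (ins j ++ (outs i ++ r)) by rewrite perm_catCA.
have e2' : perm_eq (outs j ++ (ins i ++ r)) (ins i ++ (outs j ++ r)) by rewrite perm_catCA.
rewrite (den_cons us v1 e1) (den_cons us v2 e2).
rewrite (den_cons u1 v1' e1') (den_cons u2 v2' e2').
have [u1' v1''] := andP (vld_cons u1 v1' e1').
have e3 : perm_eq (outs i ++ (outs j ++ r)) (outs j ++ (outs i ++ r)) by rewrite perm_catCA.
rewrite -(den_pm u1' e3) // -!catA; congr (_ ∘ _).
have e4 : perm_eq (ins i ++ (ins j ++ r)) (ins j ++ (ins i ++ r)) by rewrite perm_catCA.
rewrite -(pm_comp _ e1 e4).
rewrite !catA; congr (_ ∘ _); rewrite -!catA.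
have up (x y : seq wire) : uniq (x ++ (y ++ r)) -> uniq (x ++ y).
  by rewrite seq.catA cat_uniq => /andP[].
apply: wh_swap.
- by apply: up; rewrite -(perm_uniq e1).
- exact: up u1.
- by rewrite uniq_catC; exact: up u2.
by rewrite uniq_catC; exact: up u1'.
Qed.

Lemma vld_consI i p s r s' : uniq s -> uniq (ins i) -> perm_eq s (ins i ++ r) ->
  uniq (outs i ++ r) -> vld p (outs i ++ r) s' -> vld (i :: p) s s'.
Proof.
move=> us ui e uo v /=; rewrite ui.
have si : all (mem s) (ins i).
  by apply/allP => w wi; rewrite /= (perm_mem e) mem_cat wi.
have e' : perm_eq (outs i ++ rest (ins i) s) (outs i ++ r).
  by rewrite perm_cat2l -(perm_cat2l (ins i)) -(permPl (perm_rest us ui si)).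
by rewrite si (perm_uniq e') uo (vld_perm _ _ e').
Qed.

(** Static single assignment. [vld] alone lets a consumed name be produced again, and the box
    producing it could then not be moved before the box that frees the name. *)
Definition ssa s p := uniq (s ++ flatten (map outs p)).

Lemma vld_notin p s s' w : vld p s s' -> w \notin s ->
  w \notin flatten (map outs p) -> {in p, forall j, w \notin ins j}.
Proof.
elim: p s => // i p IH s /= /and4P[ui si uo v] ws; rewrite mem_cat negb_or.
case/andP=> wo wp j; rewrite inE => /orP[/eqP->|jp].
  by apply: contra ws => /(allP si).
apply: IH v _ wp j jp; rewrite mem_cat negb_or wo mem_filter negb_and.
by rewrite ws orbT.
Qed.

Lemma ssa_step i p s : ssa s (i :: p) -> ssa (outs i ++ rest (ins i) s) p.
Proof.
rewrite /ssa /= => u; rewrite -seq.catA uniq_catCA.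
by apply: subseq_uniq u; apply: cat_subseq => //; apply: filter_subseq.
Qed.

(** A box whose inputs are all present at the start waits for nothing. By [dij] no earlier box
    consumes these inputs: under [ssa] a consumed wire never comes back, so [j] could not have used
    it. *)
Lemma den_bubble p1 j p2 s s' : uniq s -> vld (p1 ++ j :: p2) s s' ->
  all (mem s) (ins j) -> ssa s (p1 ++ j :: p2) ->
  vld (j :: p1 ++ p2) s s' /\ den (p1 ++ j :: p2) s s' = den (j :: p1 ++ p2) s s'.
Proof.
elim: p1 s => //= i p1 IH s us v sj a.
have /and4P[ui si uo v1] := v.
have dij w : w \in ins j -> w \notin ins i.
  move=> wj; apply/negP => wi.
  have ws := allP si _ wi; move: a; rewrite /ssa cat_uniq => /and3P[_ /hasPn a _].
  have wn : w \notin flatten (map outs (i :: p1 ++ j :: p2)).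
    by apply/negP => /a /=; rewrite (ws : w \in s).
  move: wn; rewrite /= mem_cat negb_or => /andP[wo wp].
  have := vld_notin v1 _ wp (x := j).
  rewrite mem_cat negb_or wo mem_filter wi /= => /(_ isT).
  by rewrite mem_cat mem_head orbT wj => /(_ isT).
have sj1 : all (mem (outs i ++ rest (ins i) s)) (ins j).
  apply/allP => w wj; rewrite /= mem_cat mem_filter dij //=.
  by rewrite (allP sj _ wj : w \in s) orbT.
have [v2 d2] := IH _ uo v1 sj1 (ssa_step a).
have /and4P[uj _ uo2 v3] := v2.
have e1 : perm_eq s (ins i ++ (ins j ++ rest (ins i ++ ins j) s)).
  rewrite seq.catA; apply: perm_rest => //; last by rewrite all_cat si.
  by rewrite cat_uniq ui uj andbT; apply/hasPn.
have e2 : perm_eq s (ins j ++ (ins i ++ rest (ins i ++ ins j) s)).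
  by rewrite (permPl e1) perm_catCA.
set r := rest (ins i ++ ins j) s in e1 e2.
have ei : perm_eq (rest (ins i) s) (ins j ++ r).
  by rewrite -(perm_cat2l (ins i)) -(permPl (perm_rest us ui si)).
have e3 : perm_eq (outs i ++ rest (ins i) s) (ins j ++ (outs i ++ r)).
  by rewrite perm_sym perm_catCA perm_cat2l perm_sym.
have /andP[u1 v2'] := vld_cons uo v2 e3.
have sub : subseq (outs j) (flatten (map outs (i :: p1 ++ j :: p2))).
  rewrite /= map_cat flatten_cat /=.
  by do 2 apply: subseq_trans (suffix_subseq _ _); apply: prefix_subseq.
have uoj : uniq (s ++ outs j).
  by apply: subseq_uniq a; apply: cat_subseq.
have uj2 : uniq (outs j ++ (ins i ++ r)).
  have e5 : perm_eq (outs j ++ s) (ins j ++ (outs j ++ (ins i ++ r))).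
    by rewrite perm_sym perm_catCA perm_cat2l perm_sym.
  by move: uoj; rewrite uniq_catC (perm_uniq e5) cat_uniq => /and3P[].
have v3' : vld (j :: i :: p1 ++ p2) s s'.
  apply: (vld_consI us uj e2 uj2).
  have e6 : perm_eq (outs j ++ (ins i ++ r)) (ins i ++ (outs j ++ r)).
    by rewrite perm_catCA.
  apply: (vld_consI uj2 ui e6); first by rewrite uniq_catCA.
  by rewrite (vld_perm _ _ (_ : perm_eq _ (outs j ++ (outs i ++ r)))) // perm_catCA.
split => //; transitivity (den (i :: j :: p1 ++ p2) s s'); first by rewrite /= d2.
by apply: den_swap => //; rewrite /= ui si uo.
Qed.

(** Both programs are linear extensions of the same dependencies. The head of [q] bubbles to the
    front of [p], and induction treats the tails. *)
Lemma den_permP p q s s' : uniq s -> vld p s s' -> vld q s s' -> perm_eq p q ->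
  ssa s p -> den p s s' = den q s s'.
Proof.
elim: q p s => [|j q IH] p s us vp vq e a.
  by have := perm_size e; case: p {vp e a}.
have jp : j \in p by rewrite (perm_mem e) mem_head.
case/splitPr: jp vp e a => p1 p2 vp e a.
have /and4P[uj sj uo v] := vq.
have [vp' ->] := den_bubble us vp sj a.
have e' : perm_eq (p1 ++ p2) q by rewrite -(perm_cons j) -(permPr e) -cat1s -[_ :: p2]cat1s perm_catCA.
rewrite /= (IH (p1 ++ p2)) //; first by case/and4P: vp'.
apply: ssa_step; rewrite /ssa (perm_uniq (_ : perm_eq _ (s ++ flatten (map outs (p1 ++ j :: p2))))) //.
by rewrite perm_cat2l; apply: perm_flatten; apply: perm_map; rewrite -cat1s -[_ :: p2]cat1s perm_catCA.
Qed.

End Denotation.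

(** * Renaming of wires, and programs run in a larger context *)

Definition type_ok (f : wire -> wire) := forall w, (f w).1 = w.1.

Definition imap (f : wire -> wire) (i : instr) : instr :=
  (i.1, (map f (ins i), map f (outs i))).

Definition wires (p : seq instr) := flatten [seq ins i ++ outs i | i <- p].

Lemma wtypes_map f s : type_ok f -> wtypes (map f s) = wtypes s.
Proof. by move=> tf; rewrite /wtypes -map_comp; apply: eq_map => w /=. Qed.

Lemma rem_map (f : wire -> wire) (w : wire) (s : seq wire) : {in w :: s &, injective f} ->
  rem (f w) (map f s) = map f (rem w s).
Proof.
elim: s => //= x s IH inj; have [->|xw] := eqVneq x w; first by rewrite eqxx.
case: eqVneq => [/inj|_].
  by rewrite !inE !eqxx ?orbT => /(_ isT isT) e; rewrite e eqxx in xw.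
rewrite /= IH // => y z; rewrite !inE => hy hz; apply: inj; rewrite !inE.
  by case/orP: hy => ->; rewrite ?orbT.
by case/orP: hz => ->; rewrite ?orbT.
Qed.

Lemma rest_map (f : wire -> wire) (d s : seq wire) : {in d ++ s &, injective f} ->
  rest (map f d) (map f s) = map f (rest d s).
Proof.
move=> inj; rewrite /rest filter_map; congr (map f _); apply: eq_in_filter => w ws.
congr (~~ _); apply/mapP/idP => [[x xd /inj ->]|wd]; last by exists w.
- by [].
- by rewrite mem_cat ws orbT.
by rewrite mem_cat xd.
Qed.

Lemma vld_map f p s s' : {in s ++ wires p &, injective f} -> vld p s s' ->
  vld (map (imap f) p) (map f s) (map f s').
Proof.
elim: p s => [|i p IH] s inj /=; first exact: perm_map.
case/and4P => ui si uo v; have di : {subset ins i <= s} by apply/allP.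
have sub : {subset (outs i ++ rest (ins i) s) ++ wires p <= s ++ wires (i :: p)}.
  move=> w; rewrite /wires /= !mem_cat mem_filter.
  by case/orP => [/orP[|/andP[_]]|] ->; rewrite ?orbT.
have e : map f (outs i) ++ rest (map f (ins i)) (map f s) = map f (outs i ++ rest (ins i) s).
  rewrite map_cat rest_map // => x y hx hy; apply: inj.
    by move: hx; rewrite !mem_cat => /orP[/di|] ->.
  by move: hy; rewrite !mem_cat => /orP[/di|] ->.
rewrite /ins /outs /= in e *; rewrite e IH // ?andbT; last first.
  by move=> x y /sub hx /sub hy; apply: inj.
apply/and3P; split.
- rewrite map_inj_in_uniq // => x y /di hx /di hy.
  by apply: inj; rewrite mem_cat ?hx ?hy.
- by apply/allP => _ /mapP[w /di ws ->]; apply: map_f.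
rewrite map_inj_in_uniq // => x y hx hy.
by apply: inj; apply: sub; rewrite mem_cat ?hx ?hy.
Qed.

Lemma vld_cat p q s m s' : vld p s m -> vld (p ++ q) s s' = vld q m s'.
Proof.
elim: p s => [|i p IH] s /=; first by move=> e; apply: vld_perm.
by case/and4P=> -> -> -> /IH ->.
Qed.

Lemma vld_uniq p s s' : uniq s -> vld p s s' -> uniq s'.
Proof.
elim: p s => [|i p IH] s /=; first by move=> us e; rewrite -(perm_uniq e).
by move=> _ /and4P[_ _ uo]; apply: IH.
Qed.

Lemma vld_frame p q a b c s' : uniq (a ++ c) -> vld p a b ->
  vld (p ++ q) (a ++ c) s' -> uniq (b ++ c) && vld q (b ++ c) s'.
Proof.
elim: p a => [|i p IH] a u v.
  have e : perm_eq (a ++ c) (b ++ c) by rewrite perm_cat2r.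
  by rewrite /= (vld_perm _ _ e) -(perm_uniq e) u.
have ua : uniq a by move: u; rewrite cat_uniq => /and3P[].
have /and4P[ui si uo v1] := v.
have e' : perm_eq (a ++ c) (ins i ++ (rest (ins i) a ++ c)).
  by rewrite seq.catA perm_cat2r; apply: perm_rest.
move=> v'; have /andP[u2 v2] := vld_cons u v' e'.
by apply: IH v1 _; rewrite -seq.catA.
Qed.

Section Frames.
Variables (R : comPzRingType) (C : symMonCat R) (ob : nat -> C).
Implicit Types (s a b c : seq wire) (p q : seq instr).
Local Notation big := (big ob).
Local Notation pm := (pm ob).
Local Notation join := (join ob).
Local Notation split := (split ob).
Local Notation relab := (relab ob).
Variable G : nat -> forall a b, Mor (big a) (big b).
Local Notation den := (den G).

Lemma den_cat p q s m s' : uniq s -> vld p s m -> vld (p ++ q) s s' ->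
  den (p ++ q) s s' = den q m s' ∘ den p s m.
Proof.
elim: p s => [|i p IH] s us /=.
  move=> e v; rewrite den_pm //; first by rewrite -(perm_uniq e).
  by rewrite -(vld_perm _ _ e).
by case/and4P=> ui si uo v /and4P[_ _ _ v']; rewrite (IH _ uo) // catA.
Qed.

(** Locality: a part of a program does not see the idle wires [c]. This is what allows a rule to act
    inside a larger diagram. *)
Lemma den_frame p q a b c s' : uniq (a ++ c) -> vld p a b ->
  vld (p ++ q) (a ++ c) s' ->
  den (p ++ q) (a ++ c) s' = den q (b ++ c) s' ∘ wh (den p a b) c.
Proof.
elim: p a => [|i p IH] a u v v'.
  have e : perm_eq (a ++ c) (b ++ c) by rewrite perm_cat2r.
  rewrite /= wh_pm // den_pm -?(perm_uniq e) //.
  by rewrite -(vld_perm _ _ e).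
have ua : uniq a by move: u; rewrite cat_uniq => /and3P[].
have /and4P[ui si uo v1] := v.
have e := perm_rest ua ui si; set r := rest (ins i) a in e uo v1.
have e' : perm_eq (a ++ c) (ins i ++ (r ++ c)).
  by rewrite seq.catA perm_cat2r.
rewrite (den_cons G u v' e').
have /andP[u2 v2] := vld_cons u v' e'.
rewrite /= /step -/r !wh_comp wh_pm // -/(cat p q) in v2 *.
have <- : pm ((ins i ++ r) ++ c) (ins i ++ (r ++ c)) ∘ pm (a ++ c) ((ins i ++ r) ++ c)
   = pm (a ++ c) (ins i ++ (r ++ c)).
  by rewrite pm_comp // ?perm_cat2r // seq.catA.
rewrite [X in _ ∘ X]catA -wh_wh -!catA catA [RHS]catA; congr (_ ∘ _).
rewrite seq.catA in u2 v2; rewrite -IH //.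
by rewrite den_pm //; rewrite seq.catA.
Qed.

(** The first program runs with [w2] idle and the second with [o1] idle. The two exchanges of blocks
    in between are symmetries, which cancel by naturality. *)
Lemma den_tens p1 p2 w1 w2 o1 o2 : uniq (w1 ++ w2) -> vld p1 w1 o1 ->
  vld p2 w2 o2 -> vld (p1 ++ p2) (w1 ++ w2) (o1 ++ o2) ->
  den (p1 ++ p2) (w1 ++ w2) (o1 ++ o2) =
  join o1 o2 ∘ (den p1 w1 o1 ⊠ den p2 w2 o2) ∘ split w1 w2.
Proof.
move=> u v1 v2 v; rewrite (den_frame u v1 v).
have /andP[u' v'] := vld_frame u v1 v.
have e : perm_eq (o1 ++ w2) (w2 ++ o1) by rewrite perm_catC.
have u2 : uniq (w2 ++ o1) by rewrite -(perm_uniq e).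
have v2' : vld (p2 ++ [::]) (w2 ++ o1) (o1 ++ o2) by rewrite cats0 -(vld_perm _ _ e).
rewrite -(den_pm G u2 e); last by rewrite cats0 in v2'.
have := den_frame u2 v2 v2'; rewrite {1}cats0 => ->.
have /andP[u3 _] := vld_frame u2 v2 v2'.
rewrite /= !pm_sym // !wh.unlock -!catA !(cancA _ (joinK _ _ _)); congr (_ ∘ _).
rewrite (eqA _ (sym_nat _ _)) (cancA _ (symK _ _)) catA.
by rewrite -tensm_comp comp1m compm1.
Qed.

Section Relabelling.
Variable f : wire -> wire.
Hypothesis tf : type_ok f.

Lemma ext_relab s w : w \in s -> {in s &, injective f} ->
  (cast_ty ob w.1 (f w).1 ⊠ relab (rem w s) (rem (f w) (map f s))) ∘ ext ob s w =
  ext ob (map f s) (f w) ∘ relab s (map f s).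
Proof.
elim: s => // x s IH ws inj.
have [e|xw] := eqVneq x w.
  subst x; rewrite /= !eqxx -!tensm_comp !comp1m !cast_wirexx.
  by rewrite compm1 comp1m compm1.
have fxw : f x != f w.
  by apply: contra xw => /eqP/inj ->; rewrite ?mem_head.
rewrite /= (negbTE xw) (negbTE fxw) /= -catA -[in RHS]tensm_comp.
rewrite -IH.
- rewrite (eqA (f := _ ⊠ (_ ⊠ _)) _ (esym (sw_nat _ _ _))) -tensm_comp.
  by rewrite comp1m compm1.
- by move: ws; rewrite inE eq_sym (negbTE xw).
by move=> y z ys zs; apply: inj; rewrite inE ?ys ?zs orbT.
Qed.

Lemma pm_relab s s' : perm_eq s s' -> {in s &, injective f} ->
  relab s' (map f s') ∘ pm s s' = pm (map f s) (map f s') ∘ relab s (map f s).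
Proof.
elim: s' s => [|w t IH] s e inj.
  by have := perm_size e; case: s e inj => //= _ _ _; rewrite comp1m.
have ws : w \in s by rewrite (perm_mem e) mem_head.
rewrite /= -!catA -ext_relab // !catA -!tensm_comp compm1 comp1m rem_map ?IH //.
- by rewrite -(perm_cons w) -(permPl (perm_to_rem ws)).
- by move=> x y /mem_rem xs /mem_rem ys; apply: inj.
by move=> x y; rewrite !inE => /orP[/eqP->|xs] /orP[/eqP->|ys]; apply: inj.
Qed.

Lemma wh_relab a a' b b' c c' (g : Mor (big a) (big b)) (g' : Mor (big a') (big b')) :
  size a = size a' -> size b = size b' ->
  relab b b' ∘ g = g' ∘ relab a a' ->
  relab (b ++ c) (b' ++ c') ∘ wh g c = wh g' c' ∘ relab (a ++ c) (a' ++ c').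
Proof.
move=> sa sb e; rewrite !wh.unlock catA relab_cat // -!catA relab_cat_split //.
congr (_ ∘ _); rewrite !catA; congr (_ ∘ _).
by rewrite -!tensm_comp e compm1 comp1m.
Qed.

Hypothesis G_relab : forall g a b a' b', wtypes a = wtypes a' -> wtypes b = wtypes b' ->
  relab b b' ∘ G g a b = G g a' b' ∘ relab a a'.

Lemma den_relab p s s' : uniq s -> {in s ++ wires p &, injective f} -> vld p s s' ->
  relab s' (map f s') ∘ den p s s' =
  den (map (imap f) p) (map f s) (map f s') ∘ relab s (map f s).
Proof.
elim: p s => [|i p IH] s us inj /=.
  move=> e; apply: pm_relab => // x y xs ys; apply: inj.
    by rewrite mem_cat xs.
  by rewrite mem_cat ys.
case/and4P => ui si uo v; have di : {subset ins i <= s} by apply/allP.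
have sub : {subset (outs i ++ rest (ins i) s) ++ wires p <= s ++ wires (i :: p)}.
  move=> w; rewrite /wires /= !mem_cat mem_filter.
  by case/orP => [/orP[|/andP[_]]|] ->; rewrite ?orbT.
have er : rest (map f (ins i)) (map f s) = map f (rest (ins i) s).
  rewrite rest_map // => x y hx hy; apply: inj.
    by move: hx; rewrite !mem_cat => /orP[/di|] ->.
  by move: hy; rewrite !mem_cat => /orP[/di|] ->.
have e : map f (outs i) ++ map f (rest (ins i) s) = map f (outs i ++ rest (ins i) s).
  by rewrite map_cat.
rewrite catA IH //; last by move=> x y /sub hx /sub hy; apply: inj.
rewrite /step [ins (imap f i)]/(map f (ins i)) [outs (imap f i)]/(map f (outs i)) er.
rewrite -!catA -e; congr (_ ∘ _).
have ei := pm_relab (perm_rest us ui si) (_ : {in s &, injective f}).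
rewrite map_cat in ei; rewrite -ei; last first.
  by move=> x y xs ys; apply: inj; rewrite mem_cat ?xs ?ys.
rewrite !catA; congr (_ ∘ _); apply: wh_relab; rewrite ?size_map //.
by apply: G_relab; rewrite wtypes_map.
Qed.

End Relabelling.
End Frames.

(** * Linear combinations and rewriting of diagrams *)

Section Additivity.
Variables (R : comPzRingType).

Lemma compDl (C : linCat R) (X Y Z : C) (g g' : Mor Y Z) (f : Mor X Y) :
  (g + g') ∘ f = g ∘ f + g' ∘ f.
Proof. by have := comp_linl f 1 g g'; rewrite !scale1r. Qed.

Lemma compDr (C : linCat R) (X Y Z : C) (g : Mor Y Z) (f f' : Mor X Y) :
  g ∘ (f + f') = g ∘ f + g ∘ f'.
Proof. by have := comp_linr g 1 f f'; rewrite !scale1r. Qed.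

Lemma compNl (C : linCat R) (X Y Z : C) (g : Mor Y Z) (f : Mor X Y) :
  (- g) ∘ f = - (g ∘ f).
Proof. by apply/eqP; rewrite -addr_eq0 -compDl addNr comp0m. Qed.

Lemma compNr (C : linCat R) (X Y Z : C) (g : Mor Y Z) (f : Mor X Y) :
  g ∘ (- f) = - (g ∘ f).
Proof. by apply/eqP; rewrite -addr_eq0 -compDr addNr compm0. Qed.

Lemma compBl (C : linCat R) (X Y Z : C) (g g' : Mor Y Z) (f : Mor X Y) :
  (g - g') ∘ f = g ∘ f - g' ∘ f.
Proof. by rewrite compDl compNl. Qed.

Lemma compBr (C : linCat R) (X Y Z : C) (g : Mor Y Z) (f f' : Mor X Y) :
  g ∘ (f - f') = g ∘ f - g ∘ f'.
Proof. by rewrite compDr compNr. Qed.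

Lemma compZl (C : linCat R) (X Y Z : C) a (g : Mor Y Z) (f : Mor X Y) :
  (a *: g) ∘ f = a *: (g ∘ f).
Proof. by have := comp_linl f a g 0; rewrite comp0m !addr0. Qed.

Lemma compZr (C : linCat R) (X Y Z : C) a (g : Mor Y Z) (f : Mor X Y) :
  g ∘ (a *: f) = a *: (g ∘ f).
Proof. by have := comp_linr g a f 0; rewrite compm0 !addr0. Qed.

Variable C : symMonCat R.

Lemma tensDl (X Y X' Y' : C) (f f' : Mor X Y) (g : Mor X' Y') :
  (f + f') ⊠ g = f ⊠ g + f' ⊠ g.
Proof. by have := tensm_linl g 1 f f'; rewrite !scale1r. Qed.

Lemma tensDr (X Y X' Y' : C) (f : Mor X Y) (g g' : Mor X' Y') :
  f ⊠ (g + g') = f ⊠ g + f ⊠ g'.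
Proof. by have := tensm_linr f 1 g g'; rewrite !scale1r. Qed.

Lemma tensNl (X Y X' Y' : C) (f : Mor X Y) (g : Mor X' Y') : (- f) ⊠ g = - (f ⊠ g).
Proof. by apply/eqP; rewrite -addr_eq0 -tensDl addNr tens0m. Qed.

Lemma tensNr (X Y X' Y' : C) (f : Mor X Y) (g : Mor X' Y') : f ⊠ (- g) = - (f ⊠ g).
Proof. by apply/eqP; rewrite -addr_eq0 -tensDr addNr tensm0. Qed.

Lemma comp_suml (X Y Z : C) (I : Type) (r : seq I) (F : I -> Mor Y Z) (f : Mor X Y) :
  (\sum_(i <- r) F i) ∘ f = \sum_(i <- r) F i ∘ f.
Proof.
by elim/big_ind2: _ => [|h1 k1 h2 k2 <- <-|//]; rewrite ?comp0m ?compDl.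
Qed.

Lemma comp_sumr (X Y Z : C) (I : Type) (r : seq I) (F : I -> Mor X Y) (g : Mor Y Z) :
  g ∘ (\sum_(i <- r) F i) = \sum_(i <- r) g ∘ F i.
Proof.
by elim/big_ind2: _ => [|h1 k1 h2 k2 <- <-|//]; rewrite ?compm0 ?compDr.
Qed.

Lemma tens_suml (X Y Z W : C) (I : Type) (r : seq I) (F : I -> Mor X Y) (g : Mor Z W) :
  (\sum_(i <- r) F i) ⊠ g = \sum_(i <- r) F i ⊠ g.
Proof.
by elim/big_ind2: _ => [|h1 k1 h2 k2 <- <-|//]; rewrite ?tens0m ?tensDl.
Qed.

Lemma tens_sumr (X Y Z W : C) (I : Type) (r : seq I) (F : I -> Mor X Y) (g : Mor Z W) :
  g ⊠ (\sum_(i <- r) F i) = \sum_(i <- r) g ⊠ F i.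
Proof.
by elim/big_ind2: _ => [|h1 k1 h2 k2 <- <-|//]; rewrite ?tensm0 ?tensDr.
Qed.

Definition sg (X Y : C) (b : bool) (f : Mor X Y) := if b then - f else f.

Lemma sg_compl (X Y Z : C) b (g : Mor Y Z) (f : Mor X Y) : sg b g ∘ f = sg b (g ∘ f).
Proof. by case: b; rewrite /= ?compNl. Qed.

Lemma sg_compr (X Y Z : C) b (g : Mor Y Z) (f : Mor X Y) : g ∘ sg b f = sg b (g ∘ f).
Proof. by case: b; rewrite /= ?compNr. Qed.

Lemma sg_tensl (X Y Z W : C) b (f : Mor X Y) (g : Mor Z W) : sg b f ⊠ g = sg b (f ⊠ g).
Proof. by case: b; rewrite /= ?tensNl. Qed.

Lemma sg_tensr (X Y Z W : C) b (f : Mor X Y) (g : Mor Z W) : f ⊠ sg b g = sg b (f ⊠ g).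
Proof. by case: b; rewrite /= ?tensNr. Qed.

Lemma sg_sg (X Y : C) b b' (f : Mor X Y) : sg b (sg b' f) = sg (b (+) b') f.
Proof. by case: b; case: b'; rewrite /= ?opprK. Qed.

Lemma sg_sum (X Y : C) b (I : Type) (r : seq I) (F : I -> Mor X Y) :
  sg b (\sum_(i <- r) F i) = \sum_(i <- r) sg b (F i).
Proof. by case: b => //=; rewrite sumrN. Qed.

End Additivity.

(* A signed program ([true] stands for -1) with the list of its output wires. *)
Notation summand := (bool * (seq instr * seq wire))%type.

Record rule := Rule {
  r_in : seq wire; r_out : seq wire; r_lhs : seq instr; r_rhs : seq summand }.

Fixpoint look (m : seq (nat * nat)) (k : nat) : nat :=
  if m is (a, b) :: m' then if a == k then b else look m' k else k.

Definition ren m (w : wire) : wire := (w.1, look m w.2).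

Definition ids (s : seq wire) := map snd s.

Definition inj_on (f : wire -> wire) (s : seq wire) := uniq (map f (undup s)).

Lemma inj_onP f s : inj_on f s -> {in s &, injective f}.
Proof.
move=> u x y xs ys e; have xs' : x \in undup s by rewrite mem_undup.
have ys' : y \in undup s by rewrite mem_undup.
rewrite -(nth_index x xs') -(nth_index x ys'); congr nth.
apply/eqP; rewrite -(nth_uniq (f x) _ _ u) ?size_map ?index_mem //.
by rewrite !(nth_map x) ?index_mem // !nth_index // e.
Qed.

Definition wf_summand (s : seq wire) (t : summand) :=
  vld t.2.1 s t.2.2 && uniq (s ++ flatten (map outs t.2.1)).

(* The program following [lhs] consists of what uses, directly or not, its outputs. *)
Fixpoint sep (taint : seq wire) (p : seq instr) : seq instr * seq instr :=
  if p is i :: p' then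
    if has (mem taint) (ins i) then
      let: (pre, post) := sep (outs i ++ taint) p' in (pre, i :: post)
    else let: (pre, post) := sep taint p' in (i :: pre, post)
  else ([::], [::]).

Definition run (p : seq instr) (s : seq wire) :=
  foldl (fun s i => outs i ++ rest (ins i) s) s p.

Section ApplyRule.
Variables (r : rule) (m : seq (nat * nat)) (used : seq nat) (s : seq wire).

(* The inputs are renamed by [m], the other wires get numbers not in [used]. *)
Definition rhs_ren (t : summand) :=
  let dom := ids (r_in r) in
  let new := undup [seq k <- ids (wires t.2.1) | k \notin dom] in
  let free := [seq k <- iota 0 (size used + size new) | k \notin used] in
  ren (zip dom (map (look m) dom) ++ zip new free).

Definition rhs_prog pre post c (t : summand) : summand :=
  let g := rhs_ren t in
  let o := map g t.2.2 in
  let h := ren (zip (ids (map (ren m) (r_out r))) (ids o)) in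
  (t.1, (pre ++ map (imap g) t.2.1 ++ map (imap h) post, map h c)).

Definition rhs_ok pre post c o' (t : summand) : bool :=
  let g := rhs_ren t in
  let o := map g t.2.2 in
  let b := map (ren m) (r_out r) in
  let h := ren (zip (ids b) (ids o)) in
  [&& map g (r_in r) == map (ren m) (r_in r), vld t.2.1 (r_in r) t.2.2,
      wtypes t.2.2 == wtypes (r_out r),
      inj_on g (r_in r ++ wires t.2.1), map h b == o, map h c == c,
      inj_on h ((b ++ c) ++ wires post) & wf_summand s (rhs_prog pre post o' t)].

(** Everything that soundness needs is tested here at run time, so neither the renaming [m] nor the
    output of [sep] has to be trusted. *)
Definition apply_rule (p : seq instr) (o : seq wire) : option (seq summand) :=
  let f := ren m in
  let lhs := map (imap f) (r_lhs r) in
  let a := map f (r_in r) in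
  let b := map f (r_out r) in
  let: (pre, post) := sep (flatten (map outs lhs)) (filter (fun i => i \notin lhs) p) in
  let q := pre ++ lhs ++ post in
  let c := rest a (run pre s) in
  if [&& perm_eq p q, vld q s o, inj_on f (r_in r ++ wires (r_lhs r)), uniq (r_in r),
         vld (r_lhs r) (r_in r) (r_out r), vld pre s (a ++ c), uniq (a ++ c)
       & all (rhs_ok pre post c o) (r_rhs r)]
  then Some (map (rhs_prog pre post o) (r_rhs r)) else None.

End ApplyRule.

Section Soundness.
Variables (R : comPzRingType) (C : symMonCat R) (ob : nat -> C).
Local Notation big := (big ob).
Local Notation relab := (relab ob).
Variable G : nat -> forall a b, Mor (big a) (big b).
Hypothesis G_relab : forall g a b a' b', wtypes a = wtypes a' -> wtypes b = wtypes b' ->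
  relab b b' ∘ G g a b = G g a' b' ∘ relab a a'.
Local Notation den := (den G).

(** The summands of one sum name their outputs differently; [relab] to a common list [l] makes them
    elements of one hom-module. *)
Definition ssem s l (t : summand) : Mor (big s) (big l) :=
  sg t.1 (relab t.2.2 l ∘ den t.2.1 s t.2.2).

Definition lsem s l (L : seq summand) : Mor (big s) (big l) :=
  \sum_(t <- L) ssem s l t.

Definition rule_valid (r : rule) :=
  den (r_lhs r) (r_in r) (r_out r) = lsem (r_in r) (r_out r) (r_rhs r).

Lemma wh_sum a b c (I : Type) (L : seq I) (F : I -> Mor (big a) (big b)) :
  wh (\sum_(t <- L) F t) c = \sum_(t <- L) wh (F t) c.
Proof.
by rewrite wh.unlock tens_suml comp_suml comp_sumr.
Qed.

Lemma wh_sg a b c d (f : Mor (big a) (big b)) : wh (sg d f) c = sg d (wh f c).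
Proof. by rewrite !wh.unlock sg_tensl sg_compl sg_compr. Qed.

Lemma wh_relab_id a b c : size a = size b ->
  wh (relab a b) c = relab (a ++ c) (b ++ c).
Proof.
move=> e; rewrite wh.unlock -(relab_id ob c) catA -relab_cat // -catA splitK.
by rewrite compm1.
Qed.

Lemma type_ren m : type_ok (ren m). Proof. by []. Qed.

(** [den_permP] reorders the program into [pre ++ lhs ++ post], [den_frame] isolates [lhs], and the
    renaming [h] of [post] connects it to the outputs of each summand. *)
Lemma apply_ruleP r m used s l p o L : rule_valid r -> uniq s -> wf_summand s (false, (p, o)) ->
  apply_rule r m used s p o = Some L ->
  ssem s l (false, (p, o)) = lsem s l L /\ all (wf_summand s) L.
Proof.
move=> rv us /andP[/= vp ap]; rewrite /apply_rule.
case: sep => pre post; set lhs := map _ _; set a := map _ _; pose b := map (ren m) (r_out r).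
set c := rest _ _; case: ifP => // /and5P[e vq inj ur /and4P[vl vpre uac ok]] [<-].
split; last first.
  by rewrite all_map; apply: sub_all ok => t /and5P[_ _ _ _ /and4P[]].
rewrite /ssem /= (den_permP G us vp vq e ap) (den_cat G us vpre vq).
have injf := inj_onP inj.
have vl' : vld lhs a b by apply: vld_map.
have vq' : vld (lhs ++ post) (a ++ c) o.
  by rewrite -(vld_cat _ _ vpre).
rewrite (den_frame G uac vl' vq').
have ta := wtypes_map (r_in r) (type_ren m).
(* The rule is valid on its own wires; [den_relab] carries it to their images in the program. *)
have := den_relab (type_ren m) G_relab ur injf vl.
move/(congr1 (fun k => k ∘ relab a (r_in r))); rewrite -[in RHS]catA relab_comp //.
rewrite relab_id compm1 => <-; rewrite rv -!catA comp_suml comp_sumr wh_sum.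
rewrite !(comp_suml, comp_sumr) /lsem big_map big_seq [RHS]big_seq.
apply: eq_bigr => t tr.
have /and5P[/eqP ein vt /eqP to injg /and4P[/eqP eb /eqP ec injh gt]] := allP ok _ tr.
rewrite /ssem /= !(sg_compl, sg_compr, wh_sg); congr sg.
move: injg; set g := rhs_ren _ _ _ _ => injg.
move: eb ec injh gt; rewrite /rhs_prog -/g; set q' := map (imap g) _.
set o' := map g _; set h := ren _ => eb ec injh gt.
have tg : type_ok g by [].
have th : type_ok h by [].
have /andP[ubc vpost] := vld_frame uac vl' vq'.
have := den_relab tg G_relab ur (inj_onP injg) vt.
rewrite -/q' -/o' ein -/a => dq.
have to' : wtypes o' = wtypes b by rewrite !wtypes_map.
have to2 : wtypes t.2.2 = wtypes o' by rewrite wtypes_map.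
have -> : relab (r_out r) (map (ren m) (r_out r)) ∘
   (relab t.2.2 (r_out r) ∘ den t.2.1 (r_in r) t.2.2) ∘ relab a (r_in r) =
   relab o' b ∘ den q' a o'.
  rewrite -!catA (eqA1 _ (relab_comp _ _ to)) -(relab_comp _ _ to2) -catA.
  by rewrite (eqA _ dq) relab_comp // relab_id compm1.
have vq2 : vld q' a o'.
  by rewrite /a -ein; apply: vld_map => //; apply: inj_onP.
have uoc : uniq (o' ++ c).
  rewrite -eb -ec -map_cat map_inj_in_uniq // => x y hx hy.
  by apply: (inj_onP injh); rewrite mem_cat ?hx ?hy.
have vp2 : vld (map (imap h) post) (o' ++ c) (map h o).
  by rewrite -eb -ec -map_cat; apply: vld_map => //; apply: inj_onP.
have /andP[vall _] := gt; rewrite /= in vall.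
rewrite (den_cat G us vpre vall).
have v3 : vld (q' ++ map (imap h) post) (a ++ c) (map h o).
  by rewrite -(vld_cat _ _ vpre).
rewrite (den_frame G uac vq2 v3) wh_comp.
have := den_relab th G_relab ubc (inj_onP injh) vpost.
rewrite map_cat eb ec => dp.
have so : size o' = size b by have := congr1 size to'; rewrite !size_map.
rewrite (wh_relab_id _ so) !catA; do 2 congr (_ ∘ _).
have to3 : wtypes (o' ++ c) = wtypes (b ++ c) by rewrite /wtypes !map_cat -/(wtypes _) to'.
transitivity (relab (map h o) l ∘ relab o (map h o) ∘ den post (b ++ c) o ∘ relab (o' ++ c) (b ++ c)).
  rewrite (eqA1 _ (relab_comp _ _ _)) ?wtypes_map // ?catA //.
by rewrite (eqA _ dp) relabK // compm1.
Qed.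

End Soundness.

(** * Compilation of morphisms to diagrams *)

Inductive otree := OV of nat | OI | OT of otree & otree.

Fixpoint lv (o : otree) : seq wire :=
  match o with OV n => [:: (n, 0%N)] | OI => [::] | OT a b => lv a ++ lv b end.

Section Terms.
Variables (R : comPzRingType) (C : symMonCat R) (ob : nat -> C).
Local Notation big := (big ob).
Local Notation pm := (pm ob).
Local Notation join := (join ob).
Local Notation split := (split ob).
Local Notation relab := (relab ob).

Fixpoint oev (o : otree) : C :=
  match o with OV n => ob n | OI => tunit | OT a b => oev a ⊗ oev b end.

Fixpoint flat o : Mor (oev o) (big (lv o)) :=
  match o with
  | OV n => runiti (ob n)
  | OI => idm _
  | OT a b => join (lv a) (lv b) ∘ (flat a ⊠ flat b)
  end.

Fixpoint unflat o : Mor (big (lv o)) (oev o) :=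
  match o with
  | OV n => runit (ob n)
  | OI => idm _
  | OT a b => (unflat a ⊠ unflat b) ∘ split (lv a) (lv b)
  end.

Lemma flatK o : unflat o ∘ flat o = idm _.
Proof.
elim: o => [n||a IHa b IHb] /=; first exact: runitiK.
  by rewrite comp1m.
by rewrite -!catA (cancA _ (joinK _ _ _)) -tensm_comp IHa IHb tensm1.
Qed.

Lemma unflatK o : flat o ∘ unflat o = idm _.
Proof.
elim: o => [n||a IHa b IHb] /=; first exact: runitK.
  by rewrite comp1m.
by rewrite -!catA (catA (_ ⊠ _)) -tensm_comp IHa IHb tensm1 comp1m splitK.
Qed.

Fixpoint genv (l : seq (otree * otree)) : Type :=
  if l is t :: l' then (Mor (oev t.1) (oev t.2) * genv l')%type else unit.

Fixpoint gget (l : seq (otree * otree)) : genv l ->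
    forall g, Mor (oev (nth (OI, OI) l g).1) (oev (nth (OI, OI) l g).2) :=
  match l with
  | [::] => fun _ g => match g with 0 => idm _ | _.+1 => idm _ end
  | t :: l' => fun e g => match g with 0 => e.1 | g'.+1 => gget e.2 g' end
  end%N.

Variables (sig : seq (otree * otree)) (env : genv sig).
Local Notation gdom g := (nth (OI, OI) sig g).1.
Local Notation gcod g := (nth (OI, OI) sig g).2.
Local Notation gmor g := (gget env g).

(** The outer [relab] make the value depend only on the types of [a] and [b], as the hypothesis
    [G_relab] of the soundness proof demands. *)
Definition gsem (g : nat) (a b : seq wire) : Mor (big a) (big b) :=
  relab (lv (gcod g)) b ∘ flat _ ∘ gmor g ∘ unflat _
    ∘ relab a (lv (gdom g)).

Lemma relab_comp' s1 s2 s3 : wtypes s2 = wtypes s3 ->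
  relab s2 s3 ∘ relab s1 s2 = relab s1 s3.
Proof.
elim: s1 s2 s3 => [|[t1 i1] s1 IH] [|[t2 i2] s2] // [|[t3 i3] s3] //= e.
- by rewrite comp1m.
- by rewrite compm0.
- by rewrite compm0.
by case: e => <- e; rewrite -tensm_comp cast_tyxx comp1m IH.
Qed.

Lemma gsem_relab g a b a' b' : wtypes a = wtypes a' -> wtypes b = wtypes b' ->
  relab b b' ∘ gsem g a b = gsem g a' b' ∘ relab a a'.
Proof.
move=> ea eb; rewrite /gsem (eqA1 _ (relab_comp' _ eb)) -!catA.
by rewrite relab_comp.
Qed.

Inductive term : otree -> otree -> Type :=
| Tid a : term a a
| Tcomp a b c : term b c -> term a b -> term a c
| Ttens a b a' b' : term a b -> term a' b' -> term (OT a a') (OT b b')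
| Tassoc a b c : term (OT (OT a b) c) (OT a (OT b c))
| Tassoci a b c : term (OT a (OT b c)) (OT (OT a b) c)
| Tlunit a : term (OT OI a) a
| Tluniti a : term a (OT OI a)
| Trunit a : term (OT a OI) a
| Truniti a : term a (OT a OI)
| Tsym a b : term (OT a b) (OT b a)
| Tgen g : term (gdom g) (gcod g)
| Tadd a b : term a b -> term a b -> term a b
| Topp a b : term a b -> term a b
| Tzero a b : term a b.

Fixpoint tev a b (t : term a b) : Mor (oev a) (oev b) :=
  match t with
  | Tid _ => idm _
  | Tcomp _ _ _ g f => tev g ∘ tev f
  | Ttens _ _ _ _ f g => tev f ⊠ tev g
  | Tassoc _ _ _ => assoc _ _ _
  | Tassoci _ _ _ => associ _ _ _
  | Tlunit _ => lunit _
  | Tluniti _ => luniti _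
  | Trunit _ => runit _
  | Truniti _ => runiti _
  | Tsym _ _ => sym _ _
  | Tgen g => gmor g
  | Tadd _ _ f g => tev f + tev g
  | Topp _ _ f => - tev f
  | Tzero _ _ => 0
  end.

(* A summand together with the first unused wire number. *)
Notation result := (summand * nat)%type.

Fixpoint fresh (s : seq wire) (n : nat) : seq wire :=
  if s is w :: s' then (w.1, n) :: fresh s' n.+1 else [::].

Definition seq_comp (x y : result) : result :=
  ((x.1.1 (+) y.1.1, (x.1.2.1 ++ y.1.2.1, y.1.2.2)), y.2).

Definition seq_tens (x y : result) : result :=
  ((x.1.1 (+) y.1.1, (x.1.2.1 ++ y.1.2.1, x.1.2.2 ++ y.1.2.2)), y.2).

Fixpoint compile a b (t : term a b) (ws : seq wire) (n : nat) : seq result :=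
  match t with
  | Tcomp _ _ _ g f =>
    flatten [seq [seq seq_comp x y | y <- compile g x.1.2.2 x.2] | x <- compile f ws n]
  | Ttens a _ _ _ f g =>
    let k := size (lv a) in
    flatten [seq [seq seq_tens x y | y <- compile g (drop k ws) x.2]
                                   | x <- compile f (take k ws) n]
  | Tsym a b => let k := size (lv a) in [:: ((false, ([::], drop k ws ++ take k ws)), n)]
  | Tgen g =>
    let o := fresh (lv (gcod g)) n in
    [:: ((false, ([:: (g, (ws, o))], o)), n + size o)]
  | Tadd _ _ f g => compile f ws n ++ compile g ws n
  | Topp _ _ f => [seq ((~~ x.1.1, x.1.2), x.2) | x <- compile f ws n]
  | Tzero _ _ => [::]
  | _ => [:: ((false, ([::], ws)), n)]
  end%N.

(** The validity of compiled programs is tested on each instance by computation instead of being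
    proved for [compile] once and for all. *)
Fixpoint compile_ok a b (t : term a b) (ws : seq wire) (n : nat) : bool :=
  match t with
  | Tcomp _ _ _ g f => compile_ok f ws n &&
    all (fun x => [&& vld x.1.2.1 ws x.1.2.2, compile_ok g x.1.2.2 x.2
      & all (fun y => vld (x.1.2.1 ++ y.1.2.1) ws y.1.2.2) (compile g x.1.2.2 x.2)])
     (compile f ws n)
  | Ttens a _ _ _ f g =>
    let k := size (lv a) in
    let w1 := take k ws in let w2 := drop k ws in
    compile_ok f w1 n &&
    all (fun x => [&& vld x.1.2.1 w1 x.1.2.2, compile_ok g w2 x.2
      & all (fun y => vld y.1.2.1 w2 y.1.2.2 &&
               vld (x.1.2.1 ++ y.1.2.1) (w1 ++ w2) (x.1.2.2 ++ y.1.2.2)) (compile g w2 x.2)])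
     (compile f w1 n)
  | Tgen g => let o := fresh (lv (gcod g)) n in uniq ws && uniq o
  | Tadd _ _ f g => compile_ok f ws n && compile_ok g ws n
  | Topp _ _ f => compile_ok f ws n
  | _ => true
  end%N.

Local Notation den := (den gsem).
Local Notation gsum := (lsem gsem).

Definition csem ws l (L : seq result) := gsum ws l (map fst L).

Lemma wtypes_cat s1 s2 : wtypes (s1 ++ s2) = wtypes s1 ++ wtypes s2.
Proof. exact: map_cat. Qed.

Lemma wtypes_take k s : wtypes (take k s) = take k (wtypes s).
Proof. exact: map_take. Qed.

Lemma wtypes_drop k s : wtypes (drop k s) = drop k (wtypes s).
Proof. exact: map_drop. Qed.

Lemma wtypes_fresh s n : wtypes (fresh s n) = wtypes s.
Proof. by elim: s n => //= w s IH n; rewrite IH. Qed.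

Lemma take_lv ws a b : wtypes ws = wtypes (lv a ++ lv b) ->
  wtypes (take (size (lv a)) ws) = wtypes (lv a) /\
  wtypes (drop (size (lv a)) ws) = wtypes (lv b).
Proof.
move=> e; rewrite wtypes_take wtypes_drop e wtypes_cat.
by rewrite take_size_cat ?drop_size_cat // size_map.
Qed.

Lemma compile_types a b (t : term a b) ws n : wtypes ws = wtypes (lv a) ->
  {in compile t ws n, forall x, wtypes x.1.2.2 = wtypes (lv b)}.
Proof.
elim: t ws n => {a b} /=.
- by move=> a ws n e x; rewrite inE => /eqP ->.
- move=> a b c g IHg f IHf ws n e x /flatten_mapP[y yf /mapP[z zg ->]] /=.
  by apply: IHg zg; apply: IHf yf.
- move=> a b a' b' f IHf g IHg ws n e x /flatten_mapP[y yf /mapP[z zg ->]] /=.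
  have [e1 e2] := take_lv e.
  by rewrite !wtypes_cat (IHf _ _ e1 _ yf) (IHg _ _ e2 _ zg).
- by move=> a b c ws n e x; rewrite inE => /eqP -> /=; rewrite e !seq.catA.
- by move=> a b c ws n e x; rewrite inE => /eqP -> /=; rewrite e !seq.catA.
- by move=> a ws n e x; rewrite inE => /eqP ->.
- by move=> a ws n e x; rewrite inE => /eqP ->.
- by move=> a ws n e x; rewrite inE => /eqP -> /=; rewrite e cats0.
- by move=> a ws n e x; rewrite inE => /eqP -> /=; rewrite e cats0.
- move=> a b ws n e x; rewrite inE => /eqP -> /=; have [e1 e2] := take_lv e.
  by rewrite !wtypes_cat e1 e2.
- by move=> g ws n e x; rewrite inE => /eqP -> /=; rewrite wtypes_fresh.
- move=> a b f IHf g IHg ws n e x; rewrite mem_cat => /orP[]; [exact: IHf|exact: IHg].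
- by move=> a b f IHf ws n e x /mapP[y yf ->] /=; apply: IHf yf.
by [].
Qed.

Lemma relab_pm s s' : s = s' -> relab s s' = pm s s'.
Proof. by move=> ->; rewrite relab_id pm_id. Qed.

Lemma flat_assoc a b c :
  flat (OT a (OT b c)) ∘ assoc _ _ _ =
  relab (lv (OT (OT a b) c)) (lv (OT a (OT b c))) ∘ flat (OT (OT a b) c).
Proof.
rewrite relab_pm; last by rewrite /= seq.catA.
transitivity (join (lv a) (lv b ++ lv c) ∘ (idm _ ⊠ join (lv b) (lv c)) ∘ assoc _ _ _
    ∘ ((flat a ⊠ flat b) ⊠ flat c)).
  by rewrite assoc_nat [in RHS](catA (_ ⊠ _)) -tensm_comp comp1m /= -!catA.
rewrite -(eqA3 _ (join_assoc _ _ _ _)) /=; do 2 congr (_ ∘ _).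
by rewrite -tensm_comp comp1m.
Qed.

Lemma flat_runit a :
  flat a ∘ runit _ = relab (lv (OT a OI)) (lv a) ∘ flat (OT a OI).
Proof.
have e := esym (cats0 (lv a)).
apply: (iso_mono (relabK _ (congr1 wtypes e))).
rewrite [RHS]catA relabK; last by rewrite /= cats0.
rewrite comp1m relab_pm // join_nil -catA (eqA _ (runiti_nat _)) runitK.
by rewrite compm1.
Qed.

(* Structural isomorphisms do not move the wires. *)
Lemma compile_struct a b (f : Mor (oev a) (oev b)) ws n :
  wtypes ws = wtypes (lv a) -> wtypes (lv a) = wtypes (lv b) ->
  flat b ∘ f = relab (lv a) (lv b) ∘ flat a ->
  csem ws (lv b) [:: ((false, ([::], ws)), n)] =
  flat b ∘ f ∘ unflat a ∘ relab ws (lv a).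
Proof.
move=> ea eb e; rewrite /csem /gsum big_seq1 /ssem /= pm_id compm1.
by rewrite catA e -!catA (cancA _ (unflatK _)) relab_comp.
Qed.

Lemma struct_inv a b (f : Mor (oev a) (oev b)) (f' : Mor (oev b) (oev a)) :
  f' ∘ f = idm _ -> f ∘ f' = idm _ -> wtypes (lv a) = wtypes (lv b) ->
  flat b ∘ f = relab (lv a) (lv b) ∘ flat a ->
  flat a ∘ f' = relab (lv b) (lv a) ∘ flat b.
Proof.
move=> ff' f'f e ef; apply: (iso_epi f'f); rewrite -!catA ef ff' compm1.
by rewrite catA relabK // comp1m.
Qed.

Lemma csem_cat ws l L1 L2 : csem ws l (L1 ++ L2) = csem ws l L1 + csem ws l L2.
Proof. by rewrite /csem /lsem map_cat big_cat. Qed.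

(** Composites are concatenations by [den_cat] and tensor products are juxtapositions by [den_tens];
    bilinearity distributes both over the summands. *)
Lemma compileP a b (t : term a b) ws n : wtypes ws = wtypes (lv a) -> uniq ws ->
  compile_ok t ws n ->
  csem ws (lv b) (compile t ws n) = flat b ∘ tev t ∘ unflat a ∘ relab ws (lv a).
Proof.
elim: t ws n => {a b} /=.
- move=> a ws n e u _; apply: compile_struct => //.
  by rewrite relab_id compm1 comp1m.
- move=> a b c g IHg f IHf ws n e u /andP[okf /allP ok].
  transitivity (flat c ∘ tev g ∘ unflat b ∘ csem ws (lv b) (compile f ws n)); last first.
    by rewrite IHf // -!catA (cancA _ (flatK _)).
  rewrite /csem /lsem !big_map !comp_sumr big_flatten big_map big_seq [RHS]big_seq.
  apply: eq_bigr => x xf; have /and3P[v okg /allP vg] := ok _ xf.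
  have ex := compile_types e xf; have ux := vld_uniq u v.
  rewrite /ssem !sg_compr (_ : flat c ∘ _ = csem x.1.2.2 (lv c) (compile g x.1.2.2 x.2)
    ∘ den x.1.2.1 ws x.1.2.2); last by rewrite IHg // -!catA.
  rewrite /csem /lsem comp_suml sg_sum /= !big_map big_seq [RHS]big_seq.
  apply: eq_bigr => y yg; rewrite /ssem /= sg_compl sg_sg -catA -den_cat //.
  exact: vg.
- move=> a b a' b' f IHf g IHg ws n e u /andP[okf /allP ok].
  have [e1 e2] := take_lv e; set w1 := take _ _ in e1 okf ok *.
  set w2 := drop _ _ in e2 ok *; have ew : w1 ++ w2 = ws by apply: cat_take_drop.
  have u1 : uniq w1 by rewrite take_uniq.
  have u2 : uniq w2 by rewrite drop_uniq.
  clearbody w1 w2; subst ws.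
  transitivity (join _ _ ∘ (csem w1 (lv b) (compile f w1 n) ⊠
    (flat b' ∘ tev g ∘ unflat a' ∘ relab w2 (lv a')))
    ∘ split w1 w2).
    rewrite /csem /lsem !big_map tens_suml comp_suml comp_sumr big_flatten big_map.
    rewrite big_seq [RHS]big_seq.
    apply: eq_bigr => x xf; have /and3P[v okg /allP vg] := ok _ xf.
    have ex := compile_types e1 xf.
    rewrite -(IHg w2 x.2) // /csem /lsem tens_sumr comp_suml comp_sumr /= !big_map big_seq [RHS]big_seq.
    apply: eq_bigr => y yg; rewrite /ssem /= sg_tensl sg_tensr sg_compl sg_compr !sg_compl !sg_compr sg_sg.
    have /andP[vy vxy] := vg _ yg.
    rewrite den_tens // catA relab_cat; last first.
      by have := congr1 size ex; rewrite !size_map.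
    by rewrite !tensm_comp -!catA.
  rewrite IHf // -!catA; congr (_ ∘ _).
  rewrite relab_cat_split; last by have := congr1 size e1; rewrite !size_map.
  by rewrite !catA; congr (_ ∘ _); rewrite -!tensm_comp.
- move=> a b c ws n e u _.
  apply: (@compile_struct (OT (OT a b) c) (OT a (OT b c)) (assoc _ _ _)) => //.
    by rewrite /= seq.catA.
  exact: flat_assoc.
- move=> a b c ws n e u _.
  apply: (@compile_struct (OT a (OT b c)) (OT (OT a b) c) (associ _ _ _)) => //.
    by rewrite /= seq.catA.
  apply: (@struct_inv (OT (OT a b) c) (OT a (OT b c)) (assoc _ _ _) (associ _ _ _)
    (assocK _ _ _) (associK _ _ _) _ (flat_assoc a b c)).
  by rewrite /= seq.catA.
- move=> a ws n e u _; apply: (@compile_struct (OT OI a) a (lunit _)) => //.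
  by rewrite relab_id comp1m /= lunit_nat.
- move=> a ws n e u _; apply: (@compile_struct a (OT OI a) (luniti _)) => //.
  by rewrite relab_id comp1m /= -catA -luniti_nat catA lunitiK comp1m.
- move=> a ws n e u _; apply: (@compile_struct (OT a OI) a (runit _)) => //.
    by rewrite /= cats0.
  exact: flat_runit.
- move=> a ws n e u _; apply: (@compile_struct a (OT a OI) (runiti _)) => //.
    by rewrite /= cats0.
  apply: (@struct_inv (OT a OI) a (runit _) (runiti _) (runitK _) (runitiK _) _ (flat_runit a)).
  by rewrite /= cats0.
- move=> a b ws n e u _; rewrite /csem /lsem big_seq1 /ssem /=.
  have [e1 e2] := take_lv e; set w1 := take _ _ in e1 *.
  set w2 := drop _ _ in e2 *; have ew : w1 ++ w2 = ws by apply: cat_take_drop.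
  clearbody w1 w2; subst ws; rewrite pm_sym // catA relab_cat.
    rewrite -!catA relab_cat_split; last by have := congr1 size e1; rewrite !size_map.
    rewrite ![in LHS](eqA _ (esym (sym_nat _ _))) ![in RHS](eqA _ (esym (sym_nat _ _))).
    by rewrite (cancA (f := flat _ ⊠ flat _)) // -tensm_comp !unflatK tensm1.
  by have := congr1 size e2; rewrite !size_map.
- move=> g ws n e u /andP[_ uo]; rewrite /csem /lsem big_seq1 /ssem /=.
  set o := fresh _ n in uo *; set i : instr := (g, (ws, o)).
  have ew : perm_eq ws (ins i ++ [::]) by rewrite cats0.
  have v : vld [:: i] ws o.
    by apply: (@vld_consI i [::] ws [::] o u u ew); rewrite /= cats0.
  transitivity (relab o (lv (gcod g)) ∘ den [:: i] ws o) => //.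
  have -> : den [:: i] ws o = gsem g ws o.
    rewrite (den_cons _ u v ew) /= /ins /outs /= wh.unlock join_nil -!catA.
    rewrite (cancA _ (joinK _ _ _)) -runiti_nat (catA (join _ _)) -join_nil.
    by rewrite catA pm_comp ?cats0 // pm_id comp1m.
  by rewrite /gsem (eqA1 _ (relab_comp' _ _)) ?wtypes_fresh // relab_id comp1m.
- move=> a b f IHf g IHg ws n e u /andP[okf okg].
  by rewrite csem_cat IHf // IHg // compDl compDr.
- move=> a b f IHf ws n e u ok; rewrite compNl compNr -(IHf _ _ e u ok).
  rewrite /csem /lsem !big_map -sumrN; apply: eq_bigr => x _.
  by rewrite /ssem /=; case: x.1.1; rewrite /= ?opprK.
by move=> a b ws n e u _; rewrite /csem /lsem big_nil comp0m compm0.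
Qed.

End Terms.

(** * Normal forms *)

Section Search.
Local Open Scope nat_scope.

(* The positions met on the way from a wire to an output of the program, following
   first outputs, read backwards.  Distinct wires have distinct keys. *)
Fixpoint down_key (fuel : nat) (p : seq instr) (o : seq wire) (w : wire) : seq nat :=
  if fuel is n.+1 then
    if w \in o then [:: index w o] else
    if [seq i <- p | w \in ins i] is i :: _ then
      if outs i is v :: _ then down_key n p o v ++ [:: index w (ins i); i.1]
      (* A box without outputs, such as a counit, ends the path. The value 1000 is meant to exceed
         every index of an output wire, so that such leaves are sorted last. *)
      else [:: 1000]
    else [::]
  else [::].

Fixpoint up_key (fuel : nat) (p : seq instr) (s : seq wire) (w : wire) : seq nat :=
  if fuel is n.+1 then
    if w \in s then [:: index w s] else
    if [seq i <- p | w \in outs i] is i :: _ then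
      if ins i is v :: _ then up_key n p s v ++ [:: index w (outs i); i.1]
      else [:: 1000]
    else [::]
  else [::].

Fixpoint lex_lt (x y : seq nat) : bool :=
  match x, y with
  | _, [::] => false
  | [::], _ => true
  | a :: x', b :: y' => (a < b) || (a == b) && lex_lt x' y'
  end.

(* [Sort_out i j] (resp. [Sort_in i j]) lets a rule apply only if the keys of its
   i-th and j-th outputs (resp. inputs) are in the wrong order.  Rules marked [Cancel]
   come first, and [Enables] lets a rule apply only if one of them applies next. *)
Inductive guard := Always | Sort_out of nat & nat | Sort_in of nat & nat
  | Cancel | Enables.

Definition guard_ok (g : guard) (r : rule) m (s : seq wire) p o : bool :=
  (* A path crosses each box at most once, so it meets at most this many wires. *)
  let n := (size p).+1 in
  match g with
  | Sort_out i j =>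
    let key k := down_key n p o (ren m (nth (0, 0) (r_out r) k)) in
    lex_lt (key j) (key i)
  | Sort_in i j =>
    let key k := up_key n p s (ren m (nth (0, 0) (r_in r) k)) in
    lex_lt (key j) (key i)
  | _ => true
  end.

Fixpoint bind (m : seq (nat * nat)) (a b : seq wire) : option (seq (nat * nat)) :=
  match a, b with
  | [::], [::] => Some m
  | x :: a', y :: b' =>
    if x.1 == y.1 then
      if [seq e <- m | e.1 == x.2] is e :: _ then
        if e.2 == y.2 then bind m a' b' else None
      else if y.2 \in [seq e.2 | e <- m] then None
      else bind ((x.2, y.2) :: m) a' b'
    else None
  | _, _ => None
  end.

(* All renamings of the wires of [pat] that turn it into a part of [p]. *)
Fixpoint matches (pat p : seq instr) (m : seq (nat * nat)) : seq (seq (nat * nat)) :=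
  if pat is i :: pat' then
    flatten [seq (if i.1 == j.1 then
      if bind m (ins i ++ outs i) (ins j ++ outs j) is Some m' then matches pat' p m'
      else [::] else [::]) | j <- p]
  else [:: m].

Fixpoint first_some (A B : Type) (f : A -> option B) (l : seq A) : option B :=
  if l is x :: l' then if f x is Some y then Some y else first_some f l' else None.

Definition grule := (rule * guard)%type.

Definition try_rule (s : seq wire) p o (g : grule) (ok : seq summand -> bool) :
    option (seq summand) :=
  let used := ids (s ++ flatten (map outs p)) in
  first_some (fun m => if guard_ok g.2 g.1 m s p o then
      if apply_rule g.1 m used s p o is Some L then if ok L then Some L else None else None
    else None) (matches (r_lhs g.1) p [::]).

Definition is_cancel (g : grule) := if g.2 is Cancel then true else false.

Definition cancel_step (rs : seq grule) s p o :=
  first_some (fun g => if is_cancel g then try_rule s p o g xpredT else None) rs.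

Definition other_step (rs : seq grule) s p o :=
  first_some (fun g => try_rule s p o g (fun L =>
    if g.2 is Enables then has (fun t => isSome (cancel_step rs s t.2.1 t.2.2)) L
    else true)) rs.

Definition flip (b : bool) (t : summand) : summand := (b (+) t.1, t.2).

Definition find_step rs s p o :=
  if cancel_step rs s p o is Some L then Some L else other_step rs s p o.

(** When the fuel runs out the unfinished summands are kept, so the total is preserved whatever the
    fuel. *)
Fixpoint normalize (rs : seq grule) (s : seq wire) (fuel : nat) (todo done : seq summand) :
    seq summand :=
  match fuel, todo with
  | _, [::] => done
  | 0, _ => todo ++ done
  | n.+1, t :: todo' =>
    if find_step rs s t.2.1 t.2.2 is Some L
    then normalize rs s n (map (flip t.1) L ++ todo') done
    else normalize rs s n todo' (t :: done)
  end.

Definition same_by (s : seq wire) (t t' : summand) (m : seq (nat * nat)) : bool :=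
  let f := ren m in
  [&& map f s == s, map f t.2.2 == t'.2.2, inj_on f (s ++ wires t.2.1)
    & perm_eq (map (imap f) t.2.1) t'.2.1].

(** Inputs and outputs fix part of the renaming in advance, which prunes the search for the rest;
    [same_by] validates what is found. *)
Definition same (s : seq wire) (t t' : summand) : bool :=
  (size t.2.1 == size t'.2.1) &&
  if bind [::] (s ++ t.2.2) (s ++ t'.2.2) is Some m then
    has (same_by s t t') (matches t.2.1 t'.2.1 m) else false.

Fixpoint extract (f : summand -> bool) (L : seq summand) : option (seq summand) :=
  if L is t :: L' then
    if f t then Some L' else if extract f L' is Some L'' then Some (t :: L'') else None
  else None.

Fixpoint cancel_pairs (s : seq wire) (L : seq summand) : seq summand :=
  if L is t :: L' then
    let L1 := cancel_pairs s L' in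
    if extract (fun t' => (t.1 != t'.1) && same s t t') L1 is Some L2 then L2
    else t :: L1
  else [::].

End Search.

Section Proving.
Variable sig : seq (otree * otree).

Definition term_in a := fresh (lv a) 0.

(** Only a program can be matched, so the left-hand side must compile to a single positive summand;
    the right-hand side may be any signed sum. *)
Definition mk_rule a b (l r : term sig a b) : option rule :=
  let ws := term_in a in
  let n := size ws in
  if compile l ws n is [:: ((false, (p, o)), _)] then
    if [&& uniq ws, compile_ok l ws n & compile_ok r ws n]
    then Some (Rule ws o p (map fst (compile r ws n))) else None
  else None.

Definition residue (rs : seq grule) a b (l r : term sig a b) (fuel : nat) :=
  let ws := term_in a in
  let L := map fst (compile (Tadd l (Topp r)) ws (size ws)) in
  cancel_pairs ws (normalize rs ws fuel L [::]).

(** Normalizing the difference lets the summands of both sides cancel in pairs, so no canonical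
    names or order are needed. *)
Definition check (rs : seq grule) a b (l r : term sig a b) (fuel : nat) : bool :=
  let ws := term_in a in
  let n := size ws in
  [&& uniq ws, compile_ok l ws n, compile_ok r ws n,
      all (wf_summand ws) (map fst (compile (Tadd l (Topp r)) ws n))
    & nilp (residue rs l r fuel)].

Variables (R : comPzRingType) (C : symMonCat R) (ob : nat -> C).
Variable env : genv ob sig.
Local Notation den := (den (gsem env)).
Local Notation gsum := (lsem (gsem env)).
Local Notation gterm := (ssem (gsem env)).

Lemma mk_ruleP a b (l r : term sig a b) ru : tev env l = tev env r ->
  mk_rule l r = Some ru -> rule_valid (gsem env) ru.
Proof.
rewrite /mk_rule; set ws := term_in a; set n := size ws.
case el: (compile l ws n) => [|[[[] [p o]] k] [|? ?]] // e.
case: ifP => // /and3P[u okl okr] [<-].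
have ew : wtypes ws = wtypes (lv a) by apply: wtypes_fresh.
have eo : wtypes o = wtypes (lv b).
  by have := compile_types (t := l) (n := n) ew; rewrite el => /(_ _ (mem_head _ _)).
have := compileP env ew u okl; rewrite e -(compileP env ew u okr) el.
rewrite /csem {1}/lsem big_seq1 /ssem /= => /(congr1 (fun k => relab ob (lv b) o ∘ k)).
rewrite catA relabK // comp1m /rule_valid /= => ->.
rewrite /lsem !big_map comp_sumr big_seq [RHS]big_seq.
apply: eq_bigr => x xr; rewrite /ssem sg_compr catA relab_comp //.
exact: compile_types xr.
Qed.

Fixpoint valid_rules (rs : seq grule) : Prop :=
  if rs is g :: rs' then rule_valid (gsem env) g.1 /\ valid_rules rs' else True.

Lemma first_someP (A B : Type) (f : A -> option B) l y :
  first_some f l = Some y -> exists x, f x = Some y.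
Proof.
elim: l => //= x l IH; case e: (f x) => [z|] //.
by case=> <-; exists x.
Qed.

Lemma first_ruleP (B : Type) (f : grule -> option B) rs y :
  valid_rules rs -> first_some f rs = Some y ->
  exists g, rule_valid (gsem env) g.1 /\ f g = Some y.
Proof.
elim: rs => //= g rs IH [vg vrs]; case e: (f g) => [z|]; last exact: IH.
by case=> <-; exists g.
Qed.

Lemma lsem_cons s l t L : gsum s l (t :: L) = gterm s l t + gsum s l L.
Proof. exact: big_cons. Qed.

Lemma lsem_cat s l L1 L2 : gsum s l (L1 ++ L2) = gsum s l L1 + gsum s l L2.
Proof. exact: big_cat. Qed.

Lemma lsem_flip s l b L : gsum s l (map (flip b) L) = sg b (gsum s l L).
Proof.
by rewrite /lsem big_map sg_sum; apply: eq_bigr => t _; rewrite /ssem sg_sg.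
Qed.

Lemma normalizeP rs s l fuel todo done : valid_rules rs -> uniq s ->
  all (wf_summand s) todo -> all (wf_summand s) done ->
  gsum s l (normalize rs s fuel todo done) = gsum s l todo + gsum s l done /\
  all (wf_summand s) (normalize rs s fuel todo done).
Proof.
move=> v us; elim: fuel todo done => [|n IH] [|t todo] done /=.
- by move=> _ gd; rewrite {2}/lsem big_nil add0r.
- by move=> gt gd; rewrite !lsem_cons lsem_cat addrA; split => //; rewrite all_cat andbA gt gd.
- by move=> _ gd; rewrite {2}/lsem big_nil add0r.
case/andP=> gt gtodo gd; case e: find_step => [L|]; last first.
  have [-> ->] := IH todo (t :: done) gtodo (introT andP (conj gt gd)).
  by rewrite !lsem_cons addrCA addrA.
have [g [ok [vg]]] : exists g ok, rule_valid (gsem env) g.1 /\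
    try_rule s t.2.1 t.2.2 g ok = Some L.
  move: e; rewrite /find_step; case e1: cancel_step => [L1|].
    case=> <-; have [g [vg]] := first_ruleP v e1.
    by case: ifP => // _ e; exists g, xpredT.
  by case/(first_ruleP v) => g [vg e]; exists g; eexists; split; [|exact: e].
rewrite /try_rule => h; have {h}[m] := first_someP h.
case: ifP => // _; case ap: apply_rule => [L1|] //; case: ifP => // _ [eL].
rewrite {L1}eL in ap; case: t gt e ap => [b [p o]] gt e ap.
have [e1 gL] := apply_ruleP (gsem_relab env) l vg us gt ap.
have gL' : all (wf_summand s) (map (flip b) L ++ todo).
  by rewrite all_cat gtodo andbT all_map.
have [-> ->] := IH _ _ gL' gd; split => //.
by rewrite lsem_cat lsem_flip -e1 lsem_cons.
Qed.

Lemma sameP s l t t' : uniq s -> wf_summand s t -> wf_summand s t' -> same s t t' ->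
  t.1 != t'.1 -> gterm s l t + gterm s l t' = 0.
Proof.
move=> us /andP[v a] /andP[v' a']; rewrite /same => /andP[_].
case: bind => // m0 /hasP[m _ /and4P[/eqP es /eqP eo inj ep]] d.
have injP := inj_onP inj.
have vm : vld (map (imap (ren m)) t.2.1) s t'.2.2.
  by rewrite -{1}es -eo; apply: vld_map.
have e : relab ob t.2.2 t'.2.2 ∘ den t.2.1 s t.2.2 = den t'.2.1 s t'.2.2.
  have := den_relab (type_ren m) (gsem_relab env) us injP v.
  rewrite es eo relab_id compm1 => ->; apply: esym; apply: den_permP => //.
  by rewrite perm_sym.
rewrite /ssem -e catA relab_comp.
  by case: (t.1) d; case: (t'.1) => //= _; rewrite ?addNr ?subrr.
by rewrite -eo wtypes_map.
Qed.

Lemma extractP f L L' : extract f L = Some L' ->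
  exists t, [/\ f t, t \in L & forall s l, gsum s l L = gterm s l t + gsum s l L'].
Proof.
elim: L L' => //= t L IH L'; case: ifP => ft.
  by case=> <-; exists t; split => //; [exact: mem_head|move=> s l; apply: lsem_cons].
case e: extract => [L1|] // [<-]; have [t' [ft' tL e']] := IH _ e.
exists t'; split => //; first by rewrite inE tL orbT.
by move=> s l; rewrite !lsem_cons e' addrCA.
Qed.

Lemma extract_sub f L L' : extract f L = Some L' -> {subset L' <= L}.
Proof.
elim: L L' => //= t L IH L'; case: ifP => ft.
  by case=> <- x xL; rewrite inE xL orbT.
case e: extract => [L1|] // [<-] x; rewrite !inE => /orP[->//|xL].
by rewrite (IH _ e) ?orbT.
Qed.

Lemma cancel_pairsP s l L : uniq s -> all (wf_summand s) L ->
  gsum s l (cancel_pairs s L) = gsum s l L /\ {subset cancel_pairs s L <= L}.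
Proof.
move=> us; elim: L => //= t L IH /andP[gt gL]; have [e sub] := IH gL.
case ex: extract => [L2|]; last first.
  rewrite !lsem_cons e; split => // x; rewrite !inE => /orP[->//|/sub ->].
  by rewrite orbT.
have [t' [/andP[d sm] tL e']] := extractP ex; split; last first.
  by move=> x /(extract_sub ex)/sub xL; rewrite inE xL orbT.
rewrite lsem_cons -e e' addrA sameP ?add0r //.
exact: (allP gL) (sub _ tL).
Qed.

Theorem checkP rs a b (l r : term sig a b) fuel :
  valid_rules rs -> check rs l r fuel -> tev env l = tev env r.
Proof.
move=> v; rewrite /check /residue; set ws := term_in a; set n := size ws.
case/and5P => u okl okr gd /nilP nl.
have ew : wtypes ws = wtypes (lv a) by apply: wtypes_fresh.
have [e1 g1] := normalizeP (lv b) fuel v u gd (isT : all (wf_summand ws) [::]).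
have [e2 _] := cancel_pairsP (lv b) u g1; move: e2; rewrite nl e1.
rewrite {1 3}/lsem !big_nil addr0 => /esym.
have ok : compile_ok (Tadd l (Topp r)) ws n by rewrite /= okl.
have := compileP env ew u ok; rewrite /csem /= => -> e0.
apply/eqP; rewrite -subr_eq0; apply/eqP.
apply: (iso_epi (flatK ob a)); rewrite comp0m.
apply: (iso_mono (flatK ob b)); rewrite compm0.
apply: (iso_epi (relabK ob (esym ew))); rewrite comp0m -!catA.
exact: e0.
Qed.

End Proving.

(** * Reification of goals and the tactic [dia] *)

Ltac dia_mem x l :=
  lazymatch l with
  | (x, _) => idtac
  | (_, ?r) => dia_mem x r
  end.

Ltac dia_carrier t :=
  let t' := eval hnf in t in
  lazymatch t' with @Triple _ _ _ ?X _ _ => X end.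

(* The parameters of projections are only convertible in different occurrences; this
   chooses one syntactic form, and fails if there is nothing to change. *)
Ltac dia_change x y :=
  lazymatch y with
  | x => fail
  | _ => y
  end.

Ltac dia_canon f :=
  lazymatch f with
  | @tr_ob ?R ?C _ ?t => lazymatch type of t with
    | @triple _ _ ?H => let f' := constr:(@tr_ob R C H t) in dia_change f f' end
  | @act ?R ?C _ ?t => lazymatch type of t with
    | @triple _ _ ?H => let f' := constr:(@act R C H t) in dia_change f f' end
  | @coact ?R ?C _ ?t => lazymatch type of t with
    | @triple _ _ ?H => let f' := constr:(@coact R C H t) in dia_change f f' end
  | @ho_ob ?R ?C ?H => let H' := eval hnf in H in let f' := constr:(@ho_ob R C H') in dia_change f f'
  | @mul ?R ?C ?H => let H' := eval hnf in H in let f' := constr:(@mul R C H') in dia_change f f'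
  | @one ?R ?C ?H => let H' := eval hnf in H in let f' := constr:(@one R C H') in dia_change f f'
  | @comul ?R ?C ?H => let H' := eval hnf in H in let f' := constr:(@comul R C H') in dia_change f f'
  | @counit ?R ?C ?H => let H' := eval hnf in H in let f' := constr:(@counit R C H') in dia_change f f'
  | @antip ?R ?C ?H => let H' := eval hnf in H in let f' := constr:(@antip R C H') in dia_change f f'
  | @antipi ?R ?C ?H => let H' := eval hnf in H in let f' := constr:(@antipi R C H') in dia_change f f'
  end.

Ltac dia_obj X l :=
  match X with
  | @tr_ob _ _ _ ?t => let Y := dia_carrier t in dia_obj Y l
  | _ => let Y := dia_canon X in dia_obj Y l
  | _ =>
  lazymatch X with
  | @tens _ _ ?A ?B => let l1 := dia_obj A l in dia_obj B l1
  | @tunit _ _ => l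
  | _ => match l with
         | _ => let _ := match goal with _ => dia_mem X l end in l
         | _ => constr:((X, l))
         end
  end end.

Ltac dia_memg x l :=
  lazymatch l with
  | ((_, _, x), _) => idtac
  | (_, ?r) => dia_memg x r
  end.

Ltac dia_idx x l :=
  lazymatch l with
  | (x, _) => constr:(O)
  | (_, ?r) => let n := dia_idx x r in constr:(S n)
  end.

Ltac dia_idxg x l :=
  lazymatch l with
  | ((_, _, x), _) => constr:(O)
  | (_, ?r) => let n := dia_idxg x r in constr:(S n)
  end.

Ltac dia_robj objs X :=
  match X with
  | @tr_ob _ _ _ ?t => let Y := dia_carrier t in dia_robj objs Y
  | _ => let Y := dia_canon X in dia_robj objs Y
  | _ =>
  lazymatch X with
  | @tens _ _ ?A ?B =>
    let a := dia_robj objs A in let b := dia_robj objs B in constr:(OT a b)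
  | @tunit _ _ => constr:(OI)
  | _ => let n := dia_idx X objs in constr:(OV n)
  end end.

Ltac dia_unfold f :=
  lazymatch f with
  | @cyc _ _ _ _ _ => eval cbv beta delta [cyc] in f
  | @swap12 _ _ _ _ _ => eval cbv beta delta [swap12] in f
  | @swap23 _ _ _ _ _ => eval cbv beta delta [swap23] in f
  | @mid _ _ _ _ _ _ _ _ _ => eval cbv beta delta [mid] in f
  | @swapmid _ _ _ _ _ _ => eval cbv beta delta [swapmid] in f
  | @splitm _ _ _ _ _ _ => eval cbv beta delta [splitm] in f
  | @mergem _ _ _ _ _ _ => eval cbv beta delta [mergem] in f
  | @dropm _ _ _ _ _ _ => eval cbv beta delta [dropm] in f
  | @insertm _ _ _ _ _ _ => eval cbv beta delta [insertm] in f
  | @mul2 _ _ _ => eval cbv beta delta [mul2] in f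
  | @comul2 _ _ _ => eval cbv beta delta [comul2] in f
  | @mul_antipi _ _ _ _ => eval cbv beta delta [mul_antipi] in f
  | @twisted_coact _ _ _ _ => eval cbv beta delta [twisted_coact] in f
  | @triple_t _ _ _ _ _ => eval cbv beta delta [triple_t] in f
  | @cobr_minus _ _ _ => eval cbv beta delta [cobr_minus] in f
  | @br_plus _ _ _ => eval cbv beta delta [br_plus] in f
  | @act _ _ _ ?t => let t' := eval hnf in t in
    lazymatch t' with @Triple _ _ _ _ ?a _ => eval simpl in a end
  | @coact _ _ _ ?t => let t' := eval hnf in t in
    lazymatch t' with @Triple _ _ _ _ _ ?a => eval simpl in a end
  end.

Ltac dia_collect f acc :=
  lazymatch f with
  | @Defs.comp _ _ _ _ _ ?g ?h => let a := dia_collect g acc in dia_collect h a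
  | @tensm _ _ _ _ _ _ ?g ?h => let a := dia_collect g acc in dia_collect h a
  | @idm _ _ ?X =>
    lazymatch acc with (?o, ?g) => let o1 := dia_obj X o in constr:((o1, g)) end
  | @assoc _ _ ?X ?Y ?Z =>
    lazymatch acc with (?o, ?g) => let o1 := dia_obj constr:(X ⊗ Y ⊗ Z) o in constr:((o1, g)) end
  | @associ _ _ ?X ?Y ?Z =>
    lazymatch acc with (?o, ?g) => let o1 := dia_obj constr:(X ⊗ Y ⊗ Z) o in constr:((o1, g)) end
  | @lunit _ _ ?X =>
    lazymatch acc with (?o, ?g) => let o1 := dia_obj X o in constr:((o1, g)) end
  | @luniti _ _ ?X =>
    lazymatch acc with (?o, ?g) => let o1 := dia_obj X o in constr:((o1, g)) end
  | @runit _ _ ?X =>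
    lazymatch acc with (?o, ?g) => let o1 := dia_obj X o in constr:((o1, g)) end
  | @runiti _ _ ?X =>
    lazymatch acc with (?o, ?g) => let o1 := dia_obj X o in constr:((o1, g)) end
  | @sym _ _ ?X ?Y =>
    lazymatch acc with (?o, ?g) => let o1 := dia_obj constr:(X ⊗ Y) o in constr:((o1, g)) end
  | (?g + ?h)%R => let a := dia_collect g acc in dia_collect h a
  | (- ?g)%R => dia_collect g acc
  | 0%R => acc
  | _ => match f with
    | _ => let f' := dia_unfold f in dia_collect f' acc
    | _ => let f' := dia_canon f in dia_collect f' acc
    | _ => lazymatch acc with (?o, ?g) =>
      match g with
      | _ => let _ := match goal with _ => dia_memg f g end in acc
      | _ => lazymatch type of f with
        | context [@Mor _ _ ?X ?Y] =>
          let o1 := dia_obj X o in let o2 := dia_obj Y o1 in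
          constr:((o2, ((X, Y, f), g)))
        end
      end end
    end
  end.

Ltac dia_reify objs gens sig f :=
  let ro X := dia_robj objs X in
  let rec go f :=
  lazymatch f with
  | @Defs.comp _ _ ?X ?Y ?Z ?g ?h =>
    let a := ro X in let b := ro Y in let c := ro Z in
    let tg := go g in let th := go h in constr:(@Tcomp sig a b c tg th)
  | @tensm _ _ ?X ?Y ?X' ?Y' ?g ?h =>
    let a := ro X in let b := ro Y in let a' := ro X' in let b' := ro Y' in
    let tg := go g in let th := go h in constr:(@Ttens sig a b a' b' tg th)
  | @idm _ _ ?X => let a := ro X in constr:(@Tid sig a)
  | @assoc _ _ ?X ?Y ?Z =>
    let a := ro X in let b := ro Y in let c := ro Z in constr:(@Tassoc sig a b c)
  | @associ _ _ ?X ?Y ?Z =>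
    let a := ro X in let b := ro Y in let c := ro Z in constr:(@Tassoci sig a b c)
  | @lunit _ _ ?X => let a := ro X in constr:(@Tlunit sig a)
  | @luniti _ _ ?X => let a := ro X in constr:(@Tluniti sig a)
  | @runit _ _ ?X => let a := ro X in constr:(@Trunit sig a)
  | @runiti _ _ ?X => let a := ro X in constr:(@Truniti sig a)
  | @sym _ _ ?X ?Y => let a := ro X in let b := ro Y in constr:(@Tsym sig a b)
  | (?g + ?h)%R =>
    lazymatch type of f with context [@Mor _ _ ?X ?Y] =>
    let a := ro X in let b := ro Y in
    let tg := go g in let th := go h in constr:(@Tadd sig a b tg th) end
  | (- ?g)%R =>
    lazymatch type of f with context [@Mor _ _ ?X ?Y] =>
    let a := ro X in let b := ro Y in let tg := go g in constr:(@Topp sig a b tg) end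
  | 0%R =>
    lazymatch type of f with context [@Mor _ _ ?X ?Y] =>
    let a := ro X in let b := ro Y in constr:(@Tzero sig a b) end
  | _ => match f with
    | _ => let f' := dia_unfold f in go f'
    | _ => let f' := dia_canon f in go f'
    | _ => let n := dia_idxg f gens in constr:(@Tgen sig n)
    end
  end in go f.

Ltac dia_mkob C objs :=
  lazymatch objs with
  | tt => constr:(@nil (Ob (smCat C)))
  | (?X, ?r) => let l := dia_mkob C r in constr:(@cons (Ob (smCat C)) X l)
  end.

Ltac dia_mksig objs gens :=
  lazymatch gens with
  | tt => constr:(@nil (otree * otree))
  | ((?X, ?Y, _), ?r) => let a := dia_robj objs X in let b := dia_robj objs Y in
    let l := dia_mksig objs r in constr:(@cons (otree * otree) (a, b) l)
  end.

Ltac dia_mkenv gens :=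
  lazymatch gens with
  | tt => constr:(tt)
  | ((_, _, ?f), ?r) => let l := dia_mkenv r in constr:((f, l))
  end.

(* The rules [rs] are nested pairs of equations, possibly with guards. *)
Ltac dia_collect_rules rs acc :=
  lazymatch rs with
  | (?a, Sort_out _ _) => dia_collect_rules a acc
  | (?a, Sort_in _ _) => dia_collect_rules a acc
  | (?a, Cancel) => dia_collect_rules a acc
  | (?a, Enables) => dia_collect_rules a acc
  | (?a, ?b) => let acc1 := dia_collect_rules a acc in dia_collect_rules b acc1
  | tt => acc
  | _ => lazymatch type of rs with
    | ?l = ?r => let a := dia_collect l acc in dia_collect r a
    | _ => let rs' := eval hnf in rs in
      lazymatch rs' with (_, _) => dia_collect_rules rs' acc end
    end
  end.

(** The equation [h] and the interpretation of its reified sides are convertible; this conversion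
    and the computation of the rule are left to the kernel. *)
Ltac dia_add_rule objs gens sig env h g acc k :=
  lazymatch type of h with
  | ?l = ?r =>
    let tl := dia_reify objs gens sig l in
    let tr := dia_reify objs gens sig r in
    let ru := eval vm_compute in (mk_rule tl tr) in
    lazymatch ru with
    | Some ?ru =>
      lazymatch acc with (?rs, ?vs) =>
        let rs' := fresh "rs" in
        pose (rs' := (ru, g) :: rs : seq grule);
        let vs' := fresh "vs" in
        assert (vs' : valid_rules env rs');
        [ refine (conj (@mk_ruleP sig _ _ _ env _ _ tl tr ru _ _) vs);
          [ exact_no_check h | vm_cast_no_check (erefl (Some ru)) ]
        | k constr:((rs', vs')) ]
      end
    | _ => fail 100 "the left-hand side of a rule must be a single diagram" l
    end
  end.

Ltac dia_rules objs gens sig env rs acc k :=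
  lazymatch rs with
  | (?h, Sort_out ?i ?j) => dia_add_rule objs gens sig env h constr:(Sort_out i j) acc k
  | (?h, Sort_in ?i ?j) => dia_add_rule objs gens sig env h constr:(Sort_in i j) acc k
  | (?h, Cancel) => dia_add_rule objs gens sig env h constr:(Cancel) acc k
  | (?h, Enables) => dia_add_rule objs gens sig env h constr:(Enables) acc k
  | (?a, ?b) =>
    dia_rules objs gens sig env b acc ltac:(fun acc1 => dia_rules objs gens sig env a acc1 k)
  | tt => k acc
  | _ => lazymatch type of rs with
    | _ = _ => dia_add_rule objs gens sig env rs constr:(Always) acc k
    | _ => let rs' := eval hnf in rs in dia_rules objs gens sig env rs' acc k
    end
  end.

Ltac dia_with fuel rules tac :=
  lazymatch goal with
  | |- @eq ?T ?l ?r =>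
    lazymatch T with context [@Mor ?R (@smCat _ ?C) _ _] =>
    let acc := dia_collect l constr:((tt, tt)) in
    let acc := dia_collect r acc in
    let acc := dia_collect_rules rules acc in
    lazymatch acc with (?objs, ?gens) =>
      let lob := dia_mkob C objs in
      let ob := fresh "ob" in pose (ob := nth (@tunit R C) lob);
      let sg := dia_mksig objs gens in
      let sig := fresh "sig" in pose (sig := sg);
      let en := dia_mkenv gens in
      let env := fresh "env" in pose (env := (en : @genv R C ob sig));
      let tl := dia_reify objs gens sig l in
      let tr := dia_reify objs gens sig r in
      dia_rules objs gens sig env rules constr:((@nil grule, I : valid_rules env [::]))
        ltac:(fun acc => lazymatch acc with (?rs, ?vs) => tac sig env rs vs tl tr fuel end)
    end end
  end.

Ltac dia_solve sig env rs vs tl tr fuel :=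
  let x := eval vm_compute in (check rs tl tr fuel) in
  lazymatch x with
  | true => refine (@checkP sig _ _ _ env rs _ _ tl tr fuel vs _);
      vm_cast_no_check (erefl true)
  | _ => fail 100 "the two sides have different normal forms"
  end.

(* Proves an equality of morphisms by rewriting both sides with [rules]; [dia tt] decides
   coherence. *)
Tactic Notation "dia" constr(rules) := dia_with 1000%N rules dia_solve.

(* Makes the names of [Defs], such as [mulA], take precedence again. *)
Import Defs.

(** * Cocommutative Hopf monoids *)

Section Hopf.
Variables (R : comPzRingType) (C : symMonCat R) (H : hopfData C).
Hypothesis hH : isHopf H.

Lemma antip_one : antip H ∘ one H = one H.
Proof.
transitivity (mul H ∘ (antip H ⊠ idm H) ∘ comul H ∘ one H).
  by dia (comul_one hH, mul1r hH).
by dia (antipl hH, counit_one hH).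
Qed.

Lemma counit_antip : counit H ∘ antip H = counit H.
Proof.
transitivity (counit H ∘ mul H ∘ (antip H ⊠ idm H) ∘ comul H).
  by dia (counit_mul hH, counitr hH).
by dia (antipl hH, counit_one hH).
Qed.

End Hopf.

Section CocommutativeHopf.
Variables (R : comPzRingType) (C : symMonCat R) (H : hopfData C).
Hypotheses (hH : isHopf H) (hc : sym H H ∘ comul H = comul H).

(** Together with [hc] on the last two leaves, this transposition generates all permutations of the
    leaves of an iterated coproduct nested to the right. *)
Lemma comul_swap3 : swap12 H H H ∘ (idm H ⊠ comul H) ∘ comul H = (idm H ⊠ comul H) ∘ comul H.
Proof.
rewrite -(comulA hH) /swap12 -!catA (cancA _ (assocK _ _ _)).
by rewrite [X in _ ∘ X = _]catA -tens_compl hc.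
Qed.

Definition comul_rules :=
  (comulA hH, counitl hH, counitr hH,
   (hc, Sort_out 1 0), (comul_swap3, Sort_out 1 0)).

Definition bialg_rules :=
  (comul_rules, mulA hH, mul1l hH, mul1r hH, comul_mul hH, comul_one hH,
   counit_mul hH, counit_one hH).

(** The antipode axiom as x_1 (S(x_2) y) = eps(x) y. In products nested to the right the factor x_1
    S(x_2) is not a subterm, so the axiom itself would not match. *)
Lemma cancel_mulV : mul H ∘ (idm H ⊠ (mul H ∘ (antip H ⊠ idm H))) ∘ assoc _ _ _ ∘ (comul H ⊠ idm H)
  = lunit _ ∘ (counit H ⊠ idm H).
Proof.
transitivity (mul H ∘ ((mul H ∘ (idm H ⊠ antip H) ∘ comul H) ⊠ idm H)).
  dia (mulA hH).
by rewrite (antipr hH); dia (mul1l hH).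
Qed.

Lemma cancel_Vmul : mul H ∘ (antip H ⊠ mul H) ∘ assoc _ _ _ ∘ (comul H ⊠ idm H)
  = lunit _ ∘ (counit H ⊠ idm H).
Proof.
transitivity (mul H ∘ ((mul H ∘ (antip H ⊠ idm H) ∘ comul H) ⊠ idm H)).
  dia (mulA hH).
by rewrite (antipl hH); dia (mul1l hH).
Qed.

(** Runs against the orientation of [comulA]. Under the guard [Enables] it regroups leaves only
    where a cancellation follows, so the two do not undo each other. *)
Lemma comulA_rev : (idm H ⊠ comul H) ∘ comul H = assoc _ _ _ ∘ (comul H ⊠ idm H) ∘ comul H.
Proof. by rewrite (comulA hH). Qed.

Definition cancel_rules := ((antipl hH, Cancel), (antipr hH, Cancel),
  (cancel_mulV, Cancel), (cancel_Vmul, Cancel), (comulA_rev, Enables)).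

(** Both sides are convolution inverses of [mul]. In Sweedler notation [T] is S(a_1 b_1) a_2 b_2
    S(b_3) S(a_3). *)
Lemma antip_mul : antip H ∘ mul H = mul H ∘ sym H H ∘ (antip H ⊠ antip H).
Proof.
pose T := mul H ∘ ((mul H ∘ (antip H ⊠ idm H) ∘ comul H ∘ mul H) ⊠
  (mul H ∘ sym H H ∘ (antip H ⊠ antip H))) ∘ swapmid H H H H ∘ (comul H ⊠ comul H).
transitivity T; last by rewrite /T; dia (antipl hH, bialg_rules).
rewrite /T.
(* The rules for S(x_1) x_2 are withheld: they would collapse the first factor and give the
   right-hand side again. *)
dia (bialg_rules, (antipr hH, Cancel), (cancel_mulV, Cancel), (comulA_rev, Enables)).
Qed.

(** Uniqueness of convolution inverses among maps from [H] to [H ⊗ H], through Delta(S(c_1))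
    Delta(c_2) X(c_3). Cocommutativity removes the flip of the general formula. *)
Lemma comul_antip : comul H ∘ antip H = (antip H ⊠ antip H) ∘ comul H.
Proof.
pose X := (antip H ⊠ antip H) ∘ comul H.
transitivity (mul2 H ∘ ((comul H ∘ antip H) ⊠ (mul2 H ∘ (comul H ⊠ X) ∘ comul H)) ∘ comul H).
  by rewrite /X; dia (bialg_rules, cancel_rules).
transitivity (mul2 H ∘ ((comul H ∘ mul H ∘ (antip H ⊠ idm H) ∘ comul H) ⊠ X) ∘ comul H).
  by rewrite /X; dia (bialg_rules).
by rewrite /X; dia (antipl hH, bialg_rules).
Qed.

(** S S is a convolution inverse of S: by [comul_antip], S(S(c_1)) S(c_2) is the antipode axiom
    evaluated at S(c). *)
Lemma antipK : antip H ∘ antip H = idm H.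
Proof.
transitivity (mul H ∘ ((mul H ∘ ((antip H ∘ antip H) ⊠ antip H) ∘ comul H) ⊠ idm H) ∘ comul H).
  by dia (cancel_rules, bialg_rules).
have -> : mul H ∘ ((antip H ∘ antip H) ⊠ antip H) ∘ comul H =
    mul H ∘ (antip H ⊠ idm H) ∘ comul H ∘ antip H by dia comul_antip.
by dia (antipl hH, bialg_rules, counit_antip hH).
Qed.

Lemma antipi_antip : antipi H = antip H.
Proof. by rewrite -[LHS]compm1 -antipK catA (invl (antip_inv hH)) comp1m. Qed.

Definition hopf_rules := (cancel_rules, bialg_rules, antip_mul, antip_one hH,
  counit_antip hH, comul_antip, antipK, antipi_antip).

Section Action.
Variables (V : C) (a : Mor (H ⊗ V) V).
Hypotheses (aA : a ∘ (mul H ⊠ idm V) = a ∘ (idm H ⊠ a) ∘ assoc H H V)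
  (a1 : a ∘ (one H ⊠ idm V) = lunit V).

Lemma cancel_actV : a ∘ (idm H ⊠ (a ∘ (antip H ⊠ idm V))) ∘ assoc _ _ _ ∘ (comul H ⊠ idm V)
  = lunit _ ∘ (counit H ⊠ idm V).
Proof.
transitivity (a ∘ ((mul H ∘ (idm H ⊠ antip H) ∘ comul H) ⊠ idm V)); first by dia aA.
by rewrite (antipr hH); dia a1.
Qed.

Lemma cancel_Vact : a ∘ (antip H ⊠ a) ∘ assoc _ _ _ ∘ (comul H ⊠ idm V)
  = lunit _ ∘ (counit H ⊠ idm V).
Proof.
transitivity (a ∘ ((mul H ∘ (antip H ⊠ idm H) ∘ comul H) ⊠ idm V)); first by dia aA.
by rewrite (antipl hH); dia a1.
Qed.

Definition act_rules := ((cancel_actV, Cancel), (cancel_Vact, Cancel), aA, a1).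

End Action.

End CocommutativeHopf.

(** * Drinfeld-Yetter modules of a coPoisson Hopf monoid *)

Section TripleMor.
Variables (R : comPzRingType) (C : symMonCat R) (H : hopfData C).

Lemma triple_mor_act (V W : triple H) (f : Mor V W) : isTripleMor f ->
  f ∘ act V = act W ∘ (idm H ⊠ f).
Proof. by case/andP => /eqP. Qed.

Lemma triple_mor_coact (V W : triple H) (f : Mor V W) : isTripleMor f ->
  coact W ∘ f = (f ⊠ idm H) ∘ coact V.
Proof. by case/andP => _ /eqP. Qed.

Definition mor_rules (V W : triple H) (f : Mor V W) (hf : isTripleMor f) :=
  (triple_mor_act hf, triple_mor_coact hf).

Lemma isTripleMorP (V W : triple H) (f : Mor V W) :
  f ∘ act V = act W ∘ (idm H ⊠ f) -> coact W ∘ f = (f ⊠ idm H) ∘ coact V ->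
  isTripleMor f.
Proof. by move=> e1 e2; rewrite /isTripleMor e1 e2 !eqxx. Qed.

Lemma triple_t_nat (V V' W W' : triple H) (f : Mor V V') (g : Mor W W') :
  isTripleMor f -> isTripleMor g ->
  triple_t V' W' ∘ (f ⊠ g) = (f ⊠ g) ∘ triple_t V W.
Proof. by move=> hf hg; dia (mor_rules hf, mor_rules hg). Qed.

Lemma triple_t_sym (V W : triple H) : sym V W ∘ triple_t V W = triple_t W V ∘ sym V W.
Proof. by dia tt. Qed.

End TripleMor.

Section Lower.
Variables (R : comPzRingType) (C : symMonCat R) (H : coPoissonHopf C).
Let hH := cp_isHopf (cp_ax H).
Let hc := cp_cocomm (cp_ax H).

Lemma sym_cobr : sym H H ∘ cobr H = - cobr H.
Proof. by apply/eqP; rewrite -addr_eq0 addrC; apply/eqP/(cobr_anti (cp_ax H)). Qed.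

Lemma cobr_comulr : (idm H ⊠ comul H) ∘ cobr H =
  assoc H H H ∘ (cobr H ⊠ idm H) ∘ comul H + swap12 H H H ∘ (idm H ⊠ cobr H) ∘ comul H.
Proof.
transitivity (- (sym (H ⊗ H) H ∘ (comul H ⊠ idm H) ∘ cobr H)).
  by rewrite -[cobr H in LHS]opprK -sym_cobr; dia tt.
rewrite (cobr_comul (cp_ax H)); dia (comul_rules hH hc, (sym_cobr, Sort_out 1 0)).
Qed.

Lemma cobr_counitr : (idm H ⊠ counit H) ∘ cobr H = 0.
Proof.
transitivity (- (sym _ _ ∘ (counit H ⊠ idm H) ∘ cobr H)).
  by rewrite -[cobr H in LHS]opprK -sym_cobr; dia tt.
by rewrite (cobr_counit (cp_ax H)) compm0 oppr0.
Qed.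

Definition lower_rules := (hopf_rules hH hc, (sym_cobr, Sort_out 1 0),
  cobr_comul (cp_ax H), cobr_comulr, cobr_mul (cp_ax H), cobr_one (cp_ax H),
  cobr_counit (cp_ax H), cobr_counitr).

Section Module.
Variables (V : triple H) (hV : isLowerDY V).

(** The element v_[1] is primitive, and for primitive x the counit gives eps(x) = eps(x) +
    eps(x). *)
Lemma coact_counit : (idm V ⊠ counit H) ∘ coact V = 0.
Proof.
have e : (idm V ⊠ counit H) ∘ coact V = (idm V ⊠ counit H) ∘ coact V + (idm V ⊠ counit H) ∘ coact V.
  transitivity ((idm V ⊠ (lunit _ ∘ (counit H ⊠ counit H))) ∘ (idm V ⊠ comul H) ∘ coact V).
    by dia (counitl hH).
  by rewrite (ldy_coact_comul hV); dia (counit_one hH).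
by apply: (addrI ((idm V ⊠ counit H) ∘ coact V)); rewrite addr0 -e.
Qed.

(** For primitive x the antipode axiom reads S(x) + x = eps(x) 1, which vanishes by
    [coact_counit]. *)
Lemma coact_antip : (idm V ⊠ antip H) ∘ coact V = - coact V.
Proof.
apply/eqP; rewrite -addr_eq0; apply/eqP.
transitivity ((idm V ⊠ (mul H ∘ (antip H ⊠ idm H))) ∘ (idm V ⊠ comul H) ∘ coact V).
  by rewrite (ldy_coact_comul hV); dia (antip_one hH, mul1l hH, mul1r hH).
by dia (antipl hH, coact_counit).
Qed.

Definition module_rules := (act_rules hH (ldy_act_mul hV) (ldy_act_one hV),
  ldy_coact_act hV, ldy_coact_cobr hV, ldy_coact_comul hV, coact_counit, coact_antip).

End Module.

Lemma lower_unitP : isLowerDY (sp_unit (lowerDYspec H)).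
Proof.
split; rewrite /twisted_coact /mul_antipi /=.
- by dia lower_rules.
- by dia lower_rules.
- by dia lower_rules.
- by dia lower_rules.
by dia lower_rules.
Qed.

Lemma lower_tensP (V W : triple H) : isLowerDY V -> isLowerDY W ->
  isLowerDY (sp_tens (S := lowerDYspec H) V W).
Proof.
move=> hV hW; split; rewrite /twisted_coact /mul_antipi /=.
- dia (lower_rules, module_rules hV, module_rules hW).
- by dia (lower_rules, module_rules hV, module_rules hW).
- dia (lower_rules, module_rules hV, module_rules hW).
- dia (lower_rules, module_rules hV, module_rules hW).
dia (lower_rules, module_rules hV, module_rules hW).
Qed.

Local Notation spec := (lowerDYspec H).
Local Notation "V ⊙ W" := (sp_tens (S := spec) V W) (at level 32, left associativity).

Lemma lower_tensmP (V V' W W' : triple H) (f : Mor V V') (g : Mor W W') :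
  isTripleMor f -> isTripleMor g ->
  isTripleMor (V := V ⊙ W) (W := V' ⊙ W') (f ⊠ g).
Proof.
move=> hf hg; apply: isTripleMorP; rewrite /=; dia (mor_rules hf, mor_rules hg).
Qed.

Lemma lower_assocP (U V W : triple H) :
  isTripleMor (V := (U ⊙ V) ⊙ W) (W := U ⊙ (V ⊙ W)) (assoc U V W).
Proof. by apply: isTripleMorP; rewrite /=; dia (comulA hH). Qed.

Lemma lower_associP (U V W : triple H) :
  isTripleMor (V := U ⊙ (V ⊙ W)) (W := (U ⊙ V) ⊙ W) (associ U V W).
Proof. by apply: isTripleMorP; rewrite /=; dia (comulA hH). Qed.

Lemma lower_lunitP (V : triple H) :
  isTripleMor (V := sp_unit spec ⊙ V) (W := V) (lunit V).
Proof. by apply: isTripleMorP; rewrite /=; dia (counitl hH). Qed.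

Lemma lower_lunitiP (V : triple H) :
  isTripleMor (V := V) (W := sp_unit spec ⊙ V) (luniti V).
Proof. by apply: isTripleMorP; rewrite /=; dia (counitl hH). Qed.

Lemma lower_runitP (V : triple H) :
  isTripleMor (V := V ⊙ sp_unit spec) (W := V) (runit V).
Proof. by apply: isTripleMorP; rewrite /=; dia (counitr hH). Qed.

Lemma lower_runitiP (V : triple H) :
  isTripleMor (V := V) (W := V ⊙ sp_unit spec) (runiti V).
Proof. by apply: isTripleMorP; rewrite /=; dia (counitr hH). Qed.

Lemma lower_symP (V W : triple H) :
  isTripleMor (V := V ⊙ W) (W := W ⊙ V) (sym V W).
Proof. by apply: isTripleMorP; rewrite /=; dia ((hc, Sort_out 1 0)). Qed.

Lemma lower_tP (V W : triple H) : isLowerDY V -> isLowerDY W ->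
  isTripleMor (V := V ⊙ W) (W := V ⊙ W) (triple_t V W).
Proof.
move=> hV hW; apply: isTripleMorP; rewrite /=; dia (lower_rules, module_rules hV, module_rules hW).
Qed.

(** As u_[1] is primitive, it acts on V ⊗ W as a derivation, which splits the first term of t; the
    second splits by the definition of the coaction on V ⊗ W. *)
Lemma lower_t_tens (U V W : triple H) : isLowerDY U -> isLowerDY V -> isLowerDY W ->
  triple_t U (V ⊙ W) =
    assoc U V W ∘ (triple_t U V ⊠ idm W) ∘ associ U V W
    + assoc U V W ∘ (sym V U ⊠ idm W) ∘ associ V U W
        ∘ (idm V ⊠ triple_t U W)
        ∘ assoc V U W ∘ (sym U V ⊠ idm W) ∘ associ U V W.
Proof.
move=> hU hV hW; rewrite /triple_t /=.
dia (ldy_coact_comul hU, ldy_act_one hV, ldy_act_one hW).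
Qed.

Lemma lower_spec : isCartierSpec spec.
Proof.
split.
- exact: lower_unitP.
- by move=> V W; apply: lower_tensP (sp_tripleP V) (sp_tripleP W).
- by move=> V V' W W' f g; apply: lower_tensmP (tmorP f) (tmorP g).
- by move=> *; apply: lower_assocP.
- by move=> *; apply: lower_associP.
- by move=> *; apply: lower_lunitP.
- by move=> *; apply: lower_lunitiP.
- by move=> *; apply: lower_runitP.
- by move=> *; apply: lower_runitiP.
- by move=> *; apply: lower_symP.
- by move=> V W; apply: lower_tP (sp_tripleP V) (sp_tripleP W).
- by move=> V V' W W' f g; apply: triple_t_nat (tmorP f) (tmorP g).
- by move=> *; apply: triple_t_sym.
by move=> U V W; apply: lower_t_tens (sp_tripleP U) (sp_tripleP V) (sp_tripleP W).
Qed.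

End Lower.

(** * The Drinfeld-Yetter module [C_-] and its comonoid structure *)

Section Cminus.
Variables (R : comPzRingType) (C : symMonCat R) (H : coPoissonHopf C).
Let hH := cp_isHopf (cp_ax H).
Let hc := cp_cocomm (cp_ax H).

Lemma cminus_comul : isTripleMor (V := Cminus_triple H)
    (W := sp_tens (S := lowerDYspec H) (Cminus_triple H) (Cminus_triple H)) (comul H).
Proof.
apply: isTripleMorP; rewrite /=.
  by dia (lower_rules H).
by dia (lower_rules H).
Qed.

Lemma cminus_counit : isTripleMor (V := Cminus_triple H)
    (W := sp_unit (lowerDYspec H)) (counit H).
Proof.
apply: isTripleMorP; rewrite /=.
  by dia (lower_rules H).
by dia (lower_rules H).
Qed.

(* Sorting puts the smallest leaf of an iterated cobracket outermost; this moves it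
   innermost. *)
Lemma cobr_cobr : (idm H ⊠ cobr H) ∘ cobr H =
  assoc _ _ _ ∘ (cobr H ⊠ idm H) ∘ cobr H
  - assoc _ _ _ ∘ swap23 H H H ∘ (cobr H ⊠ idm H) ∘ cobr H.
Proof.
apply/eqP; rewrite -subr_eq0 -(cobr_jacobi (cp_ax H)); apply/eqP.
by dia ((sym_cobr H, Sort_out 1 0)).
Qed.

(** Apply delta to S(c_1) c_2 = eps(c) 1, where delta(1) = 0, and multiply on the right by
    Delta(S(c_3)) to isolate delta S. *)
Lemma cobr_antip : cobr H ∘ antip H = - (mul2 H ∘
  ((mul2 H ∘ ((comul H ∘ antip H) ⊠ cobr H) ∘ comul H) ⊠ (comul H ∘ antip H)) ∘ comul H).
Proof.
apply/eqP; rewrite -addr_eq0; apply/eqP.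
transitivity (mul2 H ∘ (((mul2 H ∘ (cobr H ⊠ comul H) + mul2 H ∘ (comul H ⊠ cobr H))
    ∘ (antip H ⊠ idm H) ∘ comul H) ⊠ (comul H ∘ antip H)) ∘ comul H).
  by dia (lower_rules H).
by rewrite -(cobr_mul (cp_ax H)); dia (lower_rules H).
Qed.

(* S(c') ⊗ c'' = - S(c_1) c_2' S(c_3) ⊗ c_2'' *)
Lemma antip_cobrl : (antip H ⊠ idm H) ∘ cobr H = - ((mul H ⊠ idm H) ∘ swap23 H H H ∘
  (((mul H ⊠ idm H) ∘ associ H H H ∘ (antip H ⊠ cobr H) ∘ comul H) ⊠ antip H) ∘ comul H).
Proof.
apply/eqP; rewrite -addr_eq0; apply/eqP.
transitivity ((mul H ⊠ idm H) ∘ swap23 H H H ∘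
  ((((mul H ∘ (antip H ⊠ idm H)) ⊠ idm H) ∘ (associ H H H ∘ (idm H ⊠ cobr H) ∘ comul H +
    swap23 H H H ∘ (cobr H ⊠ idm H) ∘ comul H)) ⊠ antip H) ∘ comul H).
  by dia (lower_rules H).
by rewrite -(cobr_comul (cp_ax H)); dia (lower_rules H).
Qed.

Lemma antip_cobrr : (idm H ⊠ antip H) ∘ cobr H = - ((idm H ⊠ mul H) ∘ assoc H H H ∘
  (((idm H ⊠ mul H) ∘ swap12 H H H ∘ (antip H ⊠ cobr H) ∘ comul H) ⊠ antip H) ∘ comul H).
Proof.
transitivity (- (sym H H ∘ (antip H ⊠ idm H) ∘ cobr H)).
  by dia ((sym_cobr H, Sort_out 1 0)).
by rewrite antip_cobrl; dia (comul_rules hH hc, (sym_cobr H, Sort_out 1 0)).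
Qed.

Definition antip_cobr_rules := (cobr_antip, antip_cobrl, antip_cobrr).

Lemma cminusP : isLowerDY (Cminus_triple H).
Proof.
split; rewrite /twisted_coact /mul_antipi /=.
- dia (mulA hH).
- dia (mul1l hH).
(* Compatibility of the coaction with delta: here the co-Jacobi identity enters, and delta falls on
   the antipode in [cobr_minus]. *)
- dia (lower_rules H, antip_cobr_rules, cobr_cobr).
- dia (lower_rules H).
dia (lower_rules H).
Qed.

Lemma lower_comonoid : isLowerComonoid H.
Proof. by split; [exact: cminusP|exact: cminus_comul|exact: cminus_counit]. Qed.

End Cminus.

(** * Transport of structure *)

Section Transport.
Variables (R : comPzRingType) (C : symMonCat R).

Section Conjugate.
Variables (H' H : hopfData C) (f : Mor H' H) (g : Mor H H').
Hypotheses (fg : isInverse f g) (fm : hopfMor f).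

Lemma iso_mul : mul H' = g ∘ mul H ∘ (f ⊠ f).
Proof. by rewrite -(hm_mul fm) catA (invl fg) comp1m. Qed.

Lemma iso_one : one H' = g ∘ one H.
Proof. by rewrite -(hm_one fm) catA (invl fg) comp1m. Qed.

Lemma iso_comul : comul H' = (g ⊠ g) ∘ comul H ∘ f.
Proof. by rewrite -(hm_comul fm) catA -tensm_comp (invl fg) tensm1 comp1m. Qed.

Lemma iso_counit : counit H' = counit H ∘ f.
Proof. by rewrite (hm_counit fm). Qed.

Lemma iso_antip : antip H' = g ∘ antip H ∘ f.
Proof. by rewrite -(hm_antip fm) catA (invl fg) comp1m. Qed.

Definition iso_rules := (iso_mul, iso_one, iso_comul, iso_counit, iso_antip, invl fg, invr fg).

End Conjugate.

(** The structure maps of [H'] are conjugates of those of [H], so [iso_rules] reduces each axiom to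
    one of [H]. As [hopfMor] does not speak of [antipi], its being inverse to [antip] is a separate
    hypothesis. *)
Lemma isHopf_iso (H' H : hopfData C) (f : Mor H' H) (g : Mor H H') :
  isInverse f g -> hopfMor f -> isInverse (antip H') (antipi H') -> isHopf H -> isHopf H'.
Proof.
move=> fg fm si hH; split=> //.
all: dia (iso_rules fg fm, mulA hH, mul1l hH, mul1r hH, comulA hH, counitl hH, counitr hH,
   comul_mul hH, comul_one hH, counit_mul hH, counit_one hH, (antipl hH, Cancel), (antipr hH, Cancel)).
Qed.

Lemma isCoPoissonHopf_iso (H' : coPoissonData C) (H : coPoissonHopf C) (f : Mor H' H) (g : Mor H H') :
  isInverse f g -> hopfMor f -> (f ⊠ f) ∘ cobr H' = cobr H ∘ f ->
  isInverse (antip H') (antipi H') -> isCoPoissonHopf H'.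
Proof.
move=> fg fm fd si; have aH := cp_ax H.
have ed : cobr H' = (g ⊠ g) ∘ cobr H ∘ f.
  by rewrite -fd catA -tensm_comp (invl fg) tensm1 comp1m.
split; first exact: isHopf_iso fg fm si (cp_isHopf aH).
- by dia (iso_rules fg fm, (cp_cocomm aH, Sort_out 1 0)).
- by dia (iso_rules fg fm, ed, (sym_cobr H, Sort_out 1 0)).
(* The co-Jacobi identity has a sum on its left side and cannot serve as a rule, so the whole
   relation is conjugated. *)
- transitivity ((g ⊠ (g ⊠ g)) ∘ ((idm H ⊠ cobr H) ∘ cobr H
    + cyc H H H ∘ (idm H ⊠ cobr H) ∘ cobr H
    + cyc H H H ∘ cyc H H H ∘ (idm H ⊠ cobr H) ∘ cobr H) ∘ f).
    by dia (iso_rules fg fm, ed).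
  by rewrite (cobr_jacobi aH) comp0m compm0.
- by dia (iso_rules fg fm, ed, cobr_comul aH).
- by dia (iso_rules fg fm, ed, cobr_mul aH).
- by dia (iso_rules fg fm, ed, cobr_one aH).
by dia (iso_rules fg fm, ed, cobr_counit aH).
Qed.

End Transport.

(** * The functor of coinvariants *)

Section Cofactor.
Variables (R : comPzRingType) (C : symMonCat R).

Section Fixed.
Variables (X Y Q : C) (f : Mor X Y) (p : Mor Y Q).
Hypothesis fp : isCoker f p.

Lemma cofactor_ex Z (g : Mor Y Z) : g ∘ f = 0 -> exists h : Mor Q Z, h ∘ p == g.
Proof. by case/(proj2 fp) => h [e _]; exists h; apply/eqP. Qed.

(** Functors are data, whereas a cokernel only asserts existence. Hom-modules carry a choice
    structure and [==] makes the property boolean, so [xchoose] extracts the factorization. *)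
Definition cofactor Z (g : Mor Y Z) (e : g ∘ f = 0) : Mor Q Z := xchoose (cofactor_ex e).

Lemma cofactorE Z (g : Mor Y Z) (e : g ∘ f = 0) : cofactor e ∘ p = g.
Proof. exact/eqP/(xchooseP (cofactor_ex e)). Qed.

Lemma coker_epi Z (g h : Mor Q Z) : g ∘ p = h ∘ p -> g = h.
Proof.
move=> e; have e0 : (g ∘ p) ∘ f = 0 by rewrite -catA (proj1 fp) compm0.
by have [k [_ u]] := proj2 fp _ _ e0; rewrite -(u g) // -(u h) // -e.
Qed.

End Fixed.

Variable good : cGoodEnough C.

(** Both factors of p ⊠ p' = (p ⊠ id) (id ⊠ p') are epimorphisms because every [Z ⊗ -] preserves
    cokernels; the left one is first conjugated by [sym]. *)
Lemma coker_epi2 (X Y Q X' Y' Q' Z : C) (f : Mor X Y) (p : Mor Y Q) (f' : Mor X' Y')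
    (p' : Mor Y' Q') (g h : Mor (Q ⊗ Q') Z) :
  isCoker f p -> isCoker f' p' -> g ∘ (p ⊠ p') = h ∘ (p ⊠ p') -> g = h.
Proof.
move=> c c'; rewrite -(tens_lr p p') !catA => e.
have {}e := coker_epi (coker_tens good Y c') e.
apply: (iso_epi (symK Q Q')).
apply: (coker_epi (coker_tens good Q' c)).
rewrite -!catA sym_nat !catA e //.
Qed.

End Cofactor.

Section Fminus.
Variables (R : comPzRingType) (C : symMonCat R) (good : cGoodEnough C).
Variable H : coPoissonHopf C.
Let hH := cp_isHopf (cp_ax H).
Let hc := cp_cocomm (cp_ax H).
Local Notation spec := (lowerDYspec H).
Local Notation DY := (lowerDY (lower_spec H)).
Local Notation "V ⊙ W" := (sp_tens (S := spec) V W) (at level 32, left associativity).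
Local Notation Fo := (Fminus_ob good).
Local Notation p := (Fminus_proj good).

Lemma proj_coker (V : triple H) : isCoker (Fminus_rel V) (p V).
Proof. exact: cokerP. Qed.

Lemma proj_act (V : triple H) : p V ∘ act V = p V ∘ lunit V ∘ (counit H ⊠ idm V).
Proof.
apply/eqP; rewrite -subr_eq0 -compBr; apply/eqP.
exact: proj1 (proj_coker V).
Qed.

Lemma kill_rel (V : triple H) Z (g : Mor V Z) :
  g ∘ act V = g ∘ lunit V ∘ (counit H ⊠ idm V) -> g ∘ Fminus_rel V = 0.
Proof. by move=> e; rewrite /Fminus_rel compBr e subrr. Qed.

Lemma Fminus_mor_kill (V W : triple H) (f : Mor V W) : isTripleMor f ->
  (p W ∘ f) ∘ Fminus_rel V = 0.
Proof.
move=> hf; apply: kill_rel; rewrite -catA (triple_mor_act hf) catA proj_act.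
by dia tt.
Qed.

Definition Fminus_mor (V W : triple H) (f : Mor V W) (hf : isTripleMor f) :=
  cofactor (proj_coker V) (Fminus_mor_kill hf).

Lemma Fminus_morE (V W : triple H) (f : Mor V W) (hf : isTripleMor f) :
  Fminus_mor hf ∘ p V = p W ∘ f.
Proof. exact: cofactorE. Qed.

Definition Fminus : @functor R DY C (fun V => Fo V).
Proof.
refine (@Functor R DY C (fun V => Fo V) (fun V W f => Fminus_mor (tmorP f)) _ _).
- move=> X; apply: (coker_epi (proj_coker X)).
  by rewrite Fminus_morE comp1m compm1.
- move=> X Y Z g f; apply: (coker_epi (proj_coker X)).
  by rewrite -catA !Fminus_morE !catA Fminus_morE.
Defined.

Lemma FminusE (V W : DY) (f : Mor V W) : fmor Fminus f ∘ p V = p W ∘ tmor f.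
Proof. exact: Fminus_morE. Qed.

Lemma F2_kill (V W : DY) : (p V ⊠ p W) ∘ Fminus_rel (V ⊗ W : DY) = 0.
Proof.
apply: kill_rel => /=; dia (proj_act V, proj_act W, counitl hH).
Qed.

Lemma F0_kill : idm tunit ∘ Fminus_rel (tunit : DY) = 0.
Proof. by apply: kill_rel => /=; dia tt. Qed.

Definition Fminus2 (V W : DY) := cofactor (proj_coker (V ⊗ W : DY)) (F2_kill V W).
Definition Fminus0 := cofactor (proj_coker (tunit : DY)) F0_kill.

Lemma Fminus2E (V W : DY) : Fminus2 V W ∘ p (V ⊗ W : DY) = p V ⊠ p W.
Proof. exact: cofactorE. Qed.

Lemma Fminus0E : Fminus0 ∘ p (tunit : DY) = idm tunit.
Proof. exact: cofactorE. Qed.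

Definition Fminus_comonoidal : @comonoidal R DY (trivialCartier C) (fun V => Fo V) Fminus.
Proof.
refine (@Comonoidal R DY (trivialCartier C) (fun V => Fo V) Fminus
  (fun V W => Fminus2 V W) Fminus0 _ _ _ _).
- move=> X Y X' Y' f g; apply: (coker_epi (proj_coker (X ⊗ Y : DY))).
  rewrite -!catA FminusE (eqA1 _ (Fminus2E _ _)) Fminus2E -!tensm_comp.
  by rewrite !FminusE.
- move=> X Y Z; apply: (coker_epi (proj_coker (X ⊗ Y ⊗ Z : DY))).
  rewrite -!catA FminusE (eqA1 _ (Fminus2E X (Y ⊗ Z))) Fminus2E.
  rewrite (catA (_ ⊠ Fminus2 _ _)) -!tensm_comp !Fminus2E !comp1m.
  by rewrite assoc_nat.
- move=> X; apply: (coker_epi (proj_coker (tunit ⊗ X : DY))).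
  rewrite -!catA FminusE Fminus2E -tensm_comp Fminus0E comp1m.
  by rewrite lunit_nat.
- move=> X; apply: (coker_epi (proj_coker (X ⊗ tunit : DY))).
  rewrite -!catA FminusE Fminus2E -tensm_comp Fminus0E comp1m.
  by rewrite runit_nat.
Defined.

(** The infinitesimal braiding of [C] is 0, so t has to die in the coinvariants: there v_[1] acts
    through eps, and eps(v_[1]) = 0. *)
Lemma Fminus_inf_braided : @comonoidal_inf_braided R DY (trivialCartier C)
  (fun V => Fo V) Fminus Fminus_comonoidal.
Proof.
split=> X Y; apply: (coker_epi (proj_coker (X ⊗ Y : DY))).
  rewrite -!catA FminusE (eqA1 _ (Fminus2E Y X)) Fminus2E.
  by rewrite sym_nat.
rewrite -!catA FminusE (eqA1 _ (Fminus2E X Y)) /= !comp0m.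
by dia (proj_act X, proj_act Y, coact_counit (sp_tripleP X), coact_counit (sp_tripleP Y)).
Qed.

Local Notation N := (Cminus_triple H).
Local Notation M := (Cminus (lower_spec H) (lower_comonoid H)).

Lemma sym_comul_M : sym (M : DY) M ∘ cm_comul M = cm_comul M.
Proof. by apply/val_inj; exact: hc. Qed.

(** By cocommutativity the antipodes cancel and the two terms of t Delta(c) become -c' ⊗ c'' and
    -c'' ⊗ c', whose sum vanishes by antisymmetry. *)
Lemma tinf_comul_M : tinf (M : DY) M ∘ cm_comul M = 0.
Proof.
apply/val_inj => /=; rewrite /triple_t /=.
by dia (lower_rules H, antip_cobr_rules H).
Qed.

(* M ⊗ V is free over H, so its coinvariants are V, by h ⊗ v |-> S(h) v. *)
Definition free_l (V : triple H) : Mor (H ⊗ V) V := act V ∘ (antip H ⊠ idm V).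
Definition free_r (V : triple H) : Mor (V ⊗ H) V := act V ∘ sym V H ∘ (idm V ⊠ antip H).

Definition split_l (V : triple H) : Mor V (H ⊗ V) := (one H ⊠ idm V) ∘ luniti V.
Definition split_r (V : triple H) : Mor V (V ⊗ H) := (idm V ⊠ one H) ∘ runiti V.

Lemma free_l_nat (V W : triple H) (f : Mor V W) : isTripleMor f ->
  free_l W ∘ (idm H ⊠ f) = f ∘ free_l V.
Proof. by move=> hf; rewrite /free_l; dia (triple_mor_act hf). Qed.

Section Free.
Variables (V : triple H) (hV : isLowerDY V).
Local Notation rules := (hopf_rules hH hc, act_rules hH (ldy_act_mul hV) (ldy_act_one hV)).

Lemma free_l_kill : free_l V ∘ Fminus_rel (N ⊙ V) = 0.
Proof. by apply: kill_rel; rewrite /free_l /=; dia rules. Qed.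

Lemma free_r_kill : free_r V ∘ Fminus_rel (V ⊙ N) = 0.
Proof. by apply: kill_rel; rewrite /free_r /=; dia rules. Qed.

Lemma free_l_split : free_l V ∘ split_l V = idm V.
Proof. by rewrite /free_l /split_l; dia rules. Qed.

Lemma proj_free_l : p (N ⊙ V) ∘ split_l V ∘ free_l V = p (N ⊙ V).
Proof.
pose X := (idm H ⊠ (split_l V ∘ free_l V)) ∘ assoc _ _ _ ∘ (comul H ⊠ idm V).
transitivity ((p (N ⊙ V) ∘ act (N ⊙ V)) ∘ X); rewrite {}/X /free_l /split_l.
  by rewrite proj_act; dia rules.
by rewrite /=; dia rules.
Qed.

Lemma proj_free_r : p (V ⊙ N) ∘ split_r V ∘ free_r V = p (V ⊙ N).
Proof.
pose X := (idm H ⊠ (split_r V ∘ free_r V)) ∘ swap12 _ _ _ ∘ (idm V ⊠ comul H).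
transitivity ((p (V ⊙ N) ∘ act (V ⊙ N)) ∘ X); rewrite {}/X /free_r /split_r.
  by rewrite proj_act; dia rules.
by rewrite /=; dia rules.
Qed.

End Free.

(** Here k is x ⊗ h ⊗ y |-> S(h_1) x ⊗ 1 ⊗ S(h_2) y, and the projection is evaluated on h_2 . k(x ⊗
    h_1 ⊗ y): the action restores x ⊗ h ⊗ y by cocommutativity, while the relation replaces h_2 by
    its counit. *)
Lemma proj_mid (X Y : triple H) (hX : isLowerDY X) (hY : isLowerDY Y) :
  p (X ⊙ N ⊙ Y) ∘ insertm X Y (one H) ∘ (free_r X ⊠ free_l Y) ∘ splitm X Y (comul H)
  = p (X ⊙ N ⊙ Y).
Proof.
pose k := insertm X Y (one H) ∘ (free_r X ⊠ free_l Y) ∘ splitm X Y (comul H).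
pose T := (idm H ⊠ k) ∘ assoc _ _ _ ∘ (sym _ _ ⊠ idm _) ∘ (associ _ _ _ ⊠ idm Y)
  ∘ ((idm X ⊠ comul H) ⊠ idm Y).
transitivity ((p (X ⊙ N ⊙ Y) ∘ act (X ⊙ N ⊙ Y)) ∘ T); rewrite {}/T {}/k /free_r /free_l.
  by rewrite proj_act; dia (hopf_rules hH hc).
by rewrite /=; dia (hopf_rules hH hc, act_rules hH (ldy_act_mul hX) (ldy_act_one hX),
  act_rules hH (ldy_act_mul hY) (ldy_act_one hY)).
Qed.

(** In [N] every h is h . 1, which the projection identifies with eps(h) 1. *)
Lemma proj_N : p N ∘ one H ∘ counit H = p N.
Proof.
transitivity ((p N ∘ act N) ∘ (idm H ⊠ one H) ∘ runiti H).
  by rewrite proj_act; dia (counit_one hH).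
by rewrite /=; dia (mul1r hH).
Qed.

Definition coinv_l (V : DY) : Mor (Fo (M ⊗ V : DY)) (tr_ob V) :=
  cofactor (proj_coker (N ⊙ V)) (free_l_kill (sp_tripleP V)).
Definition coinv_r (V : DY) : Mor (Fo (V ⊗ M : DY)) (tr_ob V) :=
  cofactor (proj_coker (V ⊙ N)) (free_r_kill (sp_tripleP V)).

Lemma coinv_lE (V : DY) : coinv_l V ∘ p (M ⊗ V : DY) = free_l V.
Proof. exact: cofactorE. Qed.

Lemma coinv_rE (V : DY) : coinv_r V ∘ p (V ⊗ M : DY) = free_r V.
Proof. exact: cofactorE. Qed.

Lemma coinv_lK (V : DY) : isInverse (coinv_l V) (p (M ⊗ V : DY) ∘ split_l V).
Proof.
split.
  apply: (coker_epi (proj_coker (M ⊗ V : DY))).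
  by rewrite -catA (coinv_lE V) comp1m -catA; exact: proj_free_l (sp_tripleP V).
by rewrite catA coinv_lE; exact: free_l_split (sp_tripleP V).
Qed.

Lemma Fminus_free : naturally_isomorphic (functor_comp Fminus (tens_left (M : DY)))
  (forget (lower_spec H)).
Proof.
exists coinv_l, (fun V : DY => p (M ⊗ V : DY) ∘ split_l V); split; first exact: coinv_lK.
move=> X Y f; apply: (coker_epi (proj_coker (M ⊗ X : DY))).
transitivity (coinv_l Y ∘ (p (M ⊗ Y : DY) ∘ (idm H ⊠ tmor f))).
  by rewrite -catA; congr (_ ∘ _); exact: (FminusE (idm (M : DY) ⊠ f)).
by rewrite catA coinv_lE -catA coinv_lE; exact: free_l_nat (tmorP f).
Qed.

Lemma chi_inv : isInverse (ad_chi Fminus_comonoidal M) (p (M : DY) ∘ one H).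
Proof.
have e : ad_chi Fminus_comonoidal M ∘ p (M : DY) = counit H.
  by rewrite -catA (FminusE (cm_counit M)) catA Fminus0E comp1m.
split; last by rewrite catA e (counit_one hH).
apply: (coker_epi (proj_coker (M : DY))).
by rewrite -catA e comp1m -catA; exact: proj_N.
Qed.

(** On representatives, (x ⊗ h) ⊗ (h' ⊗ y) |-> S(h) x ⊗ 1 ⊗ S(h') y. *)
Definition gamma_inv (X Y : DY) := p (X ⊗ M ⊗ Y : DY) ∘ insertm (tr_ob X) (tr_ob Y) (one H)
  ∘ (coinv_r X ⊠ coinv_l Y).

Lemma gammaE (X Y : DY) : ad_gamma Fminus_comonoidal M X Y ∘ p (X ⊗ M ⊗ Y : DY) =
  (p (X ⊗ M : DY) ⊠ p (M ⊗ Y : DY)) ∘ splitm (tr_ob X) (tr_ob Y) (comul H).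
Proof.
by rewrite -catA (FminusE (splitm X Y (cm_comul M))) catA (Fminus2E (X ⊗ M) (M ⊗ Y)).
Qed.

Lemma gamma_invP (X Y : DY) : isInverse (ad_gamma Fminus_comonoidal M X Y) (gamma_inv X Y).
Proof.
split.
  apply: (coker_epi (proj_coker (X ⊗ M ⊗ Y : DY))).
  rewrite -catA gammaE /gamma_inv -!catA (catA (coinv_r X ⊠ _)) -tensm_comp coinv_rE coinv_lE comp1m.
  by exact: proj_mid (sp_tripleP X) (sp_tripleP Y).
transitivity (((p (X ⊗ M : DY) ⊠ p (M ⊗ Y : DY)) ∘ splitm (tr_ob X) (tr_ob Y) (comul H)
  ∘ insertm (tr_ob X) (tr_ob Y) (one H)) ∘ (coinv_r X ⊠ coinv_l Y)).
  by rewrite /gamma_inv (catA (ad_gamma _ _ _ _)) gammaE -!catA.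
have -> : (p (X ⊗ M : DY) ⊠ p (M ⊗ Y : DY)) ∘ splitm (tr_ob X) (tr_ob Y) (comul H)
  ∘ insertm (tr_ob X) (tr_ob Y) (one H) = (p (X ⊗ M : DY) ∘ split_r X) ⊠ (p (M ⊗ Y : DY) ∘ split_l Y).
  by rewrite /split_l /split_r; dia (comul_one hH).
rewrite -tensm_comp (invl (coinv_lK Y)).
have -> : (p (X ⊗ M : DY) ∘ split_r X) ∘ coinv_r X = idm _.
  apply: (coker_epi (proj_coker (X ⊗ M : DY))).
  by rewrite -catA (coinv_rE X) comp1m -catA; exact: proj_free_r (sp_tripleP X).
by rewrite tensm1.
Qed.

Definition Fminus_adapted : adapted Fminus_comonoidal M := Adapted chi_inv gamma_invP.

End Fminus.

(** * Comparison of F(C_- ⊗ C_-) with C *)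

Lemma half_double (K : fieldType) (charK : [pchar K] =i pred0) (V : lmodType K)
  (x : V) : 2%:R^-1 *: (x + x) = x.
Proof.
rewrite -mulr2n -scaler_nat scalerA mulVf ?scale1r //.
apply/negP => e; suff : 2 \in [pchar K] by rewrite charK.
by rewrite inE.
Qed.

Section FminusHopf.
Variables (K : fieldType) (charK : [pchar K] =i pred0).
Variables (C : symMonCat K) (good : cGoodEnough C) (H : coPoissonHopf C).
Let hH := cp_isHopf (cp_ax H).
Let hc := cp_cocomm (cp_ax H).
Local Notation DY := (lowerDY (lower_spec H)).
Local Notation p := (Fminus_proj good).
Local Notation N := (Cminus_triple H).
Local Notation cM := (Cminus (lower_spec H) (lower_comonoid H)).
Local Notation M := (cM : DY).
Local Notation ad := (Fminus_adapted good H).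
Local Notation A := (adaptedCoPoisson ad).
Local Notation F := (Fminus good H).
Local Notation f := (coinv_l good M).
Local Notation epi := (coker_epi (proj_coker good (M ⊗ M : DY))).

Lemma diag_projE : f ∘ p (M ⊗ M : DY) = mul H ∘ (antip H ⊠ idm H).
Proof. exact: coinv_lE. Qed.

(** On representatives (c ⊗ d) ⊗ (c' ⊗ d') the product of [A] is the class of S(d) c ⊗ S(c') d',
    which [f] sends to S(c) d S(c') d' because S S = id. *)
Lemma diag_mul : f ∘ mul A = mul H ∘ (f ⊠ f).
Proof.
(* The source is a tensor product of two cokernels, so testing on representatives uses that
   tensoring preserves cokernels. *)
apply: (coker_epi2 good (proj_coker good (M ⊗ M : DY)) (proj_coker good (M ⊗ M : DY))).
rewrite -[RHS]catA -tensm_comp diag_projE.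
have e : gamma_inv good M M ∘ (p (M ⊗ M : DY) ⊠ p (M ⊗ M : DY)) =
    p (M ⊗ M ⊗ M : DY) ∘ insertm (H : C) H (one H) ∘ (free_r N ⊠ free_l N).
  by rewrite /gamma_inv -!catA -tensm_comp coinv_rE coinv_lE.
transitivity (f ∘ fmor F (dropm M M (cm_counit cM))
    ∘ (gamma_inv good M M ∘ (p (M ⊗ M : DY) ⊠ p (M ⊗ M : DY)))).
  by rewrite -!catA.
rewrite e (catA (fmor F _)) (FminusE good (dropm M M _)) -(catA (p _)) (catA f) diag_projE.
by rewrite /free_l /free_r /=; dia (hopf_rules hH hc).
Qed.

Lemma diag_one : f ∘ one A = one H.
Proof.
transitivity ((f ∘ p (M ⊗ M : DY)) ∘ comul H ∘ one H).
  rewrite -!catA; congr (_ ∘ _); rewrite /= catA.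
  by rewrite (FminusE good (cm_comul cM)) -catA.
by rewrite diag_projE; dia (hopf_rules hH hc).
Qed.

(** The coproduct of [A] and its cobracket before antisymmetrization both have the form F^2 F(h), so
    one computation serves both. *)
Lemma diag_pair (h : Mor (M ⊗ M) ((M ⊗ M) ⊗ (M ⊗ M) : DY)) :
  (f ⊠ f) ∘ (cF2 (Fminus_comonoidal good H) (M ⊗ M) (M ⊗ M) ∘ fmor F h) ∘ p (M ⊗ M : DY)
  = ((mul H ∘ (antip H ⊠ idm H)) ⊠ (mul H ∘ (antip H ⊠ idm H))) ∘ tmor h.
Proof.
rewrite -(catA (cF2 _ _ _)) (FminusE good h) (catA (cF2 _ _ _)) (Fminus2E good (M ⊗ M) (M ⊗ M)).
by rewrite catA -tensm_comp diag_projE.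
Qed.

Lemma diag_comul : (f ⊠ f) ∘ comul A = comul H ∘ f.
Proof.
apply: epi; rewrite -(catA (comul H)) diag_projE.
have -> : comul A = cF2 (Fminus_comonoidal good H) (M ⊗ M) (M ⊗ M)
    ∘ fmor F (mid M M (sym M M) ∘ (cm_comul cM ⊠ cm_comul cM)) by rewrite fmor_comp.
rewrite -(catA (f ⊠ f)) diag_pair /=.
by dia (hopf_rules hH hc).
Qed.

Lemma diag_counit : counit H ∘ f = counit A.
Proof.
apply: epi; rewrite -catA diag_projE.
transitivity (Fminus0 good H ∘ (fmor F (lunit _ ∘ (cm_counit cM ⊠ cm_counit cM)) ∘ p (M ⊗ M : DY))).
  by rewrite FminusE (catA (Fminus0 good H)) Fminus0E comp1m /=; dia (hopf_rules hH hc).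
by rewrite catA.
Qed.

Lemma diag_antip : f ∘ antip A = antip H ∘ f.
Proof.
apply: epi; rewrite -(catA (antip H)) diag_projE.
transitivity (f ∘ (fmor F (sym M M) ∘ p (M ⊗ M : DY))); first by rewrite catA.
by rewrite FminusE catA diag_projE /=; dia (hopf_rules hH hc).
Qed.

Lemma diag_hopf : hopfMor (H := A) (H' := H) f.
Proof.
by split; [exact: diag_mul|exact: diag_one|exact: diag_comul|exact: diag_counit|exact: diag_antip].
Qed.

Lemma diag_cobr : (f ⊠ f) ∘ cobr A = cobr H ∘ f.
Proof.
pose X := cF2 (Fminus_comonoidal good H) (M ⊗ M) (M ⊗ M)
    ∘ fmor F (mid M M (sym M M ∘ tinf M M) ∘ (cm_comul cM ⊠ cm_comul cM)).
have e : (f ⊠ f) ∘ X = cobr H ∘ f.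
  apply: epi; rewrite -(catA (cobr H)) diag_projE -(catA (f ⊠ f)) /X diag_pair /=.
  rewrite /triple_t /=.
  by dia (lower_rules H, antip_cobr_rules H).
rewrite -[RHS]half_double //.
have -> : cobr A = 2%:R^-1 *: ((idm _ - sym _ _) ∘ X) by rewrite /X fmor_comp.
rewrite compZr; congr (_ *: _).
rewrite compBl comp1m compBr (catA _ (sym _ _)) -sym_nat -catA e catA sym_cobr.
by rewrite compNl opprK.
Qed.

Lemma diag_antipK : isInverse (antip A) (antipi A).
Proof. by split; rewrite -fmor_comp (symK M M) fmor1. Qed.

Lemma Fminus_diag : isCoPoissonHopf A /\ coPoissonHopf_iso A H.
Proof.
have fg := coinv_lK good M.
split; first refine (@isCoPoissonHopf_iso K C A H f _ fg diag_hopf diag_cobr diag_antipK).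
by exists f, (p (M ⊗ M : DY) ∘ split_l N); split=> //; [exact: diag_hopf|exact: diag_cobr].
Qed.

End FminusHopf.

(** * Commutative Hopf monoids *)

Section CommutativeHopf.
Variables (R : comPzRingType) (C : symMonCat R) (H : hopfData C).
Hypotheses (hH : isHopf H) (hc : mul H ∘ sym H H = mul H).

Lemma mul_swap3 : mul H ∘ (idm H ⊠ mul H) ∘ swap12 H H H = mul H ∘ (idm H ⊠ mul H).
Proof.
transitivity ((mul H ∘ (mul H ⊠ idm H)) ∘ (sym H H ⊠ idm H) ∘ associ H H H).
  by rewrite (mulA hH); dia tt.
transitivity ((mul H ∘ ((mul H ∘ sym H H) ⊠ idm H)) ∘ associ H H H); first by dia tt.
by rewrite hc (mulA hH); dia tt.
Qed.

Definition mul_rules :=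
  (mulA hH, mul1l hH, mul1r hH, (hc, Sort_in 1 0), (mul_swap3, Sort_in 1 0)).

Definition bialgc_rules :=
  (mul_rules, comulA hH, counitl hH, counitr hH, comul_mul hH, comul_one hH,
   counit_mul hH, counit_one hH).

Lemma cancel_comulV : (mul H ⊠ idm H) ∘ associ _ _ _ ∘ (idm H ⊠ ((antip H ⊠ idm H) ∘ comul H)) ∘ comul H
  = (one H ⊠ idm H) ∘ luniti _.
Proof.
transitivity (((mul H ∘ (idm H ⊠ antip H) ∘ comul H) ⊠ idm H) ∘ comul H).
  dia (comulA hH).
by rewrite (antipr hH); dia (counitl hH).
Qed.

Lemma cancel_Vcomul : (mul H ⊠ idm H) ∘ associ _ _ _ ∘ (antip H ⊠ comul H) ∘ comul H
  = (one H ⊠ idm H) ∘ luniti _.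
Proof.
transitivity (((mul H ∘ (antip H ⊠ idm H) ∘ comul H) ⊠ idm H) ∘ comul H).
  dia (comulA hH).
by rewrite (antipl hH); dia (counitl hH).
Qed.

Lemma mulA_rev : mul H ∘ (idm H ⊠ mul H) = mul H ∘ (mul H ⊠ idm H) ∘ associ _ _ _.
Proof. by rewrite catA (mulA hH); dia tt. Qed.

Definition cancelc_rules := ((antipl hH, Cancel), (antipr hH, Cancel),
  (cancel_comulV, Cancel), (cancel_Vcomul, Cancel), (mulA_rev, Enables)).

(** The roles are exchanged with respect to the cocommutative case: the flip stays here and
    disappears from [antip_mulc]. *)
Lemma comul_antipc : comul H ∘ antip H = (antip H ⊠ antip H) ∘ sym H H ∘ comul H.
Proof.
pose X := (antip H ⊠ antip H) ∘ sym H H ∘ comul H.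
transitivity (mul2 H ∘ ((comul H ∘ antip H) ⊠ (mul2 H ∘ (comul H ⊠ X) ∘ comul H)) ∘ comul H).
  by rewrite /X; dia (bialgc_rules, cancelc_rules).
transitivity (mul2 H ∘ ((comul H ∘ mul H ∘ (antip H ⊠ idm H) ∘ comul H) ⊠ X) ∘ comul H).
  by rewrite /X; dia (bialgc_rules).
by rewrite /X; dia (antipl hH, bialgc_rules).
Qed.

Lemma antip_mulc : antip H ∘ mul H = mul H ∘ (antip H ⊠ antip H).
Proof.
pose X := mul H ∘ (antip H ⊠ antip H).
transitivity (mul H ∘ ((antip H ∘ mul H) ⊠ (mul H ∘ (mul H ⊠ X) ∘ comul2 H)) ∘ comul2 H).
  by rewrite /X; dia (bialgc_rules, cancelc_rules).
transitivity (mul H ∘ ((mul H ∘ (antip H ⊠ idm H) ∘ comul H ∘ mul H) ⊠ X) ∘ comul2 H).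
  by rewrite /X; dia (bialgc_rules).
by rewrite /X; dia (antipl hH, bialgc_rules).
Qed.

Lemma antipKc : antip H ∘ antip H = idm H.
Proof.
transitivity (mul H ∘ ((mul H ∘ ((antip H ∘ antip H) ⊠ antip H) ∘ comul H) ⊠ idm H) ∘ comul H).
  by dia (cancelc_rules, bialgc_rules).
have -> : mul H ∘ ((antip H ∘ antip H) ⊠ antip H) ∘ comul H =
    antip H ∘ mul H ∘ (antip H ⊠ idm H) ∘ comul H by dia antip_mulc.
by dia (antipl hH, bialgc_rules, antip_one hH).
Qed.

Lemma antipi_antipc : antipi H = antip H.
Proof. by rewrite -[LHS]compm1 -antipKc catA (invl (antip_inv hH)) comp1m. Qed.

Definition hopfc_rules := (cancelc_rules, bialgc_rules, antip_mulc, antip_one hH,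
  counit_antip hH, comul_antipc, antipKc, antipi_antipc).

Section Coaction.
Variables (V : C) (d : Mor V (V ⊗ H)).
Hypotheses (dA : assoc _ _ _ ∘ (d ⊠ idm H) ∘ d = (idm V ⊠ comul H) ∘ d)
  (d1 : runit V ∘ (idm V ⊠ counit H) ∘ d = idm V).

Lemma cancel_coactV : (idm V ⊠ mul H) ∘ assoc _ _ _ ∘ (((idm V ⊠ antip H) ∘ d) ⊠ idm H) ∘ d
  = (idm V ⊠ one H) ∘ runiti _.
Proof.
transitivity ((idm V ⊠ (mul H ∘ (antip H ⊠ idm H))) ∘ (idm V ⊠ comul H) ∘ d).
  by rewrite -dA; dia tt.
transitivity ((idm V ⊠ (mul H ∘ (antip H ⊠ idm H) ∘ comul H)) ∘ d); first by dia tt.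
by rewrite (antipl hH); dia d1.
Qed.

Lemma cancel_Vcoact : (idm V ⊠ mul H) ∘ assoc _ _ _ ∘ (d ⊠ antip H) ∘ d
  = (idm V ⊠ one H) ∘ runiti _.
Proof.
transitivity ((idm V ⊠ (mul H ∘ (idm H ⊠ antip H))) ∘ (idm V ⊠ comul H) ∘ d).
  by rewrite -dA; dia tt.
transitivity ((idm V ⊠ (mul H ∘ (idm H ⊠ antip H) ∘ comul H)) ∘ d); first by dia tt.
by rewrite (antipr hH); dia d1.
Qed.

Lemma coactA : (idm V ⊠ comul H) ∘ d = assoc _ _ _ ∘ (d ⊠ idm H) ∘ d.
Proof. by rewrite dA. Qed.

Definition coact_rules := ((cancel_coactV, Cancel), (cancel_Vcoact, Cancel), coactA, d1).

End Coaction.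

End CommutativeHopf.

(** * Drinfeld-Yetter modules of a Poisson Hopf monoid *)

Section Upper.
Variables (R : comPzRingType) (C : symMonCat R) (H : poissonHopf C).
Let hH := po_isHopf (po_ax H).
Let hc := po_comm (po_ax H).

Lemma br_sym : br H ∘ sym H H = - br H.
Proof. by apply/eqP; rewrite -addr_eq0 addrC; apply/eqP/(br_anti (po_ax H)). Qed.

Lemma br_mulr : br H ∘ (idm H ⊠ mul H) =
  mul H ∘ (br H ⊠ idm H) ∘ associ H H H + mul H ∘ (idm H ⊠ br H) ∘ swap12 H H H.
Proof.
transitivity (- (br H ∘ (mul H ⊠ idm H) ∘ sym H (H ⊗ H))).
  by rewrite -[br H in LHS]opprK -br_sym; dia tt.
rewrite [br H ∘ _ ∘ _]catA (br_mul (po_ax H)); dia (mul_rules hH hc, (br_sym, Sort_in 1 0)).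
Qed.

Lemma br_oner : br H ∘ (idm H ⊠ one H) = 0.
Proof.
transitivity (- ((br H ∘ (one H ⊠ idm H)) ∘ sym _ _)).
  by rewrite -[br H in LHS]opprK -br_sym; dia tt.
by rewrite (br_one (po_ax H)) comp0m oppr0.
Qed.

Definition upper_rules := (hopfc_rules hH hc, (br_sym, Sort_in 1 0),
  br_mul (po_ax H), br_mulr, br_comul (po_ax H), br_one (po_ax H),
  br_counit (po_ax H), br_oner).

Section Module.
Variables (V : triple H) (hV : isUpperDY V).

(** The action is a derivation at eps in its first argument, so 1 = 1 1 gives 1 . v = 1 . v + 1 .
    v. *)
Lemma act_one : act V ∘ (one H ⊠ idm V) = 0.
Proof.
have e : act V ∘ (one H ⊠ idm V) = act V ∘ (one H ⊠ idm V) + act V ∘ (one H ⊠ idm V).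
  transitivity ((act V ∘ (mul H ⊠ idm V)) ∘ (((one H ⊠ one H) ∘ luniti _) ⊠ idm V)).
    by dia (mul1l hH).
  by rewrite (udy_act_mul hV); dia (counit_one hH).
by apply: (addrI (act V ∘ (one H ⊠ idm V))); rewrite addr0 -e.
Qed.

(** The same derivation rule applied to S(p_1) p_2 = eps(p) 1 gives S(p) . v + p . v = eps(p) 1 . v,
    which vanishes by [act_one]. *)
Lemma act_antip : act V ∘ (antip H ⊠ idm V) = - act V.
Proof.
apply/eqP; rewrite -addr_eq0; apply/eqP.
transitivity ((act V ∘ (mul H ⊠ idm V)) ∘ (((antip H ⊠ idm H) ∘ comul H) ⊠ idm V)).
  by rewrite (udy_act_mul hV); dia (counit_antip hH, counitl hH, counitr hH).
by dia (antipl hH, act_one).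
Qed.

Definition comodule_rules := (coact_rules hH (udy_coact_comul hV) (udy_coact_counit hV),
  udy_coact_act hV, udy_act_br hV, udy_act_mul hV, act_one, act_antip).

End Module.

Lemma upper_unitP : isUpperDY (sp_unit (upperDYspec H)).
Proof. by split; rewrite /twisted_coact /mul_antipi /=; dia upper_rules. Qed.

Lemma upper_tensP (V W : triple H) : isUpperDY V -> isUpperDY W ->
  isUpperDY (sp_tens (S := upperDYspec H) V W).
Proof.
by move=> hV hW; split; rewrite /twisted_coact /mul_antipi /=;
  dia (upper_rules, comodule_rules hV, comodule_rules hW).
Qed.

Local Notation spec := (upperDYspec H).
Local Notation "V ⊙ W" := (sp_tens (S := spec) V W) (at level 32, left associativity).

Lemma upper_tensmP (V V' W W' : triple H) (f : Mor V V') (g : Mor W W') :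
  isTripleMor f -> isTripleMor g ->
  isTripleMor (V := V ⊙ W) (W := V' ⊙ W') (f ⊠ g).
Proof.
by move=> hf hg; apply: isTripleMorP; rewrite /=; dia (mor_rules hf, mor_rules hg).
Qed.

Lemma upper_assocP (U V W : triple H) :
  isTripleMor (V := (U ⊙ V) ⊙ W) (W := U ⊙ (V ⊙ W)) (assoc U V W).
Proof. by apply: isTripleMorP; rewrite /=; dia (mulA hH). Qed.

Lemma upper_associP (U V W : triple H) :
  isTripleMor (V := U ⊙ (V ⊙ W)) (W := (U ⊙ V) ⊙ W) (associ U V W).
Proof. by apply: isTripleMorP; rewrite /=; dia (mulA hH). Qed.

Lemma upper_lunitP (V : triple H) :
  isTripleMor (V := sp_unit spec ⊙ V) (W := V) (lunit V).
Proof. by apply: isTripleMorP; rewrite /=; dia (mul1l hH). Qed.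

Lemma upper_lunitiP (V : triple H) :
  isTripleMor (V := V) (W := sp_unit spec ⊙ V) (luniti V).
Proof. by apply: isTripleMorP; rewrite /=; dia (mul1l hH). Qed.

Lemma upper_runitP (V : triple H) :
  isTripleMor (V := V ⊙ sp_unit spec) (W := V) (runit V).
Proof. by apply: isTripleMorP; rewrite /=; dia (mul1r hH). Qed.

Lemma upper_runitiP (V : triple H) :
  isTripleMor (V := V) (W := V ⊙ sp_unit spec) (runiti V).
Proof. by apply: isTripleMorP; rewrite /=; dia (mul1r hH). Qed.

Lemma upper_symP (V W : triple H) :
  isTripleMor (V := V ⊙ W) (W := W ⊙ V) (sym V W).
Proof. by apply: isTripleMorP; rewrite /=; dia ((hc, Sort_in 1 0)). Qed.

Lemma upper_tP (V W : triple H) : isUpperDY V -> isUpperDY W ->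
  isTripleMor (V := V ⊙ W) (W := V ⊙ W) (triple_t V W).
Proof.
by move=> hV hW; apply: isTripleMorP; rewrite /=;
  dia (upper_rules, comodule_rules hV, comodule_rules hW).
Qed.

(** The first term of t splits by the Leibniz action on V ⊗ W; the second because the product v_1
    w_1 acts on U by the derivation rule [udy_act_mul]. *)
Lemma upper_t_tens (U V W : triple H) : isUpperDY U -> isUpperDY V -> isUpperDY W ->
  triple_t U (V ⊙ W) =
    assoc U V W ∘ (triple_t U V ⊠ idm W) ∘ associ U V W
    + assoc U V W ∘ (sym V U ⊠ idm W) ∘ associ V U W
        ∘ (idm V ⊠ triple_t U W)
        ∘ assoc V U W ∘ (sym U V ⊠ idm W) ∘ associ U V W.
Proof.
move=> hU hV hW; rewrite /triple_t /=.
dia (udy_act_mul hU, udy_coact_counit hV, udy_coact_counit hW).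
Qed.

Lemma upper_spec : isCartierSpec spec.
Proof.
split.
- exact: upper_unitP.
- by move=> V W; apply: upper_tensP (sp_tripleP V) (sp_tripleP W).
- by move=> V V' W W' f g; apply: upper_tensmP (tmorP f) (tmorP g).
- by move=> *; apply: upper_assocP.
- by move=> *; apply: upper_associP.
- by move=> *; apply: upper_lunitP.
- by move=> *; apply: upper_lunitiP.
- by move=> *; apply: upper_runitP.
- by move=> *; apply: upper_runitiP.
- by move=> *; apply: upper_symP.
- by move=> V W; apply: upper_tP (sp_tripleP V) (sp_tripleP W).
- by move=> V V' W W' f g; apply: triple_t_nat (tmorP f) (tmorP g).
- by move=> *; apply: triple_t_sym.
by move=> U V W; apply: upper_t_tens (sp_tripleP U) (sp_tripleP V) (sp_tripleP W).
Qed.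

End Upper.

(** * The Drinfeld-Yetter module [P_+] and its monoid structure *)

Section Pplus.
Variables (R : comPzRingType) (C : symMonCat R) (H : poissonHopf C).
Let hH := po_isHopf (po_ax H).
Let hc := po_comm (po_ax H).

Lemma pplus_mul : isTripleMor
    (V := sp_tens (S := upperDYspec H) (Pplus_triple H) (Pplus_triple H))
    (W := Pplus_triple H) (mul H).
Proof. by apply: isTripleMorP; rewrite /=; dia (upper_rules H). Qed.

Lemma pplus_one : isTripleMor (V := sp_unit (upperDYspec H)) (W := Pplus_triple H) (one H).
Proof. by apply: isTripleMorP; rewrite /=; dia (upper_rules H). Qed.

(** The Jacobi identity solved for one term, so that it has a single diagram on the left and can
    serve as a rule. *)
Lemma br_br : br H ∘ (idm H ⊠ br H) =
  br H ∘ (br H ⊠ idm H) ∘ associ _ _ _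
  - br H ∘ (br H ⊠ idm H) ∘ swap23 H H H ∘ associ _ _ _.
Proof.
apply/eqP; rewrite -subr_eq0 -(br_jacobi (po_ax H)); apply/eqP.
by dia ((br_sym H, Sort_in 1 0)).
Qed.

(** The antipode axiom at {p, q} gives eps({p, q}) 1 = 0. Expanding Delta{p, q} in it and
    multiplying by S(p_3 q_3) isolates S{p, q}. *)
Lemma br_antipE : antip H ∘ br H = - (mul H ∘
  ((mul H ∘ ((antip H ∘ mul H) ⊠ br H) ∘ comul2 H) ⊠ (antip H ∘ mul H)) ∘ comul2 H).
Proof.
apply/eqP; rewrite -addr_eq0; apply/eqP.
transitivity (mul H ∘ ((mul H ∘ (antip H ⊠ idm H) ∘
   ((br H ⊠ mul H) ∘ comul2 H + (mul H ⊠ br H) ∘ comul2 H))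
   ⊠ (antip H ∘ mul H)) ∘ comul2 H).
  by dia (upper_rules H).
by rewrite -(br_comul (po_ax H)); dia (upper_rules H).
Qed.

(* {S(p), q} = - S(p_1) {p_2, q} S(p_3) *)
Lemma br_antipl : br H ∘ (antip H ⊠ idm H) =
  - (mul H ∘ ((mul H ∘ (antip H ⊠ br H) ∘ assoc _ _ _ ∘ (comul H ⊠ idm H)) ⊠ antip H)
  ∘ swap23 H H H ∘ (comul H ⊠ idm H)).
Proof.
apply/eqP; rewrite -addr_eq0; apply/eqP.
transitivity (mul H ∘ (((br H ∘ (mul H ⊠ idm H)) ∘
     (((antip H ⊠ idm H) ∘ comul H) ⊠ idm H)) ⊠ antip H) ∘ swap23 H H H ∘ (comul H ⊠ idm H)).
  by rewrite (br_mul (po_ax H)); dia (upper_rules H).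
by dia (upper_rules H).
Qed.

Lemma br_antipr : br H ∘ (idm H ⊠ antip H) =
  - (mul H ∘ ((mul H ∘ (antip H ⊠ br H) ∘ swap12 _ _ _ ∘ (idm H ⊠ comul H)) ⊠ antip H)
  ∘ associ _ _ _ ∘ (idm H ⊠ comul H)).
Proof.
transitivity (- ((br H ∘ (antip H ⊠ idm H)) ∘ sym H H)).
  by dia ((br_sym H, Sort_in 1 0)).
by rewrite br_antipl; dia (mul_rules hH hc, (br_sym H, Sort_in 1 0)).
Qed.

Definition antip_br_rules := (br_antipE, br_antipl, br_antipr).

Lemma pplusP : isUpperDY (Pplus_triple H).
Proof.
split; rewrite /twisted_coact /mul_antipi /=.
- dia (comulA hH).
- dia (counitr hH).
- dia (upper_rules H, antip_br_rules, br_br).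
- dia (upper_rules H).
dia (upper_rules H).
Qed.

Lemma upper_monoid : isUpperMonoid H.
Proof. by split; [exact: pplusP|exact: pplus_mul|exact: pplus_one]. Qed.

End Pplus.

(** * Transport of Poisson Hopf structures *)

Section PoissonTransport.
Variables (R : comPzRingType) (C : symMonCat R).

(** Kernels are mapped into, so the comparison is verified for [g] from H to the invariants, while
    transport asks for a map in the other direction. *)
Lemma hopfMor_inv (H H' : hopfData C) (f : Mor H H') (g : Mor H' H) :
  isInverse f g -> hopfMor g -> hopfMor f.
Proof.
move=> fg gm; have gf : isInverse g f by split; [exact: invr fg|exact: invl fg].
by split; dia (iso_rules gf gm).
Qed.

Lemma isPoissonHopf_iso (H' : poissonData C) (H : poissonHopf C) (f : Mor H' H) (g : Mor H H') :
  isInverse f g -> hopfMor f -> f ∘ br H' = br H ∘ (f ⊠ f) ->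
  isInverse (antip H') (antipi H') -> isPoissonHopf H'.
Proof.
move=> fg fm fd si; have aH := po_ax H.
have ed : br H' = g ∘ br H ∘ (f ⊠ f) by rewrite -fd catA (invl fg) comp1m.
split; first exact: isHopf_iso fg fm si (po_isHopf aH).
- by dia (iso_rules fg fm, (po_comm aH, Sort_in 1 0)).
- by dia (iso_rules fg fm, ed, (br_sym H, Sort_in 1 0)).
- transitivity (g ∘ (br H ∘ (idm H ⊠ br H)
    + br H ∘ (idm H ⊠ br H) ∘ cyc H H H
    + br H ∘ (idm H ⊠ br H) ∘ cyc H H H ∘ cyc H H H) ∘ (f ⊠ (f ⊠ f))).
    by dia (iso_rules fg fm, ed).
  by rewrite (br_jacobi aH) comp0m compm0.
- by dia (iso_rules fg fm, ed, br_mul aH).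
- by dia (iso_rules fg fm, ed, br_comul aH).
- by dia (iso_rules fg fm, ed, br_counit aH).
by dia (iso_rules fg fm, ed, br_one aH).
Qed.

End PoissonTransport.

(** * The functor of invariants *)

Section Factor.
Variables (R : comPzRingType) (C : symMonCat R).

Section Fixed.
Variables (X Y N : C) (f : Mor X Y) (i : Mor N X).
Hypothesis fi : isKer f i.

Lemma factor_ex Z (g : Mor Z X) : f ∘ g = 0 -> exists h : Mor Z N, i ∘ h == g.
Proof. by case/(proj2 fi) => h [e _]; exists h; apply/eqP. Qed.

Definition factor Z (g : Mor Z X) (e : f ∘ g = 0) : Mor Z N := xchoose (factor_ex e).

Lemma factorE Z (g : Mor Z X) (e : f ∘ g = 0) : i ∘ factor e = g.
Proof. exact/eqP/(xchooseP (factor_ex e)). Qed.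

Lemma ker_mono Z (g h : Mor Z N) : i ∘ g = i ∘ h -> g = h.
Proof.
move=> e; have e0 : f ∘ (i ∘ g) = 0 by rewrite catA (proj1 fi) comp0m.
by have [k [_ u]] := proj2 fi _ _ e0; rewrite -(u g) // -(u h) // -e.
Qed.

End Fixed.

Variable good : kGoodEnough C.

End Factor.

Section Fplus.
Variables (R : comPzRingType) (C : symMonCat R) (good : kGoodEnough C).
Variable H : poissonHopf C.
Let hH := po_isHopf (po_ax H).
Let hc := po_comm (po_ax H).
Local Notation spec := (upperDYspec H).
Local Notation DY := (upperDY (upper_spec H)).
Local Notation "V ⊙ W" := (sp_tens (S := spec) V W) (at level 32, left associativity).
Local Notation Fo := (Fplus_ob good).
Local Notation i := (Fplus_incl good).

Lemma incl_ker (V : triple H) : isKer (Fplus_rel V) (i V).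
Proof. exact: kerP. Qed.

Lemma coact_incl (V : triple H) : coact V ∘ i V = (idm V ⊠ one H) ∘ runiti V ∘ i V.
Proof.
apply/eqP; rewrite -subr_eq0 (catA (idm V ⊠ _)) -compBl; apply/eqP.
exact: proj1 (incl_ker V).
Qed.

Lemma invariant_rel (V : triple H) Z (g : Mor Z V) :
  coact V ∘ g = (idm V ⊠ one H) ∘ runiti V ∘ g -> Fplus_rel V ∘ g = 0.
Proof. by move=> e; rewrite /Fplus_rel compBl e catA subrr. Qed.

Lemma Fplus_mor_invariant (V W : triple H) (f : Mor V W) : isTripleMor f ->
  Fplus_rel W ∘ (f ∘ i V) = 0.
Proof.
move=> hf; apply: invariant_rel; rewrite catA (triple_mor_coact hf) -catA coact_incl.
by dia tt.
Qed.

Definition Fplus_mor (V W : triple H) (f : Mor V W) (hf : isTripleMor f) :=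
  factor (incl_ker W) (Fplus_mor_invariant hf).

Lemma Fplus_morE (V W : triple H) (f : Mor V W) (hf : isTripleMor f) :
  i W ∘ Fplus_mor hf = f ∘ i V.
Proof. exact: factorE. Qed.

Definition Fplus : @functor R DY C (fun V => Fo V).
Proof.
refine (@Functor R DY C (fun V => Fo V) (fun V W f => Fplus_mor (tmorP f)) _ _).
- move=> X; apply: (ker_mono (incl_ker X)).
  by rewrite Fplus_morE comp1m compm1.
- move=> X Y Z g f; apply: (ker_mono (incl_ker Z)).
  by rewrite catA !Fplus_morE -!catA Fplus_morE.
Defined.

Lemma FplusE (V W : DY) (f : Mor V W) : i W ∘ fmor Fplus f = tmor f ∘ i V.
Proof. exact: Fplus_morE. Qed.

Lemma mF2_invariant (V W : DY) : Fplus_rel (V ⊗ W : DY) ∘ (i V ⊠ i W) = 0.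
Proof. by apply: invariant_rel => /=; dia (coact_incl V, coact_incl W, mul1l hH). Qed.

Lemma mF0_invariant : Fplus_rel (tunit : DY) ∘ idm tunit = 0.
Proof. by apply: invariant_rel => /=; dia tt. Qed.

Definition Fplus2 (V W : DY) := factor (incl_ker (V ⊗ W : DY)) (mF2_invariant V W).
Definition Fplus0 := factor (incl_ker (tunit : DY)) mF0_invariant.

Lemma Fplus2E (V W : DY) : i (V ⊗ W : DY) ∘ Fplus2 V W = i V ⊠ i W.
Proof. exact: factorE. Qed.

Lemma Fplus0E : i (tunit : DY) ∘ Fplus0 = idm tunit.
Proof. exact: factorE. Qed.

Definition Fplus_monoidal : @monoidal R DY (trivialCartier C) (fun V => Fo V) Fplus.
Proof.
refine (@Monoidal R DY (trivialCartier C) (fun V => Fo V) Fplus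
  (fun V W => Fplus2 V W) Fplus0 _ _ _ _).
- move=> X Y X' Y' f g; apply: (ker_mono (incl_ker (X' ⊗ Y' : DY))).
  rewrite catA FplusE -catA Fplus2E catA Fplus2E -!tensm_comp.
  by rewrite !FplusE.
- move=> X Y Z; apply: (ker_mono (incl_ker (X ⊗ (Y ⊗ Z) : DY))).
  rewrite !catA FplusE -!catA (eqA1 _ (Fplus2E (X ⊗ Y) Z)).
  rewrite (eqA1 _ (Fplus2E X (Y ⊗ Z))) -tensm_comp !compm1.
  rewrite (catA (i X ⊠ _)) -!tensm_comp !Fplus2E !compm1.
  by rewrite assoc_nat.
- move=> X; apply: (ker_mono (incl_ker X)).
  rewrite !catA FplusE -!catA (eqA1 _ (Fplus2E tunit X)) -tensm_comp Fplus0E compm1.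
  by rewrite lunit_nat.
- move=> X; apply: (ker_mono (incl_ker X)).
  rewrite !catA FplusE -!catA (eqA1 _ (Fplus2E X tunit)) -tensm_comp Fplus0E compm1.
  by rewrite runit_nat.
Defined.

Lemma Fplus_inf_braided : @monoidal_inf_braided R DY (trivialCartier C)
  (fun V => Fo V) Fplus Fplus_monoidal.
Proof.
split=> X Y; apply: (ker_mono (incl_ker (_ ⊗ _ : DY))).
  rewrite catA FplusE -catA Fplus2E catA Fplus2E.
  by rewrite sym_nat.
rewrite [RHS]catA FplusE -[RHS]catA Fplus2E /= !compm0.
by dia (coact_incl X, coact_incl Y, act_one (sp_tripleP X), act_one (sp_tripleP Y)).
Qed.

Local Notation N := (Pplus_triple H).
Local Notation A := (Pplus (upper_spec H) (upper_monoid H)).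

Lemma mul_sym_A : mo_mul A ∘ sym (A : DY) A = mo_mul A.
Proof. by apply/val_inj; exact: hc. Qed.

Lemma mul_tinf_A : mo_mul A ∘ tinf (A : DY) A = 0.
Proof.
apply/val_inj => /=; rewrite /triple_t /=.
by dia (upper_rules H, antip_br_rules H).
Qed.

(* V ⊗ P_+ is cofree over P, so its invariants are V, by v |-> v_0 ⊗ S(v_1). *)
Definition cofree_r (V : triple H) : Mor V (V ⊗ H) := (idm V ⊠ antip H) ∘ coact V.
Definition cofree_l (V : triple H) : Mor V (H ⊗ V) := (antip H ⊠ idm V) ∘ sym V H ∘ coact V.
Definition drop_r (V : triple H) : Mor (V ⊗ H) V := runit V ∘ (idm V ⊠ counit H).
Definition drop_l (V : triple H) : Mor (H ⊗ V) V := lunit V ∘ (counit H ⊠ idm V).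

Lemma drop_r_nat (V W : triple H) (f : Mor V W) : drop_r W ∘ (f ⊠ idm H) = f ∘ drop_r V.
Proof. by rewrite /drop_r; dia tt. Qed.

Section Cofree.
Variables (V : triple H) (hV : isUpperDY V).
Local Notation rules := (hopfc_rules hH hc, coact_rules hH (udy_coact_comul hV) (udy_coact_counit hV)).

Lemma cofree_l_invariant : Fplus_rel (N ⊙ V) ∘ cofree_l V = 0.
Proof. by apply: invariant_rel; rewrite /cofree_l /=; dia rules. Qed.

Lemma cofree_r_invariant : Fplus_rel (V ⊙ N) ∘ cofree_r V = 0.
Proof. by apply: invariant_rel; rewrite /cofree_r /=; dia rules. Qed.

Lemma drop_cofree_r : drop_r V ∘ cofree_r V = idm V.
Proof. by rewrite /drop_r /cofree_r; dia rules. Qed.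

(** Dual to [proj_free_l]: [X ∘ coact] is evaluated in two ways. On an invariant the new factor is 1
    and [cofree_l V ∘ drop_l V] remains; in general S(v_1) cancels against the coaction of v. *)
Lemma cofree_incl_l : cofree_l V ∘ drop_l V ∘ i (N ⊙ V) = i (N ⊙ V).
Proof.
pose X := (mul H ⊠ idm V) ∘ associ _ _ _ ∘ (idm H ⊠ sym _ _) ∘ assoc _ _ _
  ∘ ((cofree_l V ∘ drop_l V) ⊠ idm H).
transitivity (X ∘ coact (N ⊙ V) ∘ i (N ⊙ V)); rewrite {}/X /cofree_l /drop_l.
  by rewrite coact_incl; dia rules.
by rewrite /=; dia rules.
Qed.

Lemma cofree_incl_r : cofree_r V ∘ drop_r V ∘ i (V ⊙ N) = i (V ⊙ N).
Proof.
pose X := (idm V ⊠ mul H) ∘ assoc _ _ _ ∘ ((cofree_r V ∘ drop_r V) ⊠ idm H).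
transitivity (X ∘ coact (V ⊙ N) ∘ i (V ⊙ N)); rewrite {}/X /cofree_r /drop_r.
  by rewrite coact_incl; dia rules.
by rewrite /=; dia rules.
Qed.

End Cofree.

(** Here k is x ⊗ p ⊗ y |-> eps(p) x_0 ⊗ S(x_1) S(y_1) ⊗ y_0, and [T] multiplies the coaction into
    the middle factor after k. On an invariant this leaves k; in general the antipodes cancel and
    the identity results. *)
Lemma mid_incl (X Y : triple H) (hX : isUpperDY X) (hY : isUpperDY Y) :
  mergem X Y (mul H) ∘ (cofree_r X ⊠ cofree_l Y) ∘ dropm X Y (counit H) ∘ i (X ⊙ N ⊙ Y)
  = i (X ⊙ N ⊙ Y).
Proof.
pose k := mergem X Y (mul H) ∘ (cofree_r X ⊠ cofree_l Y) ∘ dropm X Y (counit H).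
pose T := ((idm X ⊠ mul H) ⊠ idm Y) ∘ (assoc _ _ _ ⊠ idm Y) ∘ swap23 _ _ _ ∘ (k ⊠ idm H).
transitivity (T ∘ coact (X ⊙ N ⊙ Y) ∘ i (X ⊙ N ⊙ Y)); rewrite {}/T {}/k /cofree_r /cofree_l.
  by rewrite coact_incl; dia (hopfc_rules hH hc).
by rewrite /=; dia (hopfc_rules hH hc, coact_rules hH (udy_coact_comul hX) (udy_coact_counit hX),
  coact_rules hH (udy_coact_comul hY) (udy_coact_counit hY)).
Qed.

Lemma incl_N : one H ∘ counit H ∘ i N = i N.
Proof.
transitivity (lunit _ ∘ (counit H ⊠ idm H) ∘ coact N ∘ i N).
  by rewrite coact_incl; dia (counit_one hH).
by rewrite /=; dia (counitl hH).
Qed.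

Definition inv_l (V : DY) : Mor (tr_ob V) (Fo (A ⊗ V : DY)) :=
  factor (incl_ker (N ⊙ V)) (cofree_l_invariant (sp_tripleP V)).
Definition inv_r (V : DY) : Mor (tr_ob V) (Fo (V ⊗ A : DY)) :=
  factor (incl_ker (V ⊙ N)) (cofree_r_invariant (sp_tripleP V)).

Lemma inv_lE (V : DY) : i (A ⊗ V : DY) ∘ inv_l V = cofree_l V.
Proof. exact: factorE. Qed.

Lemma inv_rE (V : DY) : i (V ⊗ A : DY) ∘ inv_r V = cofree_r V.
Proof. exact: factorE. Qed.

Lemma inv_rK (V : DY) : isInverse (drop_r V ∘ i (V ⊗ A : DY)) (inv_r V).
Proof.
split; last by rewrite -catA inv_rE; exact: drop_cofree_r (sp_tripleP V).
apply: (ker_mono (incl_ker (V ⊗ A : DY))).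
by rewrite catA inv_rE compm1; exact: cofree_incl_r (sp_tripleP V).
Qed.

Lemma Fplus_cofree : naturally_isomorphic (functor_comp Fplus (tens_right (A : DY)))
  (forget (upper_spec H)).
Proof.
exists (fun V : DY => drop_r V ∘ i (V ⊗ A : DY)), inv_r; split; first exact: inv_rK.
move=> X Y f; rewrite -catA.
transitivity (drop_r Y ∘ (tmor f ⊠ idm H) ∘ i (X ⊗ A : DY)).
  by congr (_ ∘ _); exact: (FplusE (f ⊠ idm (A : DY))).
by rewrite catA (drop_r_nat (tmor f)) -catA.
Qed.

Lemma theta_inv : isInverse (coad_theta Fplus_monoidal A) (counit H ∘ i (A : DY)).
Proof.
have e : i (A : DY) ∘ coad_theta Fplus_monoidal A = one H.
  by rewrite catA (FplusE (mo_one A)) -catA Fplus0E compm1.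
split; first by rewrite -catA e (counit_one hH).
apply: (ker_mono (incl_ker (A : DY))).
by rewrite catA e compm1; exact: incl_N.
Qed.

Definition psi_inv (X Y : DY) := (inv_r X ⊠ inv_l Y) ∘ dropm (tr_ob X) (tr_ob Y) (counit H)
  ∘ i (X ⊗ A ⊗ Y : DY).

Lemma psiE (X Y : DY) : i (X ⊗ A ⊗ Y : DY) ∘ coad_psi Fplus_monoidal A X Y =
  mergem (tr_ob X) (tr_ob Y) (mul H) ∘ (i (X ⊗ A : DY) ⊠ i (A ⊗ Y : DY)).
Proof.
by rewrite catA (FplusE (mergem X Y (mo_mul A))) -catA (Fplus2E (X ⊗ A) (A ⊗ Y)).
Qed.

Lemma psi_invP (X Y : DY) : isInverse (coad_psi Fplus_monoidal A X Y) (psi_inv X Y).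
Proof.
split; last first.
  apply: (ker_mono (incl_ker (X ⊗ A ⊗ Y : DY))).
  rewrite catA psiE /psi_inv -catA (catA (_ ⊠ _) (_ ⊠ _)) -tensm_comp inv_rE inv_lE compm1.
  by exact: mid_incl (sp_tripleP X) (sp_tripleP Y).
transitivity ((inv_r X ⊠ inv_l Y) ∘ dropm (tr_ob X) (tr_ob Y) (counit H) ∘
  mergem (tr_ob X) (tr_ob Y) (mul H) ∘ (i (X ⊗ A : DY) ⊠ i (A ⊗ Y : DY))).
  by rewrite -psiE /psi_inv -!catA.
transitivity ((inv_r X ∘ (drop_r X ∘ i (X ⊗ A : DY))) ⊠ (inv_l Y ∘ (drop_l Y ∘ i (A ⊗ Y : DY)))).
  by rewrite /drop_l /drop_r; dia (counit_mul hH).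
rewrite (invl (inv_rK X)).
have -> : inv_l Y ∘ (drop_l Y ∘ i (A ⊗ Y : DY)) = idm _.
  apply: (ker_mono (incl_ker (A ⊗ Y : DY))).
  by rewrite catA (inv_lE Y) compm1; exact: cofree_incl_l (sp_tripleP Y).
by rewrite tensm1.
Qed.

Definition Fplus_coadapted : coadapted Fplus_monoidal A := Coadapted theta_inv psi_invP.

End Fplus.

(** * Comparison of F(P_+ ⊗ P_+) with P *)

Section FplusHopf.
Variables (K : fieldType) (charK : [pchar K] =i pred0).
Variables (C : symMonCat K) (good : kGoodEnough C) (H : poissonHopf C).
Let hH := po_isHopf (po_ax H).
Let hc := po_comm (po_ax H).
Local Notation DY := (upperDY (upper_spec H)).
Local Notation i := (Fplus_incl good).
Local Notation N := (Pplus_triple H).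
Local Notation cA := (Pplus (upper_spec H) (upper_monoid H)).
Local Notation A := (cA : DY).
Local Notation P := (coadaptedPoisson (Fplus_coadapted good H)).
Local Notation F := (Fplus good H).
Local Notation F2 := (mF2 (Fplus_monoidal good H) (A ⊗ A) (A ⊗ A)).
Local Notation g := (inv_r good A).
Local Notation mono := (ker_mono (incl_ker good (A ⊗ A : DY))).

Lemma incl_diagE : i (A ⊗ A : DY) ∘ g = (idm H ⊠ antip H) ∘ comul H.
Proof. exact: inv_rE. Qed.

Lemma copair_diag (h : Mor ((A ⊗ A) ⊗ (A ⊗ A) : DY) (A ⊗ A)) :
  i (A ⊗ A : DY) ∘ (fmor F h ∘ F2) ∘ (g ⊠ g)
  = tmor h ∘ (((idm H ⊠ antip H) ∘ comul H) ⊠ ((idm H ⊠ antip H) ∘ comul H)).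
Proof.
rewrite -(catA (fmor F h)) catA (FplusE good h) -catA (catA (i _)) (Fplus2E good (A ⊗ A) (A ⊗ A)).
by rewrite -tensm_comp incl_diagE.
Qed.

Lemma codiag_mul : g ∘ mul H = mul P ∘ (g ⊠ g).
Proof.
apply: mono; rewrite catA incl_diagE.
have -> : mul P = fmor F ((mo_mul cA ⊠ mo_mul cA) ∘ mid A A (sym A A)) ∘ F2.
  by rewrite fmor_comp -catA.
by rewrite copair_diag /=; dia (hopfc_rules hH hc).
Qed.

Lemma codiag_one : g ∘ one H = one P.
Proof.
apply: mono; rewrite catA incl_diagE.
transitivity ((i (A ⊗ A : DY) ∘ fmor F ((mo_one cA ⊠ mo_one cA) ∘ luniti tunit)) ∘ Fplus0 good H).
  by rewrite FplusE -[RHS]catA Fplus0E compm1 /=; dia (hopfc_rules hH hc).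
by rewrite -catA.
Qed.

(** The coproduct of [P] contains the inverse of psi, so both sides are compared after psi and then
    after the inclusion of invariants, where p_1 ⊗ S(p_2) p_3 ⊗ S(p_4) = p_1 ⊗ 1 ⊗ S(p_2). *)
Lemma codiag_comul : (g ⊠ g) ∘ comul H = comul P ∘ g.
Proof.
apply: (iso_mono (invl (psi_invP good A A))).
transitivity ((coad_psi (Fplus_monoidal good H) cA A A ∘ psi_inv good A A)
  ∘ fmor F (insertm A A (mo_one cA)) ∘ g).
  rewrite (invr (psi_invP good A A)) comp1m.
  apply: (ker_mono (incl_ker good (A ⊗ A ⊗ A : DY))).
  transitivity ((i (A ⊗ A ⊗ A : DY) ∘ coad_psi (Fplus_monoidal good H) cA A A) ∘ (g ⊠ g) ∘ comul H).
    by rewrite -!catA.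
  transitivity ((i (A ⊗ A ⊗ A : DY) ∘ fmor F (insertm A A (mo_one cA))) ∘ g); last by rewrite -!catA.
  rewrite psiE FplusE -!(catA _ (i (A ⊗ A : DY))) incl_diagE.
  transitivity (mergem (H : C) H (mul H) ∘ ((i (A ⊗ A : DY) ∘ g) ⊠ (i (A ⊗ A : DY) ∘ g)) ∘ comul H).
    by rewrite tensm_comp -!catA.
  by rewrite incl_diagE /=; dia (hopfc_rules hH hc).
rewrite -catA; exact: (congr1 (comp (coad_psi (Fplus_monoidal good H) cA A A))
  (catA (psi_inv good A A) (fmor F (insertm A A (mo_one cA))) g)).
Qed.

Lemma codiag_counit : counit P ∘ g = counit H.
Proof.
transitivity (counit H ∘ ((i A ∘ fmor F (mo_mul cA)) ∘ g)); first by rewrite -!catA.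
by rewrite (FplusE good (mo_mul cA)) -catA incl_diagE /=; dia (hopfc_rules hH hc).
Qed.

Lemma codiag_antip : g ∘ antip H = antip P ∘ g.
Proof.
apply: mono; rewrite catA incl_diagE.
transitivity ((i (A ⊗ A : DY) ∘ fmor F (sym A A)) ∘ g); last by rewrite -catA.
by rewrite (FplusE good (sym A A)) -[RHS]catA incl_diagE /=; dia (hopfc_rules hH hc).
Qed.

Lemma codiag_hopf : hopfMor (H := H) (H' := P) g.
Proof.
split; [exact: codiag_mul|exact: codiag_one|exact: codiag_comul|
  exact: codiag_counit|exact: codiag_antip].
Qed.

Lemma codiag_br : g ∘ br H = br P ∘ (g ⊠ g).
Proof.
pose X := fmor F ((mo_mul cA ⊠ mo_mul cA) ∘ mid A A (sym A A ∘ tinf A A)) ∘ F2.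
have e : X ∘ (g ⊠ g) = g ∘ br H.
  apply: mono; rewrite /X copair_diag [RHS]catA incl_diagE /= /triple_t /=.
  by dia (upper_rules H, antip_br_rules H).
rewrite -[LHS]half_double //.
have -> : br P = 2%:R^-1 *: (X ∘ (idm _ - sym _ _)) by rewrite /X fmor_comp -!catA.
rewrite compZl; congr (_ *: _).
rewrite -catA compBl comp1m sym_nat compBr (catA X) e -catA br_sym.
by rewrite compNr opprK.
Qed.

Lemma codiag_antipK : isInverse (antip P) (antipi P).
Proof. by split; rewrite -fmor_comp (symK A A) fmor1. Qed.

Lemma Fplus_codiag : isPoissonHopf P /\ poissonHopf_iso P H.
Proof.
pose d : Mor P H := drop_r N ∘ i (A ⊗ A : DY).
have fg : isInverse d (g : Mor H P) := inv_rK good A.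
have fm : hopfMor (H := P) (H' := H) d := @hopfMor_inv K C P H d g fg codiag_hopf.
have fb : d ∘ br P = br H ∘ (d ⊠ d).
  transitivity (d ∘ (br P ∘ (g ⊠ g)) ∘ (d ⊠ d)).
    by rewrite -(catA (br P)) -tensm_comp (invl fg) tensm1 compm1.
  rewrite -codiag_br; transitivity ((d ∘ (g : Mor H P)) ∘ (br H ∘ (d ⊠ d))).
    by rewrite -catA; congr (_ ∘ _); exact: esym (catA _ _ _).
  by rewrite (invr fg) comp1m.
split; first exact: (@isPoissonHopf_iso K C P H d g fg fm fb codiag_antipK).
by exists d, g.
Qed.

End FplusHopf.

Theorem theorem3p10 (K : fieldType) (charK : [pchar K] =i pred0)
    (C : symMonCat K) :
  (forall (good : cGoodEnough C) (H : coPoissonHopf C),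
    exists (cs : isCartierSpec (lowerDYspec H)) (cm : isLowerComonoid H),
    let DY := lowerDY cs in
    let M := Cminus cs cm in
    let F0 := fun V : DY => Fminus_ob good V in
    exists (F : @functor K DY C F0)
           (c : @comonoidal K DY (trivialCartier C) F0 F),
      (forall (V W : DY) (f : Mor V W),
         fmor F f ∘ Fminus_proj good V = Fminus_proj good W ∘ tmor f) /\
      (forall V W : DY,
         cF2 c V W ∘ Fminus_proj good (V ⊗ W)
         = Fminus_proj good V ⊠ Fminus_proj good W) /\
      cF0 c ∘ Fminus_proj good (tunit : DY) = idm (tunit : C) /\
      @comonoidal_inf_braided K DY (trivialCartier C) F0 F c /\
      naturally_isomorphic (functor_comp F (tens_left M)) (forget cs) /\
      sym (M : DY) M ∘ cm_comul M = cm_comul M /\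
      tinf (M : DY) M ∘ cm_comul M = 0 /\
      exists ad : adapted c M,
        isCoPoissonHopf (adaptedCoPoisson ad) /\
        coPoissonHopf_iso (adaptedCoPoisson ad) H)
  /\
  (forall (good : kGoodEnough C) (P : poissonHopf C),
    exists (cs : isCartierSpec (upperDYspec P)) (cm : isUpperMonoid P),
    let DY := upperDY cs in
    let A := Pplus cs cm in
    let F0 := fun V : DY => Fplus_ob good V in
    exists (F : @functor K DY C F0)
           (c : @monoidal K DY (trivialCartier C) F0 F),
      (forall (V W : DY) (f : Mor V W),
         Fplus_incl good W ∘ fmor F f = tmor f ∘ Fplus_incl good V) /\
      (forall V W : DY,
         Fplus_incl good (V ⊗ W) ∘ mF2 c V W
         = Fplus_incl good V ⊠ Fplus_incl good W) /\
      Fplus_incl good (tunit : DY) ∘ mF0 c = idm (tunit : C) /\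
      @monoidal_inf_braided K DY (trivialCartier C) F0 F c /\
      naturally_isomorphic (functor_comp F (tens_right A)) (forget cs) /\
      mo_mul A ∘ sym (A : DY) A = mo_mul A /\
      mo_mul A ∘ tinf (A : DY) A = 0 /\
      exists ad : coadapted c A,
        isPoissonHopf (coadaptedPoisson ad) /\
        poissonHopf_iso (coadaptedPoisson ad) P).
Proof.
split=> good H.
  exists (lower_spec H), (lower_comonoid H) => DY M F0.
  exists (Fminus good H), (Fminus_comonoidal good H).
  split; first by move=> V W f; exact: FminusE.
  split; first by move=> V W; exact: Fminus2E.
  split; first exact: Fminus0E.
  split; first exact: Fminus_inf_braided.
  split; first exact: Fminus_free.
  split; first exact: sym_comul_M.
  split; first exact: tinf_comul_M.
  by exists (Fminus_adapted good H); exact: Fminus_diag.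
exists (upper_spec H), (upper_monoid H) => DY A F0.
exists (Fplus good H), (Fplus_monoidal good H).
split; first by move=> V W f; exact: FplusE.
split; first by move=> V W; exact: Fplus2E.
split; first exact: Fplus0E.
split; first exact: Fplus_inf_braided.
split; first exact: Fplus_cofree.
split; first exact: mul_sym_A.
split; first exact: mul_tinf_A.
by exists (Fplus_coadapted good H); exact: Fplus_codiag.
Qed.
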